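(* Let $m\ge1$ be an integer, $\mathbf p=(p_1,\dots,p_m)\in[2,+\infty]^m$, and put $\left|\frac1{\mathbf p}\right|:=\frac1{p_1}+\dots+\frac1{p_m}$. Let $X$ be an infinite dimensional Banach space which has cotype $q_X$, where $q_X:=\inf\{q\ge2:\ X\text{ has cotype }q\}$, assume $\left|\frac1{\mathbf p}\right|<\frac1{q_X}$, and let $\rho>0$. The following assertions are equivalent: (A) Every bounded $m$-linear operator $A:X_{p_1}\times\dots\times X_{p_m}\to X$ satisfies \[ \sum_{i_1,\dots,i_m=1}^{+\infty}\|A(e_{i_1},\dots,e_{i_m})\|^{\rho}<+\infty . \] (B) $\displaystyle\frac1\rho\le\frac1{q_X}-\left|\frac1{\mathbf p}\right|$.
   Context: Scalars are $\mathbb K=\mathbb R$ or $\mathbb C$. For $1\le p<+\infty$, $X_p:=\ell_p$, and $X_\infty:=c_0$; $(e_i)_{i\ge1}$ denotes the canonical unit vectors; $1/\infty=0$. A Banach space $X$ has cotype $q$ ($q<+\infty$) if there is $\kappa>0$ such that for all finite families $x_1,\dots,x_n\in X$, $\left(\sum_{k=1}^n\|x_k\|^q\right)^{1/q}\le\kappa\left(\int_0^1\left\|\sum_{k=1}^n r_k(t)x_k\right\|^2dt\right)^{1/2}$, where $r_k$ is the $k$-th Rademacher function on $[0,1]$; for $q=+\infty$ the left side is replaced by $\max_k\|x_k\|$. The hypothesis includes that the infimum $q_X$ is attained. *)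

(* Defs.v *)
From HB Require Import structures.
From mathcomp Require Import all_boot all_order all_algebra.
From mathcomp Require Import complex.
From mathcomp Require Import all_classical all_reals all_analysis.

Set Implicit Arguments.
Unset Strict Implicit.
Unset Printing Implicit Defensive.

Import Order.TTheory GRing.Theory Num.Theory.
Import numFieldNormedType.Exports.

Local Open Scope classical_set_scope.
Local Open Scope ring_scope.

Variant scalar_kind := RealScalars | ComplexScalars.

Definition scalars (R : realType) (k : scalar_kind) : numFieldType :=
  match k with
  | RealScalars => R
  | ComplexScalars => (R[i])%C
  end.

(* MathComp norms over [R[i]] take values in [R[i]]; [real_part] brings the
   norm of a [scalars R k]-space back to [R]. *)
Definition real_part (R : realType) (k : scalar_kind) : scalars R k -> R :=
  match k return scalars R k -> R with
  | RealScalars => id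
  | ComplexScalars => fun z => complex.Re z
  end.

Definition rnorm (R : realType) (k : scalar_kind)
    (V : normedZmodType (scalars R k)) (x : V) : R :=
  real_part `|x|.

Definition infinite_dimensional (K : numFieldType) (X : lmodType K) : Prop :=
  ~ exists (n : nat) (v : 'I_n -> X),
      forall x : X, exists c : 'I_n -> K, x = \sum_(i < n) c i *: v i.

(* The usual Rademacher functions, with values in {-1, 0, 1} (0 only at the
   dyadic points), as integers so that they act on any additive group. *)
Definition rademacher (R : realType) (k : nat) (t : R) : int :=
  sgz (sin (2 ^+ k * pi * t)).

Section Cotype.
Context (R : realType) (k : scalar_kind).

Definition rademacher_average (X : normedModType (scalars R k)) (n : nat)
    (x : 'I_n -> X) : R :=
  Num.sqrt (\int[lebesgue_measure]_(t in `[0%R, 1%R])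
    (rnorm (\sum_(j < n) x j *~ rademacher j.+1 t)) ^+ 2).

(* The value at [-oo] is irrelevant: cotypes are taken in [2, +oo]. *)
Definition finite_lq_norm (X : normedModType (scalars R k)) (q : \bar R)
    (n : nat) (x : 'I_n -> X) : R :=
  match q with
  | EFin q' => (\sum_(j < n) rnorm (x j) `^ q') `^ q'^-1
  | +oo%E => \big[Num.max/0]_(j < n) rnorm (x j)
  | -oo%E => 0
  end.

Definition has_cotype (X : normedModType (scalars R k)) (q : \bar R) : Prop :=
  exists2 kappa : R, 0 < kappa &
    forall (n : nat) (x : 'I_n -> X),
      finite_lq_norm q x <= kappa * rademacher_average x.

Definition optimal_cotype (X : normedModType (scalars R k)) : \bar R :=
  ereal_inf [set q : \bar R | (2%:E <= q)%E /\ has_cotype X q].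

End Cotype.

Section SequenceSpaces.
Context (R : realType) (k : scalar_kind).
Local Notation K := (scalars R k).

Definition seq_norm (p : \bar R) (u : nat -> K) : \bar R :=
  ('N[counting]_p[EFin \o (fun n => rnorm (u n))])%E.

(* [l_p] for finite [p], and [c_0] (not [l_oo]) for [p = +oo]. *)
Definition in_Xp (p : \bar R) (u : nat -> K) : Prop :=
  if p == +oo%E then rnorm (u n) @[n --> \oo] --> (0 : R)
  else (seq_norm p u < +oo)%E.

(* Indexed from 0: [unit_vector i] is the canonical vector e_(i+1). *)
Definition unit_vector (i : nat) : nat -> K := fun n => (n == i)%:R.

Definition update (m : nat) (x : 'I_m -> nat -> K) (j : 'I_m) (u : nat -> K) :
    'I_m -> nat -> K :=
  fun i => if i == j then u else x i.

(* [A] is defined on all families of sequences, but only its restriction to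
   the product of the [X_(p i)] is constrained or used. *)
Definition multilinear_on (m : nat) (p : 'I_m -> \bar R)
    (X : normedModType K) (A : ('I_m -> nat -> K) -> X) : Prop :=
  forall (x : 'I_m -> nat -> K) (j : 'I_m) (a : K) (u v : nat -> K),
    (forall i, in_Xp (p i) (x i)) -> in_Xp (p j) u -> in_Xp (p j) v ->
    A (update x j (fun n => a * u n + v n)) =
    a *: A (update x j u) + A (update x j v).

Definition bounded_on (m : nat) (p : 'I_m -> \bar R)
    (X : normedModType K) (A : ('I_m -> nat -> K) -> X) : Prop :=
  exists C : R, forall x : 'I_m -> nat -> K,
    (forall i, in_Xp (p i) (x i)) ->
    rnorm (A x) <= C * \prod_(i < m) fine (seq_norm (p i) (x i)).

End SequenceSpaces.

(* Main.v *)
(* Write [e = |1/p|] and [q = q_X].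

   (B) implies (A): applying the cotype inequality successively in the [m]
   variables bounds [\sum \prod_j c^j_{i_j}^q |A(e_i)|^q] by a constant multiple
   of [\prod_j |c^j|_{p_j}^q]. One takes for [c^j_a] the power [1/p_j] of the sum
   of the [|A(e_i)|^rho] over the [i] with [i_j = a].

   (A) implies (B): if [1/q < e + 1/rho], choose [r < q] with
   [e < 1/r < e + 1/rho]. Then the identity of [X] is not [(r, 1)]-summing. For
   [q = 2] this is the Dvoretzky-Rogers theorem; for [q > 2], an
   [(r, 1)]-summing identity together with cotype [q] would give a cotype
   smaller than [q], via the variance inequality for [|\sum_i eps_i x_i|] and an
   induction over families of equal norms. Families almost extremal for
   [\sum_i |y_i|^r] under [|\sum_i eps_i y_i| <= 1] satisfy, after removing a
   small part, [|\sum_(i in A) y_i|^r <= 4 \sum_(i in A) mu_i] with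
   [mu_i = |y_i|^r], so the diagonal operators
   [x |-> \sum_i (\prod_j x^j_i) mu_i^{-e} y_i] are uniformly bounded while
   [\sum_i |mu_i^{-e} y_i|^rho] is arbitrarily large. Placing multiples of them
   on disjoint blocks of coordinates produces a bounded operator violating (A). *)
Require Import Defs.
From HB Require Import structures.
From mathcomp Require Import all_boot all_order all_algebra.
From mathcomp Require Import perm ring lra zify.
From mathcomp Require Import all_classical all_reals all_analysis.
From mathcomp Require Import complex measurable_realfun ess_sup_inf.

Set Implicit Arguments.
Unset Strict Implicit.
Unset Printing Implicit Defensive.

Import Order.TTheory GRing.Theory Num.Theory.
Import numFieldNormedType.Exports.

Local Open Scope classical_set_scope.
Local Open Scope ring_scope.

(** * The Hahn-Banach theorem *)

(** The usual source of lower bounds in a space of optimal cotype [q] is the Maurey-Pisier theorem,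
    by which [l_q] is finitely representable in [X]. Only a weaker fact is proved here: for [r < q]
    and every constant [C], some finite family has all its signed sums smaller, by the factor [C],
    than its [l_r] norm. That fact involves real signs and real functionals only, so [X] is treated
    as a real space with a seminorm, Rademacher averages are finite means over signs, identified
    once with the integral, and complex coefficients are split into real and imaginary parts when
    the diagonal operators are built. Converting the failure into a large [l_rho] norm requires
    small individual masses: the weights [mu_i ^ (- e)] gain only where [mu_i] is small, which is
    why the extremal families are taken with huge total mass before they are normalised. In the
    other direction the obstacle is that the signs chosen in one variable must serve all indices of
    the remaining variables at once. Comparing sums of [q]-th powers provides such a choice, since
    [q >= 2] lets Jensen's inequality replace any comparison of moments. *)

Record seminorm_on (R : realType) (V : lmodType R) (N : V -> R) : Prop := {
  seminormD : forall x y, N (x + y) <= N x + N y;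
  seminormZ : forall a x, N (a *: x) = `|a| * N x }.

Section HahnBanach.
Context (R : realType) (V : lmodType R).
Implicit Types (p : V -> R) (x y : V).

Definition sublinear p :=
  (forall x y, p (x + y) <= p x + p y) /\
  (forall a x, 0 <= a -> p (a *: x) <= a * p x).

Lemma sublinear_le_opp p x : sublinear p -> - p (- x) <= p x.
Proof.
move=> [pD pZ]; have p0 : 0 <= p 0 by have := pD 0 0; rewrite addr0; lra.
by have := pD x (- x); rewrite subrr; lra.
Qed.

(* The largest sublinear [p' <= p] with [p' (- y) <= - p y]: minimal sublinear
   functionals are therefore odd, hence linear. *)
Definition steepest p y x : R := inf [set p (x + t *: y) - t * p y | t in [set t | 0 <= t]].

Lemma steepest_has_inf p y x : sublinear p ->
  has_inf [set p (x + t *: y) - t * p y | t in [set t | 0 <= t]].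
Proof.
move=> sp; have [pD pZ] := sp; split; first by exists (p (x + 0 *: y) - 0 * p y), 0 => /=.
exists (- p (- x)) => _ /= [t t0 <-].
have := pD (x + t *: y) (- x); rewrite addrAC subrr add0r.
have := pZ t (- y) t0; have := pZ t y t0 => h1 h2 h3.
have [t_eq0|tn0] := eqVneq t 0.
  have := sublinear_le_opp x sp; rewrite t_eq0 scale0r addr0 mul0r subr0.
  by [].
have tV : 0 <= t^-1 by rewrite invr_ge0.
have := pZ t^-1 (t *: y) tV; rewrite scalerA mulVf // scale1r.
have tp : 0 < t by rewrite lt_def tn0.
rewrite ler_pdivlMl // => h4; lra.
Qed.

Lemma steepest_le p y x t : sublinear p -> 0 <= t ->
  steepest p y x <= p (x + t *: y) - t * p y.
Proof.
move=> sp t0; apply: ge_inf; last by exists t.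
by have [] := steepest_has_inf y x sp.
Qed.

Lemma le_steepest p y x c : sublinear p ->
  (forall t, 0 <= t -> c <= p (x + t *: y) - t * p y) -> c <= steepest p y x.
Proof.
move=> sp H; apply: lb_le_inf; first by have [] := steepest_has_inf y x sp.
by move=> _ /= [t t0 <-]; exact: H.
Qed.

Lemma steepest_le_self p y x : sublinear p -> steepest p y x <= p x.
Proof.
by move=> sp; have := steepest_le y x sp (lexx 0); rewrite scale0r addr0 mul0r subr0.
Qed.

Lemma steepest_opp p y : sublinear p -> steepest p y (- y) <= - p y.
Proof.
move=> sp; have := steepest_le y (- y) sp (@ler01 R).
rewrite scale1r mul1r addNr => h; have [_ pZ] := sp.
have := pZ 0 0 (lexx 0); rewrite scale0r mul0r; lra.
Qed.

Lemma steepest_sublinear p y : sublinear p -> sublinear (steepest p y).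
Proof.
move=> sp; have [pD pZ] := sp; split=> [x1 x2|a x a0].
  suff: steepest p y (x1 + x2) - steepest p y x2 <= steepest p y x1 by lra.
  apply: le_steepest => // t t0.
  suff: steepest p y (x1 + x2) - (p (x1 + t *: y) - t * p y) <= steepest p y x2 by lra.
  apply: le_steepest => // s s0.
  have := steepest_le y (x1 + x2) sp (addr_ge0 t0 s0).
  have := pD (x1 + t *: y) (x2 + s *: y).
  rewrite addrACA -scalerDl; lra.
have [->|an0] := eqVneq a 0.
  rewrite scale0r mul0r; apply: le_trans (steepest_le_self y 0 sp) _.
  by have := pZ 0 0 (lexx 0); rewrite scale0r mul0r.
have ap : 0 < a by rewrite lt_def an0.
rewrite mulrC -ler_pdivrMr //; apply: le_steepest => // t t0.
rewrite ler_pdivrMr //.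
have := steepest_le y (a *: x) sp (mulr_ge0 a0 t0).
have := pZ a (x + t *: y) a0; rewrite scalerDr scalerA; lra.
Qed.

(** Zorn's lemma for the reversed pointwise order. The lower bound [- p (- x)] keeps the infimum
    along a chain finite, and this infimum is subadditive because the smaller of two members of the
    chain serves both summands. *)
Lemma minimal_sublinear p : sublinear p ->
  exists2 q : V -> R, sublinear q /\ (forall x, q x <= p x) &
    forall q', sublinear q' -> (forall x, q' x <= q x) -> q' = q.
Proof.
move=> sp; pose T := {q : V -> R | sublinear q /\ (forall x, q x <= p x)}.
pose le (s t : T) := `[< forall x, sval t x <= sval s x >].
have pT : T by exists p; split.
have [|s t u|A totA|q qmin] := @ZL_preorder T pT le.
- by move=> s; apply/asboolP => x.
- by move=> /asboolP tu /asboolP st; apply/asboolP => x; exact: le_trans (st x) (tu x).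
- have [[s0 As0]|A0] := pselect (A !=set0); last first.
    by exists pT => s As; case: A0; exists s.
  pose I x := [set sval s x | s in A].
  have I_inf x : has_inf (I x).
    split; first by exists (sval s0 x), s0.
    exists (- p (- x)) => _ [s As <-]; have [ss sle] := svalP s.
    by apply: le_trans (sublinear_le_opp x ss); rewrite lerN2.
  have I_le s x : A s -> inf (I x) <= sval s x.
    by move=> As; apply: ge_inf; [have [] := I_inf x|exists s].
  have le_inf_I c x : (forall s, A s -> c <= sval s x) -> c <= inf (I x).
    by move=> H; apply: lb_le_inf; [have [] := I_inf x|move=> _ [s As <-]; exact: H].
  have sI : sublinear (fun x => inf (I x)).
    split=> [x y|a x a0].
      suff: inf (I (x + y)) - inf (I y) <= inf (I x) by lra.
      apply: (le_inf_I _) => s As.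
      suff: inf (I (x + y)) - sval s x <= inf (I y) by lra.
      apply: (le_inf_I _) => t At.
      have [/asboolP st|/asboolP ts] := totA _ _ As At.
        have := I_le t (x + y) At; have [[tD _] _] := svalP t.
        by have := tD x y; have := st x; lra.
      have := I_le s (x + y) As; have [[sD _] _] := svalP s.
      by have := sD x y; have := ts y; lra.
    have [->|an0] := eqVneq a 0.
      rewrite scale0r mul0r; apply: le_trans (I_le _ 0 As0) _.
      have [[_ sZ] _] := svalP s0.
      by have := sZ 0 0 (lexx 0); rewrite scale0r mul0r.
    have ap : 0 < a by rewrite lt_def an0.
    rewrite mulrC -ler_pdivrMr //; apply: (le_inf_I _) => s As.
    rewrite ler_pdivrMr // mulrC.
    have [[_ sZ] _] := svalP s.
    exact: le_trans (I_le _ _ As) (sZ _ _ a0).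
  have leI x : inf (I x) <= p x.
    by have [_ sle] := svalP s0; exact: le_trans (I_le _ _ As0) (sle x).
  exists (exist (fun q => sublinear q /\ (forall x, q x <= p x)) _ (conj sI leI)) => s As.
  by apply/asboolP => x /=; exact: I_le.
have [sq qle] := svalP q; exists (sval q); first by [].
move=> q' sq' q'le.
have q'p x : q' x <= p x by exact: le_trans (q'le x) (qle x).
have /asboolP qle' := qmin (exist (fun q => sublinear q /\ (forall x, q x <= p x)) q' (conj sq' q'p)) (introT (asboolP _) q'le).
by apply/funext => x; apply/eqP; rewrite eq_le q'le; exact: qle'.
Qed.

(** Minimising below [steepest N v] rather than below [N] forces [q (- v) <= - N v], so the minimal
    functional, which is linear, agrees with [N] at [v]. *)
Lemma norming_functional (N : V -> R) (v : V) : seminorm_on N ->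
  exists phi : V -> R,
    [/\ forall x y, phi (x + y) = phi x + phi y,
        forall a x, phi (a *: x) = a * phi x,
        forall x, `|phi x| <= N x
      & phi v = N v].
Proof.
move=> [ND NZ].
have sN : sublinear N by split=> // a x a0; rewrite NZ ger0_norm.
have [q [sq qle] qmin] := minimal_sublinear (steepest_sublinear v sN).
have [qD qZ] := sq.
have qN x : q (- x) = - q x.
  have e := qmin _ (steepest_sublinear x sq) (fun y => steepest_le_self x y sq).
  have := steepest_opp x sq; rewrite e => h1.
  by have := sublinear_le_opp x sq; lra.
have qadd x y : q (x + y) = q x + q y.
  apply/eqP; rewrite eq_le qD /=.
  by have := qD (x + y) (- y); rewrite addrK qN; lra.
have qpos a x : 0 <= a -> q (a *: x) = a * q x.
  move=> a0; apply/eqP; rewrite eq_le qZ //=.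
  by have := qZ a (- x) a0; rewrite scalerN !qN; lra.
have qleN x : q x <= N x by exact: le_trans (qle x) (steepest_le_self v x sN).
have NN x : N (- x) = N x by rewrite -scaleN1r NZ normrN1 mul1r.
exists q; split=> //.
- move=> a x; have [/qpos //|/ltW a0] := leP 0 a.
  have := qpos (- a) x; rewrite oppr_ge0 => /(_ a0).
  by rewrite scaleNr qN mulNr => /oppr_inj.
- move=> x; rewrite ler_norml qleN andbT lerNl -qN -[leRHS]NN.
  exact: qleN.
- apply/eqP; rewrite eq_le qleN /=.
  by have := le_trans (qle (- v)) (steepest_opp v sN); rewrite qN lerN2.
Qed.

End HahnBanach.

(** * Rademacher averages *)

Section RademacherMean.
Context (R : realType) (W : zmodType).
Implicit Types (xs ys : seq W) (f g : W -> R) (v w x : W).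

(* [rad xs f v] is the mean of [f (v + \sum_i eps_i x_i)] over all signs. *)
Fixpoint rad xs f v : R :=
  if xs is x :: xs' then (rad xs' f (v + x) + rad xs' f (v - x)) / 2 else f v.

Fixpoint signed_sums xs v : seq W :=
  if xs is x :: xs' then signed_sums xs' (v + x) ++ signed_sums xs' (v - x)
  else [:: v].

Lemma rad_le_in xs f g v : {in signed_sums xs v, forall u, f u <= g u} ->
  rad xs f v <= rad xs g v.
Proof.
elim: xs v => [|x xs IH] v /= H; first by apply: H; rewrite inE.
rewrite ler_pM2r ?invr_gt0 // lerD // IH // => u uin; apply: H;
  by rewrite mem_cat uin ?orbT.
Qed.

Lemma rad_le xs f g v : (forall u, f u <= g u) -> rad xs f v <= rad xs g v.
Proof. by move=> H; apply: rad_le_in. Qed.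

Lemma rad_cst xs c v : rad xs (fun=> c) v = c.
Proof. by elim: xs v => //= x xs IH v; rewrite !IH; lra. Qed.

Lemma radD xs f g v : rad xs (fun u => f u + g u) v = rad xs f v + rad xs g v.
Proof. by elim: xs v => //= x xs IH v; rewrite !IH; lra. Qed.

Lemma radZ xs c f v : rad xs (fun u => c * f u) v = c * rad xs f v.
Proof. by elim: xs v => //= x xs IH v; rewrite !IH; lra. Qed.

Lemma rad_sum (I : Type) (r : seq I) xs (F : I -> W -> R) v :
  rad xs (fun u => \sum_(i <- r) F i u) v = \sum_(i <- r) rad xs (F i) v.
Proof.
elim: r => [|i r IH].
  by rewrite big_nil -[RHS](rad_cst xs 0 v); congr rad; apply/funext => u; rewrite big_nil.
rewrite big_cons -IH -radD; congr rad.
by apply/funext => u; rewrite big_cons.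
Qed.

Lemma rad_ge0 xs f v : (forall u, 0 <= f u) -> 0 <= rad xs f v.
Proof. by move=> H; rewrite -(rad_cst xs 0 v); apply: rad_le. Qed.

Lemma rad_cat xs ys f v : rad (xs ++ ys) f v = rad xs (rad ys f) v.
Proof. by elim: xs v => //= x xs IH v; rewrite !IH. Qed.

Lemma rad_shift xs f v w : rad xs f (v + w) = rad xs (fun u => f (u + w)) v.
Proof.
by elim: xs v => //= x xs IH v; rewrite -!IH; congr ((rad _ _ _ + rad _ _ _) / _);
  rewrite addrAC.
Qed.

Lemma rad_cons x xs f v :
  rad (x :: xs) f v = rad xs (fun u => (f (u + x) + f (u - x)) / 2) v.
Proof.
rewrite /= !rad_shift -radD mulrC -radZ; congr rad.
by apply/funext => u; rewrite mulrC.
Qed.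

Lemma rad_opp xs f v : rad xs f (- v) = rad xs (fun u => f (- u)) v.
Proof.
elim: xs v => //= x xs IH v; rewrite -!IH addrC; congr ((_ + _) / _);
  by rewrite opprD ?opprK.
Qed.

Lemma rad_swap xs ys f v : rad (xs ++ ys) f v = rad (ys ++ xs) f v.
Proof.
elim: xs ys v => [|x xs IH] ys v; first by rewrite cats0.
have swap1 zs u : rad (zs ++ x :: xs) f u = rad (x :: zs ++ xs) f u.
  by elim: zs u => //= z zs IHz u; rewrite !IHz /= ![u + z + _]addrAC ![u - z + _]addrAC; lra.
by rewrite swap1 /= !IH.
Qed.

Lemma rad_perm xs ys f v : perm_eq xs ys -> rad xs f v = rad ys f v.
Proof.
elim: xs ys v => [|x xs IH] ys v pxy.
  by move: pxy; rewrite perm_sym => /perm_nilP ->.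
have xys : x \in ys by rewrite -(perm_mem pxy) inE eqxx.
move: pxy; case/splitPr: xys => p1 p2 pxy.
rewrite [RHS]rad_swap /=.
have {}pxy : perm_eq xs (p2 ++ p1).
  by rewrite -(perm_cons x); apply: (perm_trans pxy); rewrite perm_catC.
by rewrite !(IH _ _ pxy).
Qed.

Lemma rad_sqr_le xs f v : rad xs f v ^+ 2 <= rad xs (fun u => f u ^+ 2) v.
Proof.
have mean2 (a b A B : R) : a ^+ 2 <= A -> b ^+ 2 <= B -> ((a + b) / 2) ^+ 2 <= (A + B) / 2.
  by move=> hA hB; have := sqr_ge0 (a - b); nra.
by elim: xs v => //= x xs IH v; exact: mean2.
Qed.

Definition midpoint_convex f := forall v x, f v *+ 2 <= f (v + x) + f (v - x).

Lemma rad_ge_center xs f v : midpoint_convex f -> f v <= rad xs f v.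
Proof.
move=> cf; elim: xs v => //= x xs IH v.
have := IH (v + x); have := IH (v - x); have := cf v x; lra.
Qed.

Lemma rad_catr_le xs ys f v : midpoint_convex f -> rad ys f v <= rad (xs ++ ys) f v.
Proof.
by move=> cf; rewrite rad_swap rad_cat; apply: rad_le => u; exact: rad_ge_center.
Qed.

Lemma rad_mean_signed_sums xs f v :
  rad xs f v = (\sum_(u <- signed_sums xs v) f u) / 2 ^+ size xs.
Proof.
elim: xs v => [|x xs IH] v /=; first by rewrite big_seq1 divr1.
by rewrite big_cat !IH /= exprS invfM; lra.
Qed.

Lemma mem_signed_sums xs v u : u \in signed_sums xs v ->
  exists2 ss : seq bool, size ss = size xs &
    u = v + \sum_(p <- zip ss xs) (if p.1 then p.2 else - p.2).
Proof.
elim: xs v => [|x xs IH] v /=.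
  by rewrite inE => /eqP ->; exists [::] => //; rewrite big_nil addr0.
rewrite mem_cat => /orP[] /IH [ss sz ->].
  by exists (true :: ss); rewrite /= ?sz // big_cons addrA.
by exists (false :: ss); rewrite /= ?sz // big_cons addrA.
Qed.

(** The signed sums of the blocks are drawn independently and handed over as a list, so that [F] may
    depend on all of them jointly. *)
Fixpoint rad_blocks (xss : seq (seq W)) (F : seq W -> R) : R :=
  if xss is xs :: xss' then rad xs (fun z => rad_blocks xss' (fun zs => F (z :: zs))) 0
  else F [::].

Lemma rad_blocks_le xss (F G : seq W -> R) :
  (forall zs, size zs = size xss -> F zs <= G zs) -> rad_blocks xss F <= rad_blocks xss G.
Proof.
elim: xss F G => [|xs xss IH] F G H /=; first exact: H.
by apply: rad_le => z; apply: IH => zs sz; apply: H; rewrite /= sz.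
Qed.

Lemma rad_blocksZ xss c F : rad_blocks xss (fun zs => c * F zs) = c * rad_blocks xss F.
Proof.
elim: xss F => //= xs xss IH F; rewrite -radZ; congr rad.
by apply/funext => z; rewrite IH.
Qed.

Lemma rad_blocksD xss F G :
  rad_blocks xss (fun zs => F zs + G zs) = rad_blocks xss F + rad_blocks xss G.
Proof.
elim: xss F G => //= xs xss IH F G; rewrite -radD; congr rad.
by apply/funext => z; rewrite IH.
Qed.

Lemma rad_blocks_cst xss c : rad_blocks xss (fun=> c) = c.
Proof.
elim: xss => //= xs xss IH; rewrite -[RHS](rad_cst xs c 0); congr rad.
by apply/funext.
Qed.

Lemma rad_blocks_ge0 xss F : (forall zs, 0 <= F zs) -> 0 <= rad_blocks xss F.
Proof. by move=> H; rewrite -(rad_blocks_cst xss 0); apply: rad_blocks_le. Qed.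

Lemma rad_blocks_sum xss (c : nat -> R) g :
  rad_blocks xss (fun zs => \sum_(j < size xss) c j * g (nth 0 zs j)) =
  \sum_(j < size xss) c j * rad (nth [::] xss j) g 0.
Proof.
elim: xss c => [|xs xss IH] c /=; first by rewrite !big_ord0.
rewrite big_ord_recl /=; under [X in rad _ X]eq_fun => z.
  under [X in rad_blocks _ X]eq_fun => zs do rewrite big_ord_recl /=.
  rewrite rad_blocksD rad_blocks_cst.
  rewrite (IH (fun j => c j.+1)).
  over.
by rewrite radD radZ rad_cst.
Qed.

(** The signed sum of a block is symmetrically distributed, so one more independent sign in front of
    each block leaves the mean unchanged. *)
Lemma rad_blocks_flatten xss h :
  rad_blocks xss (fun zs => rad zs h 0) = rad (flatten xss) h 0.
Proof.
elim: xss h => [|xs xss IH] h //=; rewrite rad_cat.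
have key z : rad_blocks xss (fun zs => (rad zs h (0 + z) + rad zs h (0 - z)) / 2) =
    2^-1 * (rad (flatten xss) h z + rad (flatten xss) h (- z)).
  rewrite -[in RHS](add0r z) -[in X in _ * (_ + X)](add0r (- (0 + z))) !rad_shift -!IH.
  rewrite -rad_blocksD -rad_blocksZ; congr rad_blocks; apply/funext => zs.
  by rewrite !rad_shift add0r mulrC.
under [X in rad _ X]eq_fun => z do rewrite key.
rewrite radZ radD -[X in _ + X](rad_opp xs (rad (flatten xss) h) 0) oppr0; lra.
Qed.

End RademacherMean.

Section FiniteHoelder.
Context (R : realType).

(** The weights [A i ^ (s - 1)] give Hölder's inequality the dual form from which Minkowski's
    inequality follows. Young's inequality is applied to the terms divided by the two [l_s] norms
    [P] and [Q]. *)
Lemma hoelder_sum (I : finType) (a A : I -> R) (s : R) : 1 <= s ->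
  (forall i, 0 <= a i) -> (forall i, 0 <= A i) ->
  \sum_i A i `^ (s - 1) * a i <=
  (\sum_i a i `^ s) `^ s^-1 * (\sum_i A i `^ s) `^ (1 - s^-1).
Proof.
move=> s1 a0 A0.
have s0 : 0 < s by lra.
have sn0 : s != 0 by lra.
set S := \sum_i a i `^ s; set B := \sum_i A i `^ s.
have S0 : 0 <= S by apply: sumr_ge0 => i _; exact: powR_ge0.
have B0 : 0 <= B by apply: sumr_ge0 => i _; exact: powR_ge0.
(* The conjugate exponent [s / (s - 1)] is meaningless at [s = 1]. *)
have [s_eq1|sn1] := eqVneq s 1.
  rewrite /S /B s_eq1 invr1 subrr powRr0 mulr1 powRr1; last first.
    by apply: sumr_ge0 => i _; exact: powR_ge0.
  by apply: ler_sum => i _; rewrite powRr0 powRr1 // mul1r.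
have sgt1 : 1 < s by rewrite lt_def sn1.
have sm1 : 0 < s - 1 by lra.
have zero_sum (b : I -> R) : \sum_i b i `^ s = 0 -> forall i, b i = 0.
  move=> bs0 i; apply: (@powR_eq0_eq0 _ _ s).
  by apply: (psumr_eq0P _ bs0) => // j _; exact: powR_ge0.
have [S_eq0|Sn0] := eqVneq S 0.
  rewrite big1 ?mulr_ge0 ?powR_ge0 // => i _.
  by rewrite (zero_sum _ S_eq0) mulr0.
have [B_eq0|Bn0] := eqVneq B 0.
  rewrite big1 ?mulr_ge0 ?powR_ge0 // => i _.
  by rewrite (zero_sum _ B_eq0) powR0 ?mul0r // gt_eqF.
have Sp : 0 < S by rewrite lt_def Sn0.
have Bp : 0 < B by rewrite lt_def Bn0.
set P := S `^ s^-1; set Q := B `^ s^-1.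
have Pp : 0 < P by exact: powR_gt0.
have Qp : 0 < Q by exact: powR_gt0.
have Ps : P `^ s = S by rewrite /P -powRrM mulVf // powRr1.
have Qs : Q `^ s = B by rewrite /Q -powRrM mulVf // powRr1.
have BQ : B `^ (1 - s^-1) = Q `^ (s - 1).
  by rewrite /Q -powRrM; congr (_ `^ _); rewrite mulrBr mulVf // mulr1.
rewrite BQ; clearbody P Q.
have young i : A i `^ (s - 1) * a i <=
    (P * Q `^ (s - 1)) * (a i `^ s / S * s^-1 + A i `^ s / B * (1 - s^-1)).
  have := @conjugate_powR R (a i / P) ((A i / Q) `^ (s - 1)) s (s / (s - 1)).
  rewrite divr_ge0 ?powR_ge0 ?(ltW Pp) // => /(_ isT isT s0).
  rewrite divr_gt0 // => /(_ isT).
  have -> : s^-1 + (s / (s - 1))^-1 = 1 by rewrite invf_div mulrBl divff // mul1r addrC subrK.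
  move=> /(_ erefl).
  rewrite -powRrM.
  have -> : (s - 1) * (s / (s - 1)) = s by rewrite mulrC divfK // gt_eqF.
  have pd (x y t : R) : 0 <= x -> 0 < y -> (x / y) `^ t = x `^ t / y `^ t.
    move=> x0 y0; rewrite powRM ?invr_ge0 ?(ltW y0) //.
    by rewrite -[y^-1]powR_inv1 ?(ltW y0) // -powRrM mulN1r powRN.
  rewrite (pd (a i) P s) // (pd (A i) Q s) // (pd (A i) Q (s - 1)) // Ps Qs => H.
  have Q1 : 0 < Q `^ (s - 1) by exact: powR_gt0.
  have -> : A i `^ (s - 1) * a i = P * Q `^ (s - 1) * (a i / P * (A i `^ (s - 1) / Q `^ (s - 1))).
    rewrite mulrACA (mulrC P) divfK ?gt_eqF //.
    by rewrite [X in _ = _ * X]mulrC divfK ?gt_eqF // mulrC.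
  rewrite ler_pM2l ?mulr_gt0 //; apply: (le_trans H).
  by rewrite invf_div lerD2l ler_wpM2l ?mulr_ge0 ?invr_ge0 ?powR_ge0 // mulrBl divff // mul1r.
apply: (le_trans (ler_sum _ (fun i _ => young i))).
rewrite -mulr_sumr big_split /= -!mulr_suml -/S -/B !divff //.
by rewrite !mul1r addrC subrK mulr1.
Qed.

End FiniteHoelder.

(** * Rademacher averages of a seminorm: monotonicity, contraction, variance *)

Section NormedMean.
Context (R : realType) (V : lmodType R) (N : V -> R).
Hypothesis normN : seminorm_on N.
Implicit Types (xs ys zs : seq V) (u v x y : V).

Let ND := seminormD normN.
Let NZ := seminormZ normN.

Lemma seminorm0 : N 0 = 0.
Proof. by have := NZ 0 0; rewrite scale0r normr0 mul0r. Qed.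

Lemma seminormN x : N (- x) = N x.
Proof. by rewrite -scaleN1r NZ normrN1 mul1r. Qed.

Lemma seminorm_ge0 x : 0 <= N x.
Proof. by have := ND x (- x); rewrite subrr seminorm0 seminormN; lra. Qed.

Lemma seminorm_midpoint x v : N v *+ 2 <= N (v + x) + N (v - x).
Proof.
have := ND (v + x) (v - x); rewrite addrACA subrr addr0 -mulr2n.
rewrite -scaler_nat NZ ger0_norm ?ler0n // mulr2n; lra.
Qed.

Lemma seminorm_sqr_convex : midpoint_convex (fun v => N v ^+ 2).
Proof.
move=> v x; have := seminorm_midpoint x v.
have := seminorm_ge0 v; have := seminorm_ge0 (v + x); have := seminorm_ge0 (v - x).
move: (N v) (N (v + x)) (N (v - x)) => a b c c0 b0 a0 h.
have := sqr_ge0 (b - c); have : 0 <= (b + c - a *+ 2) * (b + c + a *+ 2).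
  by apply: mulr_ge0; lra.
nra.
Qed.

Definition avg2 xs : R := rad xs (fun u => N u ^+ 2) 0.

Definition avg xs : R := Num.sqrt (avg2 xs).

Lemma avg2_ge0 xs : 0 <= avg2 xs.
Proof. by apply: rad_ge0 => u; exact: sqr_ge0. Qed.

Lemma avg_ge0 xs : 0 <= avg xs. Proof. exact: sqrtr_ge0. Qed.

Lemma avg_sqr xs : avg xs ^+ 2 = avg2 xs.
Proof. by rewrite sqr_sqrtr // avg2_ge0. Qed.

Lemma avg_perm xs ys : perm_eq xs ys -> avg xs = avg ys.
Proof. by move=> p; rewrite /avg /avg2 (rad_perm _ _ p). Qed.

Lemma avg_catr_le xs ys : avg ys <= avg (xs ++ ys).
Proof. by rewrite ler_sqrt ?avg2_ge0 //; apply: rad_catr_le; exact: seminorm_sqr_convex. Qed.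

Lemma avg_catl_le xs ys : avg xs <= avg (xs ++ ys).
Proof.
by rewrite (avg_perm (permEl (perm_catC xs ys))); exact: avg_catr_le.
Qed.

Lemma avg_seq1 x : avg [:: x] = N x.
Proof.
rewrite /avg /avg2 /= add0r sub0r seminormN.
by rewrite (_ : _ / 2 = N x ^+ 2) ?sqrtr_sqr ?ger0_norm ?seminorm_ge0 //; lra.
Qed.

Lemma norm_le_avg xs x : x \in xs -> N x <= avg xs.
Proof.
move=> xin; rewrite -avg_seq1.
have /avg_perm -> : perm_eq xs ([:: x] ++ rem x xs) by exact: perm_to_rem.
exact: avg_catl_le.
Qed.

Lemma rad_norm_le_avg xs : rad xs N 0 <= avg xs.
Proof.
have n0 : 0 <= rad xs N 0 by apply: rad_ge0 => u; exact: seminorm_ge0.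
rewrite -[leLHS](ger0_norm n0) -sqrtr_sqr ler_sqrt ?avg2_ge0 //.
exact: rad_sqr_le.
Qed.

(** Coefficients are removed one at a time. Both [w + c x] and [w - c x] are convex combinations of
    [w + x] and [w - x], with exchanged weights, so their squared norms add up to no more than those
    of [w + x] and [w - x]. *)
Lemma rad_contraction_sqr (c : V -> R) xs v : (forall x, 0 <= c x <= 1) ->
  rad [seq c x *: x | x <- xs] (fun u => N u ^+ 2) v <= rad xs (fun u => N u ^+ 2) v.
Proof.
move=> c01.
suff H zs : rad (zs ++ [seq c x *: x | x <- xs]) (fun u => N u ^+ 2) v <=
            rad (zs ++ xs) (fun u => N u ^+ 2) v by exact: (H [::]).
elim: xs zs => [|x xs IH] zs //.
apply: (@le_trans _ _ (rad (zs ++ x :: [seq c x *: x | x <- xs]) (fun u => N u ^+ 2) v)); last first.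
  by rewrite -!cat_rcons; exact: IH.
rewrite rad_cat [leRHS]rad_cat; apply: rad_le => u.
rewrite !rad_cons; apply: rad_le => w.
rewrite ler_pM2r ?invr_gt0 //.
have /andP[c0 c1] := c01 x.
have split (e : R) : `|e| <= 1 -> N (w + e *: x) <= (1 + e) / 2 * N (w + x) + (1 - e) / 2 * N (w - x).
  rewrite ler_norml => /andP[e1 e2].
  have -> : w + e *: x = ((1 + e) / 2) *: (w + x) + ((1 - e) / 2) *: (w - x).
    rewrite !scalerDr !scalerN addrACA -scalerDl -scalerBl.
    have -> : (1 + e) / 2 + (1 - e) / 2 = 1 by lra.
    have -> : (1 + e) / 2 - (1 - e) / 2 = e by lra.
    by rewrite scale1r.
  apply: (le_trans (ND _ _)); rewrite !NZ !ger0_norm //; lra.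
have c1' : `|c x| <= 1 by rewrite ger0_norm.
have := split _ c1'.
have := @split (- c x); rewrite normrN scaleNr => /(_ c1').
have := seminorm_ge0 (w + x); have := seminorm_ge0 (w - x).
have := seminorm_ge0 (w + c x *: x); have := seminorm_ge0 (w - c x *: x).
set A := N (w + x); set B := N (w - x); set a := N (w + c x *: x); set b := N (w - c x *: x).
move: (c x) c0 c1 => e e0 e1 b0 a0 B0 A0 hb ha.
have h1 : a ^+ 2 <= ((1 + e) / 2 * A + (1 - e) / 2 * B) ^+ 2 by rewrite ler_pXn2r ?nnegrE //; nra.
have h2 : b ^+ 2 <= ((1 - e) / 2 * A + (1 + e) / 2 * B) ^+ 2 by rewrite ler_pXn2r ?nnegrE //; nra.
(* This is exactly what the convex combinations lose once the squares are expanded. *)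
have h3 : 0 <= (1 - e ^+ 2) / 2 * (A - B) ^+ 2.
  by rewrite mulr_ge0 ?sqr_ge0 //; nra.
apply: (le_trans (lerD h1 h2)); rewrite -subr_ge0; apply: le_trans h3 _.
by rewrite le_eqVlt; apply/orP; left; apply/eqP; field.
Qed.

Lemma avg_contraction (c : V -> R) xs : (forall x, 0 <= c x <= 1) ->
  avg [seq c x *: x | x <- xs] <= avg xs.
Proof. by move=> c01; rewrite ler_sqrt ?avg2_ge0 //; exact: rad_contraction_sqr. Qed.

Lemma avg2_scale a xs : avg2 [seq a *: x | x <- xs] = a ^+ 2 * avg2 xs.
Proof.
rewrite /avg2 -[in LHS](scaler0 _ a); elim: xs (0 : V) => [|x xs IH] v /=.
  by rewrite NZ exprMn real_normK ?num_real.
by rewrite -scalerDr -scalerBr !IH; lra.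
Qed.

Lemma avg_scale a xs : 0 <= a -> avg [seq a *: x | x <- xs] = a * avg xs.
Proof. by move=> a0; rewrite /avg avg2_scale sqrtrM ?sqr_ge0 // sqrtr_sqr ger0_norm. Qed.

Lemma seminorm_functionals : exists nf : V -> V -> R, forall u,
    [/\ forall x y, nf u (x + y) = nf u x + nf u y,
        forall a x, nf u (a *: x) = a * nf u x,
        forall x, `|nf u x| <= N x
      & nf u u = N u].
Proof.
have [nf Hnf] := boolp.choice (fun u => @norming_functional R V N u normN).
by exists nf.
Qed.

(* Efron-Stein: flipping the sign of [x] decreases [N u] by at most
   [2 |nf u x|], where [nf u] norms [u]. *)
Lemma rad_variance (nf : V -> V -> R) xs v :
  (forall u, [/\ forall x y, nf u (x + y) = nf u x + nf u y,
        forall a x, nf u (a *: x) = a * nf u x,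
        forall x, `|nf u x| <= N x & nf u u = N u]) ->
  rad xs (fun u => N u ^+ 2) v - (rad xs N v) ^+ 2 <=
  2 * rad xs (fun u => \sum_(x <- xs) nf u x ^+ 2) v.
Proof.
move=> Hnf; elim: xs v => [|x xs IH] v /=; first by rewrite subrr big_nil mulr0.
have sum_cons w : rad xs (fun u => \sum_(y <- x :: xs) nf u y ^+ 2) w =
    rad xs (fun u => nf u x ^+ 2) w + rad xs (fun u => \sum_(y <- xs) nf u y ^+ 2) w.
  by rewrite -radD; congr rad; apply/funext => u; rewrite big_cons.
rewrite !sum_cons; have := IH (v + x); have := IH (v - x).
set A1 := rad xs (fun u => N u ^+ 2) _; set A2 := rad xs (fun u => N u ^+ 2) _.
set B1 := rad xs N (v - x); set B2 := rad xs N (v + x).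
(* The variance is the mean of the two variances given the sign of [x], bounded by induction, plus
   the squared half difference of the two conditional means. *)
have key : ((B2 - B1) / 2) ^+ 2 <= rad xs (fun u => nf u x ^+ 2) (v + x) + rad xs (fun u => nf u x ^+ 2) (v - x).
  have -> : B2 - B1 = rad xs (fun u => N (u + x) - N (u - x)) v.
    rewrite /B2 /B1 !rad_shift -mulN1r -radZ -radD; congr rad.
    by apply/funext => u; rewrite mulN1r.
  rewrite mulrC -radZ !rad_shift -radD.
  apply: le_trans (rad_sqr_le _ _ _) _; apply: rad_le => u.
  have [pD pZ ple pu] := Hnf (u + x); have [qD qZ qle qu] := Hnf (u - x).
  set a := nf (u + x) x; set b := nf (u - x) x.
  have h1 : N (u + x) - N (u - x) <= 2 * a.
    have := le_trans (ler_norm _) (ple (u - x)).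
    rewrite -scaleN1r pD pZ -/a; move: pu; rewrite pD -/a; lra.
  have h2 : N (u - x) - N (u + x) <= - 2 * b.
    have := le_trans (ler_norm _) (qle (u + x)).
    rewrite qD -/b; move: qu; rewrite -{2}scaleN1r qD qZ -/b; lra.
  have [d0|d0] := leP 0 (N (u + x) - N (u - x)); nra.
move: (rad xs (fun u => nf u x ^+ 2) (v + x)) (rad xs (fun u => nf u x ^+ 2) (v - x)) key => D1 D2.
move: (rad xs _ (v + x)) (rad xs _ (v - x)) => C1 C2; nra.
Qed.

End NormedMean.

(** * Averages of blocks *)

Section PowR.
Context (R : realType).

Lemma sqr_powR_half (a r : R) : 0 <= a -> (a ^+ 2) `^ (r / 2) = a `^ r.
Proof. by move=> a0; rewrite -powR_mulrn // -powRrM mulrC divfK // pnatr_eq0. Qed.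

Lemma powR_half_inv (a r : R) : 0 <= a -> r != 0 -> (a `^ r^-1) ^+ 2 = a `^ (r / 2)^-1.
Proof. by move=> a0 r0; rewrite -powR_mulrn ?powR_ge0 // -powRrM invf_div mulrC. Qed.

End PowR.

Section Blocks.
Context (R : realType) (V : lmodType R) (N : V -> R).
Hypothesis normN : seminorm_on N.
Implicit Types (xs ys zs : seq V) (xss yss : seq (seq V)).

(** Duality: against the weights [A j ^ (s - 1)] built from the block means, the left side becomes
    linear in the means, and Hölder's inequality is applied to each draw. *)
Lemma rad_blocks_minkowski yss (g : V -> R) (s : R) : 1 <= s -> (forall v, 0 <= g v) ->
  (\sum_(ys <- yss) rad ys g 0 `^ s) `^ s^-1 <=
  rad_blocks yss (fun zs => (\sum_(z <- zs) g z `^ s) `^ s^-1).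
Proof.
move=> s1 g0; have s0 : 0 < s by lra.
pose A (j : 'I_(size yss)) := rad (nth [::] yss j) g 0.
have A0 j : 0 <= A j by exact: rad_ge0.
have -> : \sum_(ys <- yss) rad ys g 0 `^ s = \sum_j A j `^ s.
  by rewrite (big_nth [::]) big_mkord.
set B := \sum_j A j `^ s.
have B0 : 0 <= B by apply: sumr_ge0 => j _; exact: powR_ge0.
have [->|Bn0] := eqVneq B 0.
  rewrite powR0; last by rewrite invr_eq0 gt_eqF.
  by apply: rad_blocks_ge0 => zs; exact: powR_ge0.
have Bp : 0 < B by rewrite lt_def Bn0.
rewrite -(@ler_pM2r _ (B `^ (1 - s^-1))) ?powR_gt0 //.
rewrite -powRD; last by rewrite Bn0 implybT.
rewrite addrCA subrr addr0 powRr1 // mulrC -rad_blocksZ.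
apply: (@le_trans _ _ (rad_blocks yss (fun zs => \sum_(j < size yss)
    (if insub (val j) is Some i then A i `^ (s - 1) else 0) * g (nth 0 zs j)))).
  rewrite (rad_blocks_sum yss (fun j => if insub j is Some i then A i `^ (s - 1) else 0) g).
  apply: ler_sum => j _; rewrite valK -/(A j) mulrC mulr_powRB1 //.
apply: rad_blocks_le => zs sz.
have -> : \sum_(z <- zs) g z `^ s = \sum_(j < size yss) g (nth 0 zs j) `^ s.
  by rewrite (big_nth 0) big_mkord sz.
rewrite mulrC; under eq_bigr => j _ do rewrite valK.
exact: (hoelder_sum (a := fun j : 'I_(size yss) => g (nth 0 zs j)) s1).
Qed.

Lemma avg2_half_pow yss r : \sum_(ys <- yss) avg N ys `^ r = \sum_(ys <- yss) avg2 N ys `^ (r / 2).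
Proof. by apply: eq_bigr => ys _; rewrite -avg_sqr sqr_powR_half // avg_ge0. Qed.

Lemma avg_blocks_le_rad yss r : 2 <= r ->
  (\sum_(ys <- yss) avg N ys `^ r) `^ (r / 2)^-1 <=
  rad_blocks yss (fun zs => ((\sum_(z <- zs) N z `^ r) `^ r^-1) ^+ 2).
Proof.
move=> r2; rewrite avg2_half_pow.
have s1 : 1 <= r / 2 by rewrite ler_pdivlMr ?mul1r.
apply: le_trans (rad_blocks_minkowski yss s1 (fun v => sqr_ge0 (N v))) _.
apply: rad_blocks_le => zs _.
rewrite powR_half_inv; last 2 first.
- by apply: sumr_ge0 => z _; exact: powR_ge0.
- by rewrite gt_eqF //; lra.
rewrite (eq_bigr (fun z => N z `^ r)) // => z _.
by rewrite sqr_powR_half // (seminorm_ge0 normN).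
Qed.

(** The cotype inequality is applied to one random signed sum per block, and the signs it adds are
    absorbed by [rad_blocks_flatten]. Blocks measured by their averages thus have cotype [q] with
    the same constant. *)
Lemma avg_blocks_le_cotype yss q K : 2 <= q ->
  (forall zs, (\sum_(z <- zs) N z `^ q) `^ q^-1 <= K * avg N zs) ->
  (\sum_(ys <- yss) avg N ys `^ q) `^ (q / 2)^-1 <= K ^+ 2 * avg2 N (flatten yss).
Proof.
move=> q2 HK; apply: le_trans (avg_blocks_le_rad yss q2) _.
rewrite /avg2 -rad_blocks_flatten -rad_blocksZ; apply: rad_blocks_le => zs _.
have p0 : 0 <= (\sum_(z <- zs) N z `^ q) `^ q^-1 by exact: powR_ge0.
rewrite -[rad zs _ 0]avg_sqr -exprMn ler_pXn2r ?nnegrE //.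
exact: le_trans (HK zs).
Qed.

(* The maximum over the [2 ^ k] signed sums of the blocks is controlled by the
   variance of the norm, which is small when all the functionals are. *)
Lemma avg_blocks_le_summing yss r C (nf : V -> V -> R) sigma : 2 <= r ->
  (forall zs, exists2 u, u \in signed_sums zs 0 &
     (\sum_(z <- zs) N z `^ r) `^ r^-1 <= C * N u) ->
  (forall u, [/\ forall x y, nf u (x + y) = nf u x + nf u y,
        forall a x, nf u (a *: x) = a * nf u x,
        forall x, `|nf u x| <= N x & nf u u = N u]) ->
  {in signed_sums (flatten yss) 0, forall u, \sum_(x <- flatten yss) nf u x ^+ 2 <= sigma} ->
  (\sum_(ys <- yss) avg N ys `^ r) `^ (r / 2)^-1 <=
    C ^+ 2 * (2 * avg2 N (flatten yss) + 4 * 2 ^+ size yss * sigma).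
Proof.
move=> r2 HC Hnf Hs; apply: le_trans (avg_blocks_le_rad yss r2) _.
set m := rad (flatten yss) N 0.
have m0 : 0 <= m by apply: rad_ge0 => u; exact: seminorm_ge0 normN u.
have var : rad (flatten yss) (fun u => (N u - m) ^+ 2) 0 <= 2 * sigma.
  have -> : rad (flatten yss) (fun u => (N u - m) ^+ 2) 0 = avg2 N (flatten yss) - m ^+ 2.
    have -> : (fun u => (N u - m) ^+ 2) = (fun u => N u ^+ 2 + ((- (2 * m)) * N u + m ^+ 2)).
      by apply/funext => u; ring.
    by rewrite !radD radZ rad_cst -/m /avg2; ring.
  rewrite /avg2 /m; apply: le_trans (rad_variance (flatten yss) 0 Hnf) _.
  rewrite ler_pM2l // -[leRHS](rad_cst (flatten yss) sigma 0).
  exact: rad_le_in.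
(* [N u] is at most [m] plus its deviation from [m]. Replacing the deviation at the unknown [u] by a
   mean costs the number [2 ^ size yss] of signed sums. *)
apply: (@le_trans _ _ (C ^+ 2 * (2 * m ^+ 2 + (2 * 2 ^+ size yss) *
    rad (flatten yss) (fun u => (N u - m) ^+ 2) 0))); last first.
  rewrite ler_wpM2l ?sqr_ge0 // lerD //.
    by rewrite ler_pM2l // /m /avg2 rad_sqr_le.
  apply: le_trans (ler_wpM2l _ var) _; first by rewrite mulr_ge0 ?exprn_ge0.
  by rewrite le_eqVlt; apply/orP; left; apply/eqP; ring.
rewrite -rad_blocks_flatten -rad_blocksZ -[2 * m ^+ 2](rad_blocks_cst yss).
rewrite -rad_blocksD -rad_blocksZ; apply: rad_blocks_le => zs sz.
have [u uin hu] := HC zs.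
have p0 : 0 <= (\sum_(z <- zs) N z `^ r) `^ r^-1 by exact: powR_ge0.
apply: (@le_trans _ _ ((C * N u) ^+ 2)).
  by rewrite ler_pXn2r ?nnegrE // (le_trans p0).
rewrite exprMn ler_wpM2l ?sqr_ge0 //.
rewrite rad_mean_signed_sums sz -mulrA [X in _ + 2 * X]mulrC divfK ?expf_neq0 ?pnatr_eq0 //.
have : (N u - m) ^+ 2 <= \sum_(w <- signed_sums zs 0) (N w - m) ^+ 2.
  rewrite (big_rem u) //= lerDl; apply: sumr_ge0 => w _; exact: sqr_ge0.
have := sqr_ge0 (N u - m - m).
move: (\sum_(w <- _) _) => S; nra.
Qed.

End Blocks.

(** * Halving a family *)

Section MaxOverFunctionals.
Context (R : realType) (T : eqType) (us : seq T).
Implicit Types (a b g : T -> R).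

Definition maxf a : R := \big[Num.max/0]_(u <- us) a u.

Lemma maxf_ge0 a : 0 <= maxf a.
Proof.
rewrite /maxf; elim: us => [|u l IH]; first by rewrite big_nil.
by rewrite big_cons le_max IH orbT.
Qed.

Lemma maxf_ge a u : u \in us -> a u <= maxf a.
Proof.
rewrite /maxf; elim: us => [|w l IH] //; rewrite inE big_cons le_max.
by case/orP => [/eqP -> | /IH ->]; rewrite ?lexx ?orbT.
Qed.

Lemma maxf_le a c : 0 <= c -> {in us, forall u, a u <= c} -> maxf a <= c.
Proof.
rewrite /maxf => c0; elim: us => [|w l IH] H; first by rewrite big_nil.
rewrite big_cons ge_max H ?mem_head // IH // => u ul.
by apply: H; rewrite inE ul orbT.
Qed.

Lemma maxf_attained a : maxf a = 0 \/ exists2 u, u \in us & maxf a = a u.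
Proof.
rewrite /maxf; elim: us => [|w l IH]; first by left; rewrite big_nil.
rewrite big_cons; have [h|h] := leP (a w) (\big[Num.max/0]_(u <- l) a u).
  case: IH => [->|[u ul ->]]; [by left|right].
  by exists u => //; rewrite inE ul orbT.
by right; exists w => //; rewrite mem_head.
Qed.

Lemma maxfD a b : maxf (a + b) <= maxf a + maxf b.
Proof.
by apply: maxf_le => [|u uin]; rewrite ?addr_ge0 ?maxf_ge0 //; apply: lerD; exact: maxf_ge.
Qed.

(* One step of the contraction principle for [t |-> t ^ 2], which is
   2-Lipschitz on [-1, 1]. *)
Lemma maxf_sqr_contraction a g : {in us, forall u, `|g u| <= 1} ->
  maxf (a + (fun u => g u ^+ 2)) + maxf (a - (fun u => g u ^+ 2)) <=
  maxf (a + (fun u => 2 * g u)) + maxf (a - (fun u => 2 * g u)).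
Proof.
move=> g1; set b := fun u => g u ^+ 2; set c := fun u => 2 * g u.
have P u : u \in us -> a u + 2 * g u <= maxf (a + c) by exact: (maxf_ge (a + c)).
have Q u : u \in us -> a u - 2 * g u <= maxf (a - c) by exact: (maxf_ge (a - c)).
have P0 := maxf_ge0 (a + c); have Q0 := maxf_ge0 (a - c).
have one u : u \in us -> a u + g u ^+ 2 <= maxf (a + c) + maxf (a - c).
  move=> uin; have := P _ uin; have := Q _ uin; have := g1 _ uin.
  by rewrite ler_norml => /andP[h1 h2]; have [h|h] := leP 0 (g u); nra.
have [->|[u uin ->]] := maxf_attained (a + b);
  have [->|[v vin ->]] := maxf_attained (a - b).
- by rewrite addr0 addr_ge0.
- rewrite add0r; apply: le_trans (one v vin); rewrite -subr_ge0.
  rewrite (_ : _ - _ = 2 * g v ^+ 2); first by rewrite mulr_ge0 ?sqr_ge0.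
  by rewrite -[(a - b) v]/(a v - g v ^+ 2); ring.
- by rewrite addr0; exact: one.
rewrite -[(a + b) u]/(a u + g u ^+ 2) -[(a - b) v]/(a v - g v ^+ 2).
have := P _ uin; have := Q _ uin; have := P _ vin; have := Q _ vin.
have := g1 _ uin; have := g1 _ vin; rewrite !ler_norml => /andP[h1 h2] /andP[h3 h4].
move: (g u) (g v) (a u) (a v) h1 h2 h3 h4 => x y au av h1 h2 h3 h4 *.
have [h|h] := leP y x.
  have : 0 <= (x - y) * (2 - (x + y)) by apply: mulr_ge0; lra.
  nra.
have : 0 <= (y - x) * (2 + (x + y)) by apply: mulr_ge0; lra.
nra.
Qed.

Lemma rad_maxf_sqr (X : eqType) (xs : seq X) (G : X -> T -> R) a :
  {in xs, forall x, {in us, forall u, `|G x u| <= 1}} ->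
  rad [seq (fun u => G x u ^+ 2) : T -> R | x <- xs] maxf a <=
  rad [seq (fun u => 2 * G x u) : T -> R | x <- xs] maxf a.
Proof.
elim: xs a => [|x xs IH] a H //.
have Hg : {in us, forall u, `|G x u| <= 1} by apply: H; exact: mem_head.
have {}IH b : rad [seq (fun u => G x u ^+ 2) : T -> R | x <- xs] maxf b <=
    rad [seq (fun u => 2 * G x u) : T -> R | x <- xs] maxf b.
  by apply: IH => y yin; apply: H; rewrite inE yin orbT.
rewrite [leLHS]/=; apply: (@le_trans _ _ ((rad [seq (fun u => 2 * G x u) : T -> R | x <- xs] maxf (a + (fun u => G x u ^+ 2)) +
   rad [seq (fun u => 2 * G x u) : T -> R | x <- xs] maxf (a - (fun u => G x u ^+ 2))) / 2)).
  by rewrite ler_pM2r ?invr_gt0 // lerD.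
rewrite /= ler_pM2r ?invr_gt0 //.
rewrite !rad_shift -!radD; apply: rad_le => b.
exact: maxf_sqr_contraction.
Qed.

End MaxOverFunctionals.

Section Halving.
Context (R : realType) (V : lmodType R) (N : V -> R).
Hypothesis normN : seminorm_on N.
Variables (nf : V -> V -> R) (us : seq V).
Hypothesis Hnf : forall u, [/\ forall x y, nf u (x + y) = nf u x + nf u y,
  forall a x, nf u (a *: x) = a * nf u x, forall x, `|nf u x| <= N x & nf u u = N u].
Implicit Types (xs ys zs : seq V).

Local Notation M := (maxf us).
Local Notation sq x := (fun u => nf u x ^+ 2).

Let nfD u x y : nf u (x + y) = nf u x + nf u y. Proof. by have [] := Hnf u. Qed.
Let nfN u x : nf u (- x) = - nf u x.
Proof. by have [_ h _ _] := Hnf u; rewrite -scaleN1r h mulN1r. Qed.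
Let nf_le u x : `|nf u x| <= N x. Proof. by have [] := Hnf u. Qed.

Lemma rad_maxf_le_norm xs v :
  rad [seq (fun u => 2 * nf u x) : V -> R | x <- xs] M (fun u => 2 * nf u v) <=
  2 * rad xs N v.
Proof.
elim: xs v => [|x xs IH] v /=.
  apply: maxf_le => [|u _]; first by rewrite mulr_ge0 ?(seminorm_ge0 normN).
  by rewrite ler_pM2l //; exact: le_trans (ler_norm _) (nf_le _ _).
have e1 : (fun u => 2 * nf u v) + (fun u => 2 * nf u x) = (fun u => 2 * nf u (v + x)).
  by apply/funext => u; rewrite nfD mulrDr.
have e2 : (fun u => 2 * nf u v) - (fun u => 2 * nf u x) = (fun u => 2 * nf u (v - x)).
  by apply/funext => u; rewrite nfD nfN mulrDr mulrN.
by rewrite e1 e2 mulrA ler_pM2r ?invr_gt0 // mulrDr lerD.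
Qed.

(** The contraction principle trades the squares for linear terms, and a signed sum of values of a
    functional dominated by [N] is bounded by the seminorm of the signed sum. *)
Lemma rad_maxf_sqr_le_norm xs : {in xs, forall x, N x <= 1} ->
  rad [seq sq x : V -> R | x <- xs] M 0 <= 2 * rad xs N 0.
Proof.
move=> N1.
apply: le_trans (@rad_maxf_sqr R V us V xs (fun x u => nf u x) 0 _) _.
  by move=> x xin u _; apply: le_trans (nf_le _ _) (N1 _ xin).
have -> : (0 : V -> R) = (fun u => 2 * nf u 0).
  apply/funext => u; have [_ h _ _] := Hnf u.
  by rewrite -(scale0r (0 : V)) h mul0r mulr0.
exact: rad_maxf_le_norm.
Qed.

Lemma rad_maxf_diff (ps : seq (V * V)) (a b : V * V -> V -> R) v w :
  rad [seq a p - b p | p <- ps] M (v - w) <=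
  rad [seq a p | p <- ps] M v + rad [seq b p | p <- ps] (fun c => M (- c)) w.
Proof.
elim: ps v w => [|p ps IH] v w /=; first exact: maxfD.
have -> : v - w + (a p - b p) = (v + a p) - (w + b p) by rewrite opprD addrACA.
have -> : v - w - (a p - b p) = (v - a p) - (w - b p) by rewrite !opprD addrACA.
have := IH (v + a p) (w + b p); have := IH (v - a p) (w - b p); lra.
Qed.

Lemma rad_exists_le (W : zmodType) (xs : seq W) (f : W -> R) v :
  exists2 u, u \in signed_sums xs v & f u <= rad xs f v.
Proof.
elim: xs v => [|x xs IH] v /=; first by exists v; rewrite ?mem_head.
have [h|h] := leP (rad xs f (v + x)) (rad xs f (v - x)).
  have [u uin hu] := IH (v + x); exists u; first by rewrite mem_cat uin.
  by apply: (le_trans hu); lra.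
have [u uin hu] := IH (v - x); exists u; first by rewrite mem_cat uin orbT.
by apply: (le_trans hu); lra.
Qed.

(** Random splitting: the first half of [xs] is paired with the second, and a sign in each pair
    decides which member goes to [ys]. The discrepancy of the two sums of squares is the signed sum
    [c] of the differences [D p]; for a suitable choice of signs it is at most [8 * avg N xs], and
    each part gets half the total plus half the discrepancy. *)
Lemma halving n xs (s : R) : size xs = (n + n)%N -> {in xs, forall x, N x <= 1} ->
  {in us, forall u, \sum_(x <- xs) nf u x ^+ 2 <= s} ->
  exists ys zs, [/\ size ys = n, size zs = n, perm_eq (ys ++ zs) xs &
    {in us, forall u, \sum_(x <- ys) nf u x ^+ 2 <= s / 2 + 4 * avg N xs /\
                      \sum_(x <- zs) nf u x ^+ 2 <= s / 2 + 4 * avg N xs}].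
Proof.
move=> szxs N1 Hs.
set x1 := take n xs; set x2 := drop n xs.
have sz1 : size x1 = n by rewrite size_take_min szxs; apply/minn_idPl; exact: leq_addr.
have sz2 : size x2 = n by rewrite size_drop szxs addnK.
have xs12 : x1 ++ x2 = xs by exact: cat_take_drop.
pose ps := zip x1 x2.
have ps1 : unzip1 ps = x1 by rewrite unzip1_zip // sz1 sz2.
have ps2 : unzip2 ps = x2 by rewrite unzip2_zip // sz1 sz2.
pose D (p : V * V) : V -> R := (sq p.1 : V -> R) - (sq p.2 : V -> R).
(* A single choice of signs has to control the discrepancy from above and from below, whence the sum
   of the two maxima. *)
have [c cin hc] := rad_exists_le [seq D p | p <- ps] (fun c => M c + M (- c)) 0.
have bound1 : rad [seq D p | p <- ps] M 0 <= 4 * avg N xs.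
  have := rad_maxf_diff ps (fun p => sq p.1) (fun p => sq p.2) 0 0.
  rewrite subr0 -[X in _ + X]rad_opp oppr0.
  rewrite (_ : [seq sq p.1 : V -> R | p <- ps] = [seq sq x : V -> R | x <- x1]); last first.
    by rewrite -ps1 /unzip1 -map_comp.
  rewrite (_ : [seq sq p.2 : V -> R | p <- ps] = [seq sq x : V -> R | x <- x2]); last first.
    by rewrite -ps2 /unzip2 -map_comp.
  move=> h; apply: (le_trans h).
  have h1 : rad [seq sq x : V -> R | x <- x1] M 0 <= 2 * avg N xs.
    apply: (le_trans (rad_maxf_sqr_le_norm _)).
      by move=> x xin; apply: N1; rewrite -xs12 mem_cat xin.
    rewrite ler_pM2l //; apply: (le_trans (rad_norm_le_avg normN _)).
    by rewrite -xs12; exact: avg_catl_le.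
  have h2 : rad [seq sq x : V -> R | x <- x2] M 0 <= 2 * avg N xs.
    apply: (le_trans (rad_maxf_sqr_le_norm _)).
      by move=> x xin; apply: N1; rewrite -xs12 mem_cat xin orbT.
    rewrite ler_pM2l //; apply: (le_trans (rad_norm_le_avg normN _)).
    by rewrite -xs12; exact: avg_catr_le.
  lra.
have bound : M c + M (- c) <= 8 * avg N xs.
  apply: (le_trans hc); rewrite radD -[X in _ + X]rad_opp oppr0; lra.
have [ss szss cE] := mem_signed_sums cin.
rewrite size_map in szss.
pose ys := [seq if q.1 then q.2.1 else q.2.2 | q <- zip ss ps].
pose zs := [seq if q.1 then q.2.2 else q.2.1 | q <- zip ss ps].
have szps : size ps = n by rewrite size_zip sz1 sz2 minnn.
suff pxs : perm_eq (ys ++ zs) xs.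
  exists ys, zs; split=> //; first by rewrite size_map size_zip szss szps minnn.
    by rewrite size_map size_zip szss szps minnn.
  move=> u uin.
  have cuE : c u = \sum_(x <- ys) nf u x ^+ 2 - \sum_(x <- zs) nf u x ^+ 2.
    rewrite cE /ys /zs !big_map add0r; move: szss; clear.
    elim: (ps) ss => [|p l IH] [|s' ss'] //=.
      by move=> _; rewrite !big_nil subrr.
    move=> [szl]; rewrite !big_cons /=; have IH' := IH _ szl.
    rewrite -[LHS]/((if s' then D p else - D p) u + (\sum_(q <- zip ss' [seq D p | p <- l]) (if q.1 then q.2 else - q.2)) u).
    by rewrite IH'; case: s'; rewrite /D /=; rewrite -?[(- _) u]/(- (_ u)) -[(_ - _) u]/(nf u p.1 ^+ 2 - nf u p.2 ^+ 2); ring.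
  have sumE : \sum_(x <- ys) nf u x ^+ 2 + \sum_(x <- zs) nf u x ^+ 2 <= s.
    by rewrite -big_cat (perm_big _ pxs) Hs.
  have M1 := maxf_ge c uin; have M2 : - c u <= M (- c) by exact: (maxf_ge (- c)).
  have := maxf_ge0 us c; have := maxf_ge0 us (- c).
  by split; lra.
rewrite -xs12 -ps1 -ps2 /ys /zs; move: szss; clear.
elim: (ps) ss => [|p l IH] [|s' ss'] //= [szl].
  have sw (A B C D' : seq V) (x y : V) : perm_eq (A ++ B) (C ++ D') ->
      perm_eq (x :: A ++ y :: B) (x :: C ++ y :: D').
    by move=> /seq.permP h; apply/seq.permP => f; have := h f; rewrite /= !count_cat /=; lia.
  have sw' (A B C D' : seq V) (x y : V) : perm_eq (A ++ B) (C ++ D') ->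
      perm_eq (x :: A ++ y :: B) (y :: C ++ x :: D').
    by move=> /seq.permP h; apply/seq.permP => f; have := h f; rewrite /= !count_cat /=; lia.
  by case: s' => /=; [apply: sw|apply: sw']; exact: IH.
Qed.

(** Each halving replaces [s] by [s / 2 + 4 * A], a recursion with fixed point [8 * A]. The average
    does not grow on passing to a part, so the same [A] serves throughout. *)
Lemma halving_iter l n xs (s A : R) : size xs = (2 ^ l * n)%N ->
  {in xs, forall x, N x <= 1} -> avg N xs <= A ->
  {in us, forall u, \sum_(x <- xs) nf u x ^+ 2 <= s} ->
  exists yss, [/\ size yss = (2 ^ l)%N, {in yss, forall ys, size ys = n},
    perm_eq (flatten yss) xs &
    {in yss, forall ys, {in us, forall u,
      \sum_(x <- ys) nf u x ^+ 2 <= s / 2 ^+ l + 8 * A * (1 - (2 ^+ l)^-1)}}].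
Proof.
elim: l xs s => [|l IH] xs s szxs N1 avA Hs.
  exists [:: xs]; split=> //.
  - by move=> ys; rewrite inE => /eqP ->; rewrite szxs mul1n.
  - by rewrite /= cats0.
  move=> ys; rewrite inE => /eqP -> u uin.
  by rewrite expr0 invr1 subrr mulr0 addr0 mulr1 Hs.
have szxs' : size xs = (2 ^ l * n + 2 ^ l * n)%N by rewrite szxs expnS -mulnA mul2n addnn.
have [ys [zs [szy szz pxs Hyz]]] := halving szxs' N1 Hs.
have subP ts : {subset ts <= ys ++ zs} -> {in ts, forall x, N x <= 1}.
  by move=> sub x xin; apply: N1; rewrite -(perm_mem pxs); exact: sub.
have avgyz : avg N (ys ++ zs) = avg N xs by exact: avg_perm.
have [||u uin|y1 [sy1 sy2 sy3 sy4]] := IH ys (s / 2 + 4 * A) szy.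
- by apply: subP => x xin; rewrite mem_cat xin.
- by apply: le_trans avA; rewrite -avgyz; exact: avg_catl_le.
- by have [h _] := Hyz u uin; apply: (le_trans h); rewrite lerD2l ler_pM2l.
have [||u uin|z1 [sz1 sz2 sz3 sz4]] := IH zs (s / 2 + 4 * A) szz.
- by apply: subP => x xin; rewrite mem_cat xin orbT.
- by apply: le_trans avA; rewrite -avgyz; exact: avg_catr_le.
- by have [_ h] := Hyz u uin; apply: (le_trans h); rewrite lerD2l ler_pM2l.
exists (y1 ++ z1); split.
- by rewrite size_cat sy1 sz1 expnS mul2n addnn.
- by move=> t; rewrite mem_cat => /orP[/sy2|/sz2].
- by rewrite flatten_cat; apply: perm_trans pxs; exact: perm_cat.
have e : (s / 2 + 4 * A) / 2 ^+ l + 8 * A * (1 - (2 ^+ l)^-1) =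
         s / 2 ^+ l.+1 + 8 * A * (1 - (2 ^+ l.+1)^-1).
  by rewrite exprS invfM; lra.
by rewrite -e => t; rewrite mem_cat => /orP[/sy4|/sz4].
Qed.

End Halving.

(** * Equal norms *)

Section Growth.
Context (R : realType).

Lemma expr_unbounded (x B : R) : 1 < x -> exists n, B < x ^+ n.
Proof.
move=> x1; have bern n : 1 + n%:R * (x - 1) <= x ^+ n.
  elim: n => [|n IH]; first by rewrite mul0r addr0.
  rewrite exprS -natr1; have : 0 <= n%:R * (x - 1) ^+ 2 :> R by rewrite mulr_ge0 ?sqr_ge0.
  move: (x ^+ n) IH => y IH; nra.
have xm : 0 < x - 1 by lra.
exists (Num.bound (`|B| / (x - 1))); apply: lt_le_trans (bern _).
have := @archi_boundP _ (`|B| / (x - 1)) (divr_ge0 (normr_ge0 _) (ltW xm)).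
rewrite ltr_pdivrMr //; have := ler_norm B; lra.
Qed.

Lemma powR2_gt1 (x : R) : 0 < x -> 1 < 2 `^ x.
Proof.
move=> x0; rewrite -[ltLHS](congr1 (fun f => f x) (@powR1 R)).
by rewrite gt0_ltr_powR ?nnegrE //; lra.
Qed.

Lemma powR_unbounded (x B : R) : 0 < x -> exists n, B < 2 `^ (n%:R * x).
Proof.
move=> x0; have [n hn] := expr_unbounded B (powR2_gt1 x0).
by exists n; rewrite mulrC powRrM powR_mulrn // powR_ge0.
Qed.

Lemma exists_le_mean (T : eqType) (s : seq T) (f : T -> R) c : s != [::] ->
  \sum_(x <- s) f x <= (size s)%:R * c -> exists2 x, x \in s & f x <= c.
Proof.
elim: s => // x s IH _; rewrite big_cons /= -natr1 mulrDl mul1r.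
have [fx|fx] := leP (f x) c; first by exists x; rewrite ?mem_head.
have [->|sn0] := eqVneq s [::]; first by rewrite big_nil mul0r; lra.
move=> h; have [|y yin fy] := IH sn0; first by lra.
by exists y; rewrite ?inE ?yin ?orbT.
Qed.

Lemma pow2_powR (n : nat) (x : R) : (2 ^ n)%:R `^ x = 2 `^ (n%:R * x).
Proof. by rewrite powRrM powR_mulrn // natrX. Qed.

Lemma pow2R (n : nat) : (2 ^ n)%:R = 2 `^ n%:R :> R.
Proof. by rewrite powR_mulrn // natrX. Qed.

Lemma powR2D (x y : R) : 2 `^ (x + y) = 2 `^ x * 2 `^ y.
Proof. by rewrite powRD // pnatr_eq0 implybT. Qed.

Lemma powR2_gt0 (x : R) : 0 < 2 `^ x. Proof. exact: powR_gt0. Qed.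

End Growth.

Section Flat.
Context (R : realType) (V : lmodType R) (N : V -> R).
Hypothesis normN : seminorm_on N.
Implicit Types (xs ys zs : seq V).

(** By orthogonality of the signs, the sum of squares is the mean of [phi ^ 2] over the signed
    sums. *)
Lemma sum_functional_sqr_le (phi : V -> R) xs :
  (forall x y, phi (x + y) = phi x + phi y) ->
  (forall a x, phi (a *: x) = a * phi x) ->
  (forall x, `|phi x| <= N x) ->
  \sum_(x <- xs) phi x ^+ 2 <= avg2 N xs.
Proof.
move=> phiD phiZ phile.
have phiN x : phi (- x) = - phi x by rewrite -scaleN1r phiZ mulN1r.
have phi0 : phi 0 = 0 by rewrite -(scale0r 0) phiZ mul0r.
have E v : rad xs (fun u => phi u ^+ 2) v = phi v ^+ 2 + \sum_(x <- xs) phi x ^+ 2.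
  elim: xs v => [|x xs IH] v /=; first by rewrite big_nil addr0.
  by rewrite !IH big_cons !phiD phiN; field.
have <- : rad xs (fun u => phi u ^+ 2) 0 = \sum_(x <- xs) phi x ^+ 2.
  by rewrite E phi0 expr0n add0r.
apply: rad_le => u; rewrite -[leLHS]real_normK ?num_real //.
by rewrite ler_pXn2r ?nnegrE ?(seminorm_ge0 normN).
Qed.

(** Prefixes of permutations reach every subfamily. The points whose norming functionals are
    controlled must be listed before the halving, when the part that will be selected is still
    unknown. *)
Definition all_signed_sums xs : seq V :=
  flatten [seq signed_sums (take i s) 0 | s <- permutations xs, i <- iota 0 (size xs).+1].

Lemma mem_all_signed_sums xs ys zs u : perm_eq (ys ++ zs) xs ->
  u \in signed_sums ys 0 -> u \in all_signed_sums xs.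
Proof.
move=> pxs uin; apply/flattenP; exists (signed_sums (take (size ys) (ys ++ zs)) 0).
  apply/allpairsP; exists (ys ++ zs, size ys); split=> //.
    by rewrite mem_permutations.
  by rewrite mem_iota /= add0n ltnS -(perm_size pxs) size_cat leq_addr.
by rewrite take_size_cat.
Qed.

Lemma perm_flatten_rem (xss : seq (seq V)) ys : ys \in xss ->
  exists zs, perm_eq (ys ++ zs) (flatten xss).
Proof.
case/splitPr => p1 p2; exists (flatten p1 ++ flatten p2).
by rewrite flatten_cat /= perm_catCA.
Qed.

(* Negating the conclusion at size [2 ^ j] gives [avg N xs <= M].  Halving [l]
   times makes the functionals small on each part, and cotype [q] selects a part
   of small mean; its [2 ^ a] blocks have large mean by induction, against the
   [(r, 1)]-summing estimate. *)
Lemma flat_step r C q K (tau Q : R) (a l j : nat) xs :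
  2 <= r -> 2 <= q -> 0 < C -> 0 < K -> 0 < Q ->
  (forall zs, exists2 u, u \in signed_sums zs 0 &
     (\sum_(z <- zs) N z `^ r) `^ r^-1 <= C * N u) ->
  (forall zs, (\sum_(z <- zs) N z `^ q) `^ q^-1 <= K * avg N zs) ->
  (a + l <= j)%N -> size xs = (2 ^ j)%N -> {in xs, forall x, N x = 1} ->
  (forall ys, size ys = (2 ^ (j - l - a))%N -> {in ys, forall x, N x = 1} ->
     2 `^ ((j - l - a)%:R * tau) <= Q * avg N ys) ->
  avg N xs <= 2 `^ (j%:R * tau) / Q -> 2 ^+ l <= 2 `^ (j%:R * tau) / Q ->
  2 `^ (a%:R * (2 / r - 2 * tau)) <=
   C ^+ 2 * (2 * K ^+ 2 * 2 `^ (2 * l%:R * (tau - q^-1)) +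
             36 * 2 ^+ (2 ^ a) * 2 `^ (l%:R * (2 * tau - 1))).
Proof.
move=> r2 q2 C0 K0 Q0 HC HK alj szxs N1 IH.
set M := 2 `^ (j%:R * tau) / Q => avM Ml.
have r0 : r != 0 by lra.
have q0 : q != 0 by lra.
have M0 : 0 < M by rewrite divr_gt0 ?powR2_gt0.
have ME : M = 2 `^ (j%:R * tau) / Q by [].
clearbody M.
have [nf Hnf] := seminorm_functionals normN.
have avg2M : avg2 N xs <= M ^+ 2.
  by rewrite -avg_sqr ler_pXn2r ?nnegrE ?avg_ge0 ?(ltW M0).
have N1' : {in xs, forall x, N x <= 1} by move=> x /N1 ->.
have szxs' : size xs = (2 ^ l * 2 ^ (j - l))%N.
  by rewrite szxs -expnD subnKC // (leq_trans (leq_addl a l)).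
have s0 : {in all_signed_sums xs, forall u, \sum_(x <- xs) nf u x ^+ 2 <= M ^+ 2}.
  move=> u _; have [nD nZ nle _] := Hnf u.
  exact: le_trans (sum_functional_sqr_le _ nD nZ nle) avg2M.
have [yss [szy szys pxs Hyss]] := halving_iter normN Hnf szxs' N1' avM s0.
(* Cotype [q] for the [2 ^ l] parts bounds the sum of the powers [avg N ys ^ q] by [(K * M) ^ q], so
   some part is at most the mean. *)
have [ys ysin hys] : exists2 ys, ys \in yss & avg N ys `^ q <= (K * M) `^ q / 2 ^+ l.
  apply: exists_le_mean.
    by rewrite -size_eq0 szy -lt0n expn_gt0.
  rewrite szy natrX mulrC divfK ?expf_neq0 ?pnatr_eq0 //.
  have := avg_blocks_le_cotype normN yss q2 HK.
  have -> : avg2 N (flatten yss) = avg2 N xs by rewrite -!avg_sqr (avg_perm _ pxs).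
  move=> h; have {}h := le_trans h (ler_wpM2l (sqr_ge0 K) avg2M).
  have S0 : 0 <= \sum_(x <- yss) avg N x `^ q by apply: sumr_ge0 => *; exact: powR_ge0.
  have qh : 0 <= q / 2 by lra.
  have := ge0_ler_powR qh _ _ h; rewrite !nnegrE powR_ge0 mulr_ge0 ?sqr_ge0 // => /(_ isT isT).
  rewrite -powRrM mulVf ?powRr1 //; last by rewrite mulf_neq0 // invr_eq0 pnatr_eq0.
  by rewrite -exprMn sqr_powR_half // mulr_ge0 ?ltW.
have hys2 : avg2 N ys <= K ^+ 2 * M ^+ 2 * 2 `^ (- (2 * l%:R * q^-1)).
  have h := ge0_ler_powR (_ : 0 <= 2 / q) _ _ hys.
  have q20 : 0 <= 2 / q by rewrite divr_ge0 //; lra.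
  have {h} := h q20; rewrite !nnegrE powR_ge0 divr_ge0 ?powR_ge0 ?exprn_ge0 // => /(_ isT isT).
  have e2 : q * (2 / q) = 2 by rewrite mulrC divfK.
  rewrite -powRrM e2 powR_mulrn ?avg_ge0 // avg_sqr => h.
  apply: (le_trans h); rewrite powRM ?powR_ge0 ?invr_ge0 ?exprn_ge0 //.
  rewrite -powRrM e2 powR_mulrn ?mulr_ge0 ?(ltW K0) ?(ltW M0) // exprMn.
  apply: ler_wpM2l; first by rewrite mulr_ge0 ?sqr_ge0.
  rewrite -powR_invn ?ler0n // -powRrM.
  by rewrite le_eqVlt; apply/orP; left; apply/eqP; congr (_ `^ _); ring.
have szysE := szys _ ysin.
set m := (2 ^ (j - l - a))%N.
have szysE' : size ys = (2 ^ a * m)%N.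
  by rewrite szysE -expnD subnKC // leq_subRL ?(leq_trans (leq_addl a l)) // addnC.
pose yb := reshape (nseq (2 ^ a) m) ys.
have sumn_nseq' : sumn (nseq (2 ^ a) m) = size ys by rewrite sumn_nseq szysE' mulnC.
have flat_yb : flatten yb = ys by apply: reshapeKr; rewrite sumn_nseq'.
have sz_yb : size yb = (2 ^ a)%N by rewrite size_reshape size_nseq.
have sz_blk : {in yb, forall b, size b = m}.
  have sh : shape yb = nseq (2 ^ a) m by apply: reshapeKl; rewrite sumn_nseq'.
  move=> b bin; have : size b \in shape yb by apply: map_f.
  by rewrite sh mem_nseq => /andP[_ /eqP].
have ysx : {subset ys <= xs}.
  move=> y yin; rewrite -(perm_mem pxs); apply/flattenP; by exists ys.
have blk_lb : {in yb, forall b, 2 `^ ((j - l - a)%:R * tau) / Q <= avg N b}.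
  move=> b bin; rewrite ler_pdivrMr // [leRHS]mulrC; apply: IH; first exact: sz_blk.
  move=> x xin; apply: N1; apply: ysx; rewrite -flat_yb; apply/flattenP; by exists b.
(* Halving gives at most [M ^ 2 / 2 ^ l + 8 * M], and [2 ^ l <= M] turns the second term into eight
   times the first. *)
set sigma := 9 * M ^+ 2 / 2 ^+ l.
have Hsig : {in signed_sums (flatten yb) 0, forall u, \sum_(x <- flatten yb) nf u x ^+ 2 <= sigma}.
  rewrite flat_yb => u uin.
  have [zs pz] := perm_flatten_rem ysin.
  have uall : u \in all_signed_sums xs by exact: mem_all_signed_sums (perm_trans pz pxs) uin.
  apply: le_trans (Hyss _ ysin _ uall) _.
  have L0 : 0 < 2 ^+ l :> R by exact: exprn_gt0.
  have -> : sigma = M ^+ 2 / 2 ^+ l + 8 * M ^+ 2 / 2 ^+ l by rewrite /sigma; ring.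
  rewrite lerD2l.
  have iL0 : 0 < (2 ^+ l)^-1 :> R by rewrite invr_gt0.
  apply: (@le_trans _ _ (8 * M)); first by rewrite ler_piMr ?mulr_ge0 ?ltW //; lra.
  rewrite -mulrA ler_pM2l //; rewrite ler_pdivlMr // expr2 ler_pM2l //.
have := avg_blocks_le_summing normN r2 HC Hnf Hsig.
rewrite flat_yb sz_yb => main.
(* All [2 ^ a] blocks have average at least [B], which is [M] times the power [- (l + a) * tau] of
   2. *)
have lb : M ^+ 2 * 2 `^ (a%:R * (2 / r - 2 * tau)) * 2 `^ (- (2 * l%:R * tau)) <=
    (\sum_(b <- yb) avg N b `^ r) `^ (r / 2)^-1.
  set B := 2 `^ ((j - l - a)%:R * tau) / Q.
  have B0 : 0 < B by rewrite divr_gt0 ?powR2_gt0.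
  apply: (@le_trans _ _ (((2 ^ a)%:R * B `^ r) `^ (r / 2)^-1)).
    rewrite powRM ?ler0n ?powR_ge0 // -powRrM invf_div mulrA (mulrC r 2) -[2 * r / r]mulrA divff // mulr1.
    rewrite powR_mulrn ?(ltW B0) // pow2_powR.
    have -> : B = M * 2 `^ (- ((l + a)%:R * tau)).
      rewrite /B ME mulrAC -powR2D; congr (_ `^ _ / _).
      rewrite -subnDA natrB; first by ring.
      by rewrite addnC.
    rewrite exprMn -(@powR_mulrn _ (2 `^ _)) ?powR_ge0 // -powRrM.
    rewrite mulrCA -powR2D -mulrA -powR2D le_eqVlt; apply/orP; left; apply/eqP.
    by congr (_ * (_ `^ _)); rewrite natrD; field.
  apply: ge0_ler_powR.
  - by rewrite invr_ge0 divr_ge0 //; lra.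
  - by rewrite nnegrE mulr_ge0 ?powR_ge0 ?ler0n.
  - by rewrite nnegrE; apply: sumr_ge0 => *; exact: powR_ge0.
  have -> : (2 ^ a)%:R * B `^ r = \sum_(b <- yb) B `^ r.
    by rewrite big_const_seq count_predT sz_yb iter_addr_0 mulr_natl.
  rewrite big_seq [leRHS]big_seq; apply: ler_sum => b bin.
  apply: ge0_ler_powR; rewrite ?nnegrE ?avg_ge0 ?(ltW B0) //; first by lra.
  exact: blk_lb.
have {main lb} main := le_trans lb main.
rewrite -(@ler_pM2r _ (M ^+ 2 * 2 `^ (- (2 * l%:R * tau)))); last first.
  by rewrite mulr_gt0 ?exprn_gt0 ?powR2_gt0.
rewrite mulrCA; rewrite -mulrA in main; apply: (le_trans main).
rewrite -[leRHS]mulrA ler_pM2l ?exprn_gt0 // [leRHS]mulrDl; apply: lerD.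
  have e : 2 `^ (- (2 * l%:R * q^-1)) = 2 `^ (2 * l%:R * (tau - q^-1)) * 2 `^ (- (2 * l%:R * tau)).
    by rewrite -powR2D; congr (_ `^ _); ring.
  apply: le_trans (ler_wpM2l (ler0n _ 2) hys2) _.
  by rewrite e le_eqVlt; apply/orP; left; apply/eqP; ring.
(* The constant 36 is the 4 of the variance estimate times the 9 of [sigma]. *)
rewrite /sigma le_eqVlt; apply/orP; left; apply/eqP.
have -> : 2 `^ (l%:R * (2 * tau - 1)) = 2 `^ (2 * l%:R * tau) / 2 ^+ l.
  by rewrite -powR_invn ?ler0n // -powR2D; congr (_ `^ _); ring.
have -> : 2 `^ (- (2 * l%:R * tau)) = (2 `^ (2 * l%:R * tau))^-1 by rewrite powRN.
have := lt0r_neq0 (powR2_gt0 (2 * l%:R * tau)).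
have L0 : 2 ^+ l != 0 :> R by rewrite expf_neq0 ?pnatr_eq0.
move: (2 `^ _) (2 ^+ l) (2 ^+ (2 ^ a)) L0 => x y z y0 x0; field.
by rewrite y0 x0.
Qed.

End Flat.

(** * From equal norms to cotype *)

Section FlatCotype.
Context (R : realType) (V : lmodType R) (N : V -> R).
Hypothesis normN : seminorm_on N.
Implicit Types (xs ys zs : seq V).

(** The constants are fixed in the order [a], [l], [tau], [j0]: [a] lets the gain of the [2 ^ a]
    blocks beat the loss from cotype, [l] makes the variance term at most 1, [tau] is so close to
    [1 / q] that [l] halvings cost a factor at most 2, and [j0] marks where the induction can
    start. *)
Lemma flat_cotype r C q K : 2 <= r -> r < q -> 0 < C -> 0 < K ->
  (forall zs, exists2 u, u \in signed_sums zs 0 &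
     (\sum_(z <- zs) N z `^ r) `^ r^-1 <= C * N u) ->
  (forall zs, (\sum_(z <- zs) N z `^ q) `^ q^-1 <= K * avg N zs) ->
  exists tau Q : R, [/\ q^-1 < tau, 0 < Q &
    forall j xs, size xs = (2 ^ j)%N -> {in xs, forall x, N x = 1} ->
      2 `^ (j%:R * tau) <= Q * avg N xs].
Proof.
move=> r2 rq C0 K0 HC HK.
have r0 : 0 < r by lra.
have q0 : 0 < q by lra.
have qr : q^-1 < r^-1 by rewrite ltf_pV2 ?posrE.
have rh : r^-1 <= 2^-1 by rewrite lef_pV2 ?posrE.
have qi0 : 0 < q^-1 by rewrite invr_gt0.
pose t0 := (q^-1 + r^-1) / 2.
have t01 : q^-1 < t0 by rewrite /t0; lra.
have t02 : t0 < r^-1 by rewrite /t0; lra.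
have [a ha] : exists a, 4 * C ^+ 2 * K ^+ 2 + 1 < 2 `^ (a%:R * (2 / r - 2 * t0)) :> R.
  by apply: powR_unbounded; lra.
have [l hl] : exists l, 36 * C ^+ 2 * 2 ^+ (2 ^ a) < 2 `^ (l%:R * (1 - 2 * t0)) :> R.
  by apply: powR_unbounded; lra.
pose tau := Num.min t0 (q^-1 + (2 * l.+1%:R)^-1).
have l0 : 0 < (2 * l.+1%:R)^-1 :> R by rewrite invr_gt0 mulr_gt0 ?ltr0Sn.
have tau1 : q^-1 < tau by rewrite lt_min t01 /= ltrDl.
have tau2 : tau <= t0 by rewrite ge_min lexx.
have tau3 : tau - q^-1 <= (2 * l.+1%:R)^-1 by rewrite lerBlDl ge_min lexx orbT.
(* From [j1] on, cotype [q] alone makes the average at least [2 ^ l]. The summand [a + l] of [j0]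
   allows a family of size [2 ^ j] to be cut [a + l] times. *)
have [j1 hj1] : exists j1, K * 2 ^+ l < 2 `^ (j1%:R * q^-1) by exact: powR_unbounded.
pose j0 := (j1 + (a + l))%N.
have Q0 : 0 < 2 `^ (j0%:R * tau) :> R by exact: powR2_gt0.
exists tau, (2 `^ (j0%:R * tau)); split=> //.
elim/ltn_ind => j IH xs szxs N1.
have tau0 : 0 < tau by lra.
(* For [j <= j0] a single vector of norm 1 suffices, by the size of the constant. *)
have [jj0|j0j] := leqP j j0.
  have xs0 : head 0 xs \in xs.
    by case: (xs) szxs => [/=|x s _ /=]; [move/esym/eqP; rewrite expn_eq0|exact: mem_head].
  have : 1 <= avg N xs by rewrite -(N1 _ xs0); exact: norm_le_avg.
  move=> av1; apply: le_trans (_ : _ <= 2 `^ (j0%:R * tau)) _.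
    by apply: ler_powR; rewrite ?ler1n // ler_pM2r // ler_nat.
  by rewrite ler_peMr // ltW.
rewrite leNgt; apply/negP; rewrite mulrC -ltr_pdivlMr // => avlt.
have alj : (a + l <= j)%N by apply: leq_trans (ltnW j0j); exact: leq_addl.
have Ml : 2 ^+ l <= 2 `^ (j%:R * tau) / 2 `^ (j0%:R * tau).
  apply: le_trans (ltW avlt).
  have := HK xs.
  have -> : \sum_(z <- xs) N z `^ q = (2 ^ j)%:R.
    rewrite big_seq (eq_bigr (fun=> 1)) => [|z /N1 ->]; last by rewrite powR1.
    by rewrite -big_seq big_const_seq count_predT szxs iter_addr_0.
  rewrite pow2_powR => h; rewrite -(ler_pM2l K0); apply: le_trans h.
  apply: (le_trans (ltW hj1)); apply: ler_powR; rewrite ?ler1n // ler_pM2r // ler_nat.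
  by apply: leq_trans (ltnW j0j); exact: leq_addr.
have IH' ys : size ys = (2 ^ (j - l - a))%N -> {in ys, forall x, N x = 1} ->
    2 `^ ((j - l - a)%:R * tau) <= 2 `^ (j0%:R * tau) * avg N ys.
  (* The induction descends only if [a + l > 0]; indeed [a = 0] would contradict the choice of
     [a]. *)
  have [al0|alp] := posnP (a + l)%N; last first.
    by apply: IH; rewrite -subnDA ltn_subrL addnC alp (leq_ltn_trans _ j0j).
  move/eqP: al0; rewrite addn_eq0 => /andP[/eqP a_eq0 /eqP l_eq0].
  move: hl ha; rewrite a_eq0 l_eq0.
  rewrite !mul0r powRr0 => h1 h2; exfalso.
  have : 0 <= C ^+ 2 * K ^+ 2 by rewrite mulr_ge0 ?sqr_ge0.
  lra.
have q2 : 2 <= q by lra.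
have main := flat_step normN r2 q2 C0 K0 Q0 HC HK alj szxs N1 IH' (ltW avlt) Ml.
have h1 : 2 `^ (2 * l%:R * (tau - q^-1)) <= 2 :> R.
  rewrite -[leRHS]powRr1 //; apply: ler_powR; first by rewrite ler1n.
  apply: (@le_trans _ _ (2 * l%:R * (2 * l.+1%:R)^-1)).
    by rewrite ler_wpM2l // mulr_ge0 // ler0n.
  rewrite ler_pdivrMr ?mulr_gt0 ?ltr0Sn // mul1r ler_pM2l // ler_nat //.
have h2 : 36 * 2 ^+ (2 ^ a) * 2 `^ (l%:R * (2 * tau - 1)) * C ^+ 2 <= 1 :> R.
  have e : 2 `^ (l%:R * (2 * tau - 1)) <= (2 `^ (l%:R * (1 - 2 * t0)))^-1 :> R.
    rewrite -powRN; apply: ler_powR; first by rewrite ler1n.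
    by rewrite -mulrN ler_wpM2l ?ler0n //; lra.
  have P0 := powR2_gt0 (l%:R * (1 - 2 * t0)).
  rewrite mulrAC; apply: (@le_trans _ _ (36 * 2 ^+ (2 ^ a) * C ^+ 2 / 2 `^ (l%:R * (1 - 2 * t0)))).
    by rewrite ler_wpM2l // mulr_ge0 ?sqr_ge0 // mulr_ge0 ?exprn_ge0.
  by rewrite ler_pdivrMr // mul1r mulrAC ltW.
have h3 : 2 `^ (a%:R * (2 / r - 2 * t0)) <= 2 `^ (a%:R * (2 / r - 2 * tau)) :> R.
  by apply: ler_powR; rewrite ?ler1n // ler_wpM2l ?ler0n //; lra.
have : C ^+ 2 * K ^+ 2 * 2 `^ (2 * l%:R * (tau - q^-1)) <= C ^+ 2 * K ^+ 2 * 2.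
  by rewrite ler_wpM2l // mulr_ge0 ?sqr_ge0.
move: main h2 h3 ha.
move: (2 `^ _) (2 `^ _) (2 `^ _) (2 `^ _) (2 ^+ _) (C ^+ 2) (K ^+ 2) => x1 x2 x3 x4 x5 x6 x7.
lra.
Qed.

(** When [y] lies in []2 ^ -(l+1), 2 ^ -l]], the term of index [l] alone dominates [y ^ p]. The
    indicators become counts once summed over a family. *)
Lemma powR_le_dyadic (p : R) (L : nat) (y : R) : 0 < p -> 0 <= y <= 1 ->
  y = 0 \/ 2 ^- L < y ->
  y `^ p <= \sum_(l < L) 2 `^ (- p) ^+ l * (2 ^- l.+1 < y)%R%:R.
Proof.
move=> p0; elim: L y => [|L IH] y /andP[y0 y1] hy.
  case: hy => [->|]; first by rewrite big_ord0 powR0 ?gt_eqF.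
  by rewrite expr0 invr1 => /lt_le_trans /(_ y1); rewrite ltxx.
rewrite big_ord_recl /= expr0 mul1r expr1.
have P0 : 0 <= 2 `^ (- p) :> R by exact: powR_ge0.
have [hy2|hy2] := ltP 2^-1 y.
  apply: (@le_trans _ _ 1).
    have yp : 0 < y by lra.
    by rewrite -(powRr0 y); apply: ger_powR; rewrite ?yp // ltW.
  by rewrite lerDl; apply: sumr_ge0 => i _; rewrite mulr_ge0 ?exprn_ge0 ?ler0n.
rewrite add0r.
have y2 : 0 <= 2 * y <= 1 by apply/andP; split; lra.
have {}hy : 2 * y = 0 \/ 2 ^- L < 2 * y.
  case: hy => [->|hy]; [by left; rewrite mulr0|right].
  by move: hy; rewrite exprS invfM; lra.
have h := IH (2 * y) y2 hy.
have -> : y `^ p = 2 `^ (- p) * (2 * y) `^ p.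
  rewrite powRM // mulrA -powR2D addNr powRr0 mul1r //.
apply: le_trans (ler_wpM2l P0 h) _.
rewrite mulr_sumr; apply: ler_sum => l _.
have -> : (2 ^- l.+1 < 2 * y) = (2 ^- (lift ord0 l).+1 < y).
  by rewrite lift0 [in RHS]exprS invfM; apply/idP/idP; lra.
by rewrite lift0 (exprS (2 `^ (- p))) mulrA.
Qed.

Lemma dyadic_lower_bound xs (a : R) : 0 < a ->
  exists L, {in xs, forall x, N x = 0 \/ a * 2 ^- L < N x}.
Proof.
move=> a0; elim: xs => [|x xs [L HL]]; first by exists 0%N.
have [Nx0|Nx0] := eqVneq (N x) 0.
  by exists L => y; rewrite inE => /orP[/eqP ->|/HL]; [left|].
have Nx : 0 < N x by rewrite lt_def Nx0 (seminorm_ge0 normN).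
have [L' hL'] := expr_unbounded (a / N x) (ltr1n R 2).
have mono m : a * 2 ^- (L + L') <= a * 2 ^- m \/ (maxn L L' < m)%N.
  have [h|h] := leqP m (L + L')%N; last by right; lia.
  by left; rewrite ler_pM2l // lef_pV2 ?posrE ?exprn_gt0 // ler_weXn2l // ler1n.
exists (L + L')%N => y; rewrite inE => /orP[/eqP ->|/HL [->|hy]]; [right|by left|right].
  case: (mono L') => [h|]; last by rewrite ltnNge leq_maxr.
  apply: (le_lt_trans h); rewrite ltr_pdivrMr ?exprn_gt0 //.
  by rewrite mulrC -ltr_pdivrMr.
case: (mono L) => [h|]; last by rewrite ltnNge leq_maxl.
exact: le_lt_trans hy.
Qed.

(** Among the vectors of norm above [c], keep the largest possible power of two, which costs the
    factor 2, and normalise them. Since their norms exceed [c], the contraction principle bounds the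
    new average by [avg N xs / c]. *)
Lemma flat_cotype_count (tau Q c : R) xs : 0 < tau -> 0 < Q -> 0 < c ->
  (forall j ys, size ys = (2 ^ j)%N -> {in ys, forall x, N x = 1} ->
      2 `^ (j%:R * tau) <= Q * avg N ys) ->
  (seq.count (fun x => (c < N x)%R) xs)%:R <= 2 * (Q * (avg N xs / c)) `^ tau^-1.
Proof.
move=> tau0 Q0 c0 HQ; rewrite -size_filter.
set ys := seq.filter _ xs.
have [ys0|ysp] := posnP (size ys).
  by rewrite ys0 mulr_ge0 ?powR_ge0.
pose j := trunc_log 2 (size ys).
have /andP[j1 j2] : (2 ^ j <= size ys < 2 ^ j.+1)%N by exact: trunc_log_bounds.
pose zs := take (2 ^ j) ys.
have szz : size zs = (2 ^ j)%N by rewrite size_takel.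
have zsN : {in zs, forall z, c < N z}.
  by move=> z /mem_take; rewrite mem_filter => /andP[].
have avz : avg N zs <= avg N xs.
  apply: (@le_trans _ _ (avg N ys)); first by rewrite -(cat_take_drop (2 ^ j) ys); exact: avg_catl_le.
  have -> : avg N xs = avg N (ys ++ seq.filter (predC (fun x => c < N x)) xs).
    by apply: avg_perm; rewrite perm_sym perm_filterC.
  exact: avg_catl_le.
pose ws := [seq (N z)^-1 *: z | z <- zs].
have ws1 : {in ws, forall x, N x = 1}.
  move=> _ /mapP[z /zsN zc ->].
  have zp : 0 < N z by exact: lt_trans zc.
  by rewrite (seminormZ normN) ger0_norm ?invr_ge0 ?(ltW zp) // mulVf // gt_eqF.
have szw : size ws = (2 ^ j)%N by rewrite size_map.
have h := HQ j ws szw ws1.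
have avw : avg N ws <= c^-1 * avg N zs.
  (* The minimum keeps the coefficient in [[0, 1]] at every vector, as [avg_contraction] demands,
     and is invisible on [zs]. *)
  have -> : ws = [seq c^-1 *: y | y <- [seq (Num.min 1 (c / N z)) *: z | z <- zs]].
    rewrite -map_comp; apply/eq_in_map => z /zsN zc /=.
    have zp : 0 < N z by exact: lt_trans zc.
    rewrite scalerA min_r; first by rewrite mulrA mulVf ?mul1r // gt_eqF.
    by rewrite ler_pdivrMr // mul1r ltW.
  rewrite (avg_scale normN) ?invr_ge0 ?(ltW c0) // ler_pM2l ?invr_gt0 //.
  apply: (avg_contraction normN) => z; rewrite ge_min lexx /= andbT le_min ler01 /=.
  by rewrite divr_ge0 ?(seminorm_ge0 normN) // ltW.
have {}h : 2 `^ (j%:R * tau) <= Q * (avg N xs / c).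
  apply: (le_trans h); rewrite ler_pM2l //; apply: (le_trans avw).
  by rewrite mulrC ler_pM2r ?invr_gt0.
apply: (@le_trans _ _ (2 * 2 ^+ j)).
  by rewrite -exprS -natrX ler_nat ltnW.
rewrite ler_pM2l //.
have -> : 2 ^+ j = (2 `^ (j%:R * tau)) `^ tau^-1 :> R.
  by rewrite -powRrM mulfK ?gt_eqF // powR_mulrn.
apply: ge0_ler_powR; rewrite ?nnegrE ?powR_ge0 ?invr_ge0 ?(ltW tau0) //.
by rewrite mulr_ge0 ?divr_ge0 ?avg_ge0 ?ltW.
Qed.

(** From a weak to a strong estimate: about [2 ^ (l / tau)] vectors at most have norm above
    [2 ^ -(l+1)] times the average, and the weights [2 ^ (- p l)] make this a geometric series of
    ratio [b < 1]. *)
Lemma cotype_of_flat (tau Q p : R) : 0 < tau -> 0 < Q -> tau^-1 < p ->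
  (forall j xs, size xs = (2 ^ j)%N -> {in xs, forall x, N x = 1} ->
      2 `^ (j%:R * tau) <= Q * avg N xs) ->
  exists2 K : R, 0 < K & forall zs, (\sum_(z <- zs) N z `^ p) `^ p^-1 <= K * avg N zs.
Proof.
move=> tau0 Q0 taup HQ.
have ti0 : 0 < tau^-1 by rewrite invr_gt0.
have p0 : 0 < p by lra.
pose b : R := 2 `^ (tau^-1 - p).
have b0 : 0 < b by exact: powR2_gt0.
have b1 : b < 1.
  rewrite -[ltRHS](powRr0 2) /b -[tau^-1 - p]opprK powRN powRr0 invf_lt1 ?powR2_gt0 //.
  by apply: powR2_gt1; lra.
pose D : R := 2 * (2 * Q) `^ tau^-1 / (1 - b).
have D0 : 0 < D by rewrite divr_gt0 ?subr_gt0 // mulr_gt0 // powR_gt0 // mulr_gt0.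
exists (D `^ p^-1); first exact: powR_gt0.
move=> zs; set A := avg N zs.
have A0 : 0 <= A by exact: avg_ge0.
have [A_eq0|An0] := eqVneq A 0.
  rewrite A_eq0 mulr0 big_seq big1 ?powR0 ?invr_eq0 ?gt_eqF // => z zin.
  have : N z <= 0 by rewrite -A_eq0; exact: norm_le_avg.
  rewrite le_eqVlt ltNge (seminorm_ge0 normN) orbF => /eqP ->.
  by rewrite powR0 // gt_eqF.
have Ap : 0 < A by rewrite lt_def An0.
suff H : \sum_(z <- zs) N z `^ p <= D * A `^ p.
  have -> : D `^ p^-1 * A = (D * A `^ p) `^ p^-1.
    by rewrite powRM ?powR_ge0 ?(ltW D0) // -powRrM divff ?gt_eqF // powRr1.
  apply: ge0_ler_powR => //; first by rewrite invr_ge0 ltW.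
    by rewrite nnegrE; apply: sumr_ge0 => *; exact: powR_ge0.
  by rewrite nnegrE mulr_ge0 ?powR_ge0 // ltW.
have [L HL] := dyadic_lower_bound zs Ap.
rewrite -ler_pdivrMr ?powR_gt0 // mulr_suml.
apply: (@le_trans _ _ (\sum_(z <- zs) \sum_(l < L) 2 `^ (- p) ^+ l * (A * 2 ^- l.+1 < N z)%R%:R)).
  rewrite big_seq [leRHS]big_seq; apply: ler_sum => z zin.
  have -> : N z `^ p / A `^ p = (N z / A) `^ p.
    rewrite powRM ?invr_ge0 ?(seminorm_ge0 normN) //; congr (_ * _).
    by rewrite -[in RHS]powR_inv1 ?(ltW Ap) // -powRrM mulN1r powRN.
  have -> : \sum_(l < L) 2 `^ (- p) ^+ l * (A * 2 ^- l.+1 < N z)%R%:R =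
            \sum_(l < L) 2 `^ (- p) ^+ l * (2 ^- l.+1 < N z / A)%R%:R.
    by apply: eq_bigr => l _; rewrite ltr_pdivlMr // [A * _]mulrC.
  apply: powR_le_dyadic => //.
    rewrite divr_ge0 ?(seminorm_ge0 normN) //= ler_pdivrMr // mul1r.
    exact: norm_le_avg.
  by case: (HL _ zin) => [->|h]; [left; rewrite mul0r|right; rewrite ltr_pdivlMr // mulrC].
rewrite exchange_big /=.
apply: (@le_trans _ _ (\sum_(l < L) (2 * (2 * Q) `^ tau^-1) * b ^+ l)).
  apply: ler_sum => l _; rewrite -mulr_sumr.
  have -> : \sum_(z <- zs) (A * 2 ^- l.+1 < N z)%R%:R = (seq.count (fun z => (A * 2 ^- l.+1 < N z)%R) zs)%:R :> R.
    by rewrite -sum1_count [in RHS]big_mkcond natr_sum; apply: eq_bigr => z _; case: ifP.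
  have c0 : 0 < A * 2 ^- l.+1 by rewrite mulr_gt0 ?invr_gt0 ?exprn_gt0.
  have := flat_cotype_count zs tau0 Q0 c0 HQ.
  rewrite -/A => h; apply: le_trans (ler_wpM2l _ h) _; first by rewrite exprn_ge0 ?powR_ge0.
  have -> : A / (A * 2 ^- l.+1) = 2 ^+ l * 2.
    by rewrite invfM invrK mulrA divff // mul1r exprSr.
  rewrite (_ : Q * (2 ^+ l * 2) = (2 * Q) * 2 ^+ l); last by ring.
  rewrite powRM ?exprn_ge0 ?mulr_ge0 ?(ltW Q0) //.
  have -> : b ^+ l = 2 `^ (- p) ^+ l * (2 ^+ l) `^ tau^-1.
    rewrite -!powR_mulrn ?powR_ge0 // -!powRrM -powR2D; congr (_ `^ _); ring.
  by rewrite le_eqVlt; apply/orP; left; apply/eqP; ring.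
rewrite -mulr_sumr /D ler_pM2l ?mulr_gt0 ?powR_gt0 ?mulr_gt0 //.
rewrite -[leRHS]div1r ler_pdivlMr ?subr_gt0 //.
have -> : (\sum_(l < L) b ^+ l) * (1 - b) = 1 - b ^+ L.
  by rewrite -{2}(expr1n _ L) subrXX mulrC; congr (_ * _); apply: eq_bigr => l _; rewrite expr1n mul1r.
by rewrite lerBlDr lerDl exprn_ge0 // ltW.
Qed.

End FlatCotype.

(** * The Dvoretzky-Rogers theorem *)

Section DvoretzkyRogers.
Context (R : realType) (V : lmodType R) (N : V -> R).
Hypothesis normN : seminorm_on N.
Hypothesis N0 : forall x, N x = 0 -> x = 0.

Definition linear_functional (phi : V -> R) :=
  (forall x y, phi (x + y) = phi x + phi y) /\ (forall a x, phi (a *: x) = a * phi x).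

Definition lin_comb n (c : 'rV[R]_n) (v : 'I_n -> V) : V := \sum_i c 0 i *: v i.

Definition finitely_spanned (W : V -> Prop) :=
  exists n (v : 'I_n -> V), forall x, W x -> exists c, x = lin_comb c v.

(** The kernel has codimension at most one in [W], so one vector [w] outside it completes a spanning
    family. *)
Lemma finitely_spanned_kernel (W : V -> Prop) phi : linear_functional phi ->
  (forall a x y, W x -> W y -> W (x - a *: y)) ->
  finitely_spanned (fun x => W x /\ phi x = 0) -> finitely_spanned W.
Proof.
move=> [phiD phiZ] WB [n [v span]].
have [[w [Ww phiw]]|Wker] := pselect (exists w, W w /\ phi w <> 0); last first.
  exists n, v => x Wx; apply: span; split=> //.
  by apply: contrapT => phix; apply: Wker; exists x.
pose v' (i : 'I_n.+1) := if unlift ord0 i is Some j then v j else w.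
exists n.+1, v' => x Wx.
have phix : phi (x - (phi x / phi w) *: w) = 0.
  rewrite phiD -scaleN1r !phiZ mulN1r divfK ?subrr //; exact/eqP.
have [c hc] := span _ (conj (WB (phi x / phi w) _ _ Wx Ww) phix).
exists (\row_i if unlift ord0 i is Some j then c 0 j else phi x / phi w).
rewrite /lin_comb big_ord_recl mxE /v' unlift_none -[LHS](subrK ((phi x / phi w) *: w)).
rewrite addrC hc; congr (_ + _); apply: eq_bigr => i _.
by rewrite mxE !liftK.
Qed.

Definition real_infinite_dimensional := ~ finitely_spanned (fun=> True).

Lemma common_kernel_nontrivial n (phi : nat -> V -> R) : real_infinite_dimensional ->
  (forall i, (i < n)%N -> linear_functional (phi i)) ->
  exists2 x, x <> 0 & forall i, (i < n)%N -> phi i x = 0.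
Proof.
move=> infdim lin; apply: contrapT => ker0; apply: infdim.
have : finitely_spanned (fun x => forall i, (i < n)%N -> phi i x = 0).
  exists 0%N, (fun=> 0) => x phix; exists 0; rewrite /lin_comb big_ord0.
  by apply: contrapT => x0; apply: ker0; exists x.
clear ker0; elim: n lin => [|n IH] lin; first by move=> [k [v sp]]; exists k, v => x _; exact: sp.
move=> sp; apply: IH; first by move=> i /ltnW; exact: lin.
apply: (@finitely_spanned_kernel _ (phi n)); first exact: lin.
  move=> a x y hx hy i ilt; have [pD pZ] := lin i (ltnW ilt).
  by rewrite pD -scaleN1r !pZ hx // hy // !mulr0 addr0.
have [k [v sp']] := sp; exists k, v => x [hx hn]; apply: sp' => i.
by rewrite ltnS leq_eqVlt => /predU1P[->|/hx].
Qed.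

(** Each new vector is taken in the common kernel of the earlier functionals. The triangular matrix
    [phi i (e j)] with unit diagonal later provides a contraction of nonzero volume. *)
Lemma triangular_system n : real_infinite_dimensional ->
  exists (e : nat -> V) (phi : nat -> V -> R), forall i, (i < n)%N ->
  [/\ linear_functional (phi i), forall x, `|phi i x| <= N x, N (e i) = 1,
      phi i (e i) = 1 & forall j, (i < j < n)%N -> phi i (e j) = 0].
Proof.
move=> infdim; elim: n => [|n [e [phi H]]]; first by exists (fun=> 0), (fun=> fun=> 0).
have [i ilt|x x0 hx] := @common_kernel_nontrivial n phi infdim.
  by have [] := H i ilt.
have Nx : N x != 0 by apply/eqP => /N0.
pose y := (N x)^-1 *: x.
have Ny : N y = 1.
  by rewrite (seminormZ normN) ger0_norm ?mulVf // invr_ge0 (seminorm_ge0 normN).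
have [psi [pD pZ ple py]] := norming_functional y normN.
exists (fun k => if k == n then y else e k), (fun k => if k == n then psi else phi k).
move=> i; rewrite ltnS leq_eqVlt => /predU1P[->|ilt].
  rewrite eqxx; split=> //; first by rewrite py.
  by move=> j /andP[nj]; rewrite ltnS leqNgt nj.
rewrite (ltn_eqF ilt); have [lin le1 Ne e1 h0] := H i ilt; split=> //.
move=> j /andP[ij]; rewrite ltnS leq_eqVlt => /predU1P[->|jn].
  by rewrite eqxx /y; have [_ pZ'] := lin; rewrite pZ' hx // mulr0.
by rewrite (ltn_eqF jn) h0 // ij.
Qed.

(** In matrix form, invariance under orthogonal matrices is just associativity of the product. *)
Definition sqnorm n (c : 'rV[R]_n) : R := (c *m c^T) 0 0.

Lemma sqnormE n (c : 'rV[R]_n) : sqnorm c = \sum_i c 0 i ^+ 2.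
Proof. by rewrite /sqnorm mxE; apply: eq_bigr => i _; rewrite mxE expr2. Qed.

Lemma sqnorm_ge0 n (c : 'rV[R]_n) : 0 <= sqnorm c.
Proof. by rewrite sqnormE; apply: sumr_ge0 => i _; exact: sqr_ge0. Qed.

(** These are the operators of norm at most 1 from the Euclidean space of dimension [n] to [V],
    given by the images of the basis vectors. *)
Definition contraction n (v : 'I_n -> V) := forall c, N (lin_comb c v) ^+ 2 <= sqnorm c.

Definition act n (M : 'M[R]_n) (v : 'I_n -> V) : 'I_n -> V :=
  fun i => lin_comb (row i M) v.

Lemma lin_comb_act n (M : 'M[R]_n) v c : lin_comb c (act M v) = lin_comb (c *m M) v.
Proof.
rewrite /lin_comb /act; under eq_bigr do rewrite scaler_sumr.
rewrite exchange_big; apply: eq_bigr => j _; rewrite mxE scaler_suml.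
by apply: eq_bigr => i _; rewrite scalerA mxE.
Qed.

Lemma lin_comb_delta n i (v : 'I_n -> V) : lin_comb (delta_mx 0 i) v = v i.
Proof.
rewrite /lin_comb (bigD1 i) //= mxE !eqxx scale1r big1 ?addr0 // => j ji.
by rewrite mxE (negPf ji) andbF scale0r.
Qed.

Lemma lin_combD n (c d : 'rV[R]_n) v : lin_comb (c + d) v = lin_comb c v + lin_comb d v.
Proof. by rewrite -big_split; apply: eq_bigr => i _; rewrite mxE scalerDl. Qed.

Lemma lin_combZ n a (c : 'rV[R]_n) v : lin_comb (a *: c) v = a *: lin_comb c v.
Proof. by rewrite scaler_sumr; apply: eq_bigr => i _; rewrite mxE scalerA. Qed.

Lemma contraction_le1 n (v : 'I_n -> V) i : contraction v -> N (v i) <= 1.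
Proof.
move=> /(_ (delta_mx 0 i)); rewrite lin_comb_delta sqnormE (bigD1 i) //= big1.
  rewrite mxE !eqxx expr1n addr0 -[leRHS](expr1n _ 2) ler_pXn2r ?nnegrE //.
  exact: (seminorm_ge0 normN).
by move=> j ji; rewrite mxE (negPf ji) andbF expr0n.
Qed.

Lemma contraction_orthogonal n (M : 'M[R]_n) v : M *m M^T = 1%:M ->
  contraction v -> contraction (act M v).
Proof.
move=> MM cv c; rewrite lin_comb_act; apply: le_trans (cv _) _.
by rewrite /sqnorm trmx_mul mulmxA -(mulmxA c) MM mulmx1.
Qed.

(* A Householder reflection. *)
Lemma orthogonal_completion n (k : 'I_n) (c : 'rV[R]_n) : sqnorm c = 1 ->
  (forall i : 'I_n, (i < k)%N -> c 0 i = 0) ->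
  exists M : 'M[R]_n, [/\ M *m M^T = 1%:M, row k M = c &
    forall i : 'I_n, (i < k)%N -> row i M = delta_mx 0 i].
Proof.
move=> c1 c0; have [->|cn] := eqVneq c (delta_mx 0 k).
  exists 1%:M; split; first by rewrite trmx1 mulmx1.
    by rewrite row1.
  by move=> i _; rewrite row1.
pose w := c - delta_mx 0 k.
have wi (i : 'I_n) : w 0 i = c 0 i - (i == k)%:R by rewrite !mxE eqxx.
have ww : sqnorm w = 2 * (1 - c 0 k).
  have -> : sqnorm w = \sum_i (c 0 i ^+ 2 + (i == k)%:R * (1 - 2 * c 0 k)).
    rewrite sqnormE; apply: eq_bigr => i _; rewrite wi.
    by case: eqVneq => [->|_] /=; ring.
  rewrite big_split /= -sqnormE c1 (bigD1 k) //= eqxx mul1r big1 => [|i /negPf ->].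
    by ring.
  by rewrite mul0r.
have ck : 1 - c 0 k != 0.
  apply/eqP => ck0; case/negP: cn; rewrite -subr_eq0 -/w.
  apply/eqP/rowP => i; rewrite [RHS]mxE; apply/eqP; rewrite -sqrf_eq0; apply/eqP.
  move: ww; rewrite ck0 mulr0 sqnormE => /psumr_eq0P; apply=> // j _; exact: sqr_ge0.
have wwT : w *m w^T = (2 * (1 - c 0 k))%:M by rewrite [LHS]mx11_scalar -ww.
have wE : w = c - delta_mx 0 k by [].
(* [b] is 2 divided by the squared norm of [w], so [M] reflects the [k]-th basis vector onto [c]. It
   fixes the earlier basis vectors because [w] vanishes there. *)
clearbody w; pose b := (1 - c 0 k)^-1.
pose M := 1%:M - b *: (w^T *m w).
have MT : M^T = M by rewrite /M linearB /= linearZ /= trmx1 trmx_mul trmxK.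
have rowM i : row i M = delta_mx 0 i - (b * w 0 i) *: w.
  rewrite /M linearB /= row1 linearZ /= row_mul.
  congr (_ - _); apply/rowP => j; rewrite !mxE big_ord1 !mxE; ring.
exists M; split.
- rewrite MT /M mulmxBl mul1mx mulmxBr mulmx1 -scalemxAl -scalemxAr.
  rewrite -mulmxA (mulmxA w) wwT mul_scalar_mx -scalemxAr !scalerA.
  have -> : b * (b * (2 * (1 - c 0 k))) = b + b by rewrite /b; field.
  by rewrite scalerDl; apply/matrixP => i j; rewrite !mxE; ring.
- rewrite rowM wi eqxx; have -> : b * (c 0 k - 1) = -1 by rewrite -opprB mulrN mulVf.
  by rewrite scaleN1r opprK wE addrC subrK.
- move=> i ik; rewrite rowM wi c0 // (_ : i == k = false) ?subrr ?mulr0 ?scale0r ?subr0 //.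
  by apply/negbTE; rewrite -val_eqE /= ltn_eqF.
Qed.

Section Volume.
Context (n : nat) (phi : 'I_n -> V -> R).
Hypothesis phi_lin : forall i, linear_functional (phi i).
Hypothesis phi_le : forall i x, `|phi i x| <= N x.

(** A determinant for operators into [V], read through fixed functionals. A contraction of nearly
    maximal volume plays the part of the ellipsoid of maximal volume. *)
Definition volume (v : 'I_n -> V) : R := \det (\matrix_(i, j) phi i (v j)).

Lemma volume_act (M : 'M[R]_n) v : volume (act M v) = volume v * \det M.
Proof.
rewrite /volume -(det_tr M) -det_mulmx; congr (\det _); apply/matrixP => i j.
rewrite !mxE /act /lin_comb; have [pD pZ] := phi_lin i.
have p0 : phi i 0 = 0 by rewrite -(scale0r 0) pZ mul0r.
rewrite (big_morph _ pD p0); apply: eq_bigr => l _.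
by rewrite !mxE pZ mulrC.
Qed.

Lemma volume_contraction v : contraction v -> `|volume v| <= #|{perm 'I_n}|%:R.
Proof.
move=> cv; apply: (le_trans (ler_norm_sum _ _ _)).
rewrite -sum1_card natr_sum; apply: ler_sum => s _.
rewrite normrM normrX normrN1 expr1n mul1r normr_prod.
apply: (@le_trans _ _ (\prod_(i < n) 1)); last by rewrite big1_eq.
apply: ler_prod => i _.
by rewrite normr_ge0 /= mxE (le_trans (phi_le _ _)) // contraction_le1.
Qed.

(* Where [v] is small on the last coordinates, it can be enlarged there by a
   factor [sqrt 8] at the cost of a factor [sqrt (1/2)] on the first ones. *)
Lemma contraction_enlarge v (k : nat) : contraction v -> (k + k < n)%N ->
  (forall c : 'rV[R]_n, (forall i : 'I_n, (i < k)%N -> c 0 i = 0) ->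
    N (lin_comb c v) <= 4^-1 * Num.sqrt (sqnorm c)) ->
  exists2 w, contraction w & 2 * `|volume v| <= `|volume w|.
Proof.
(* With this [mu], the square of [mu * (x + y)] is at most [x ^ 2 + y ^ 2], and the factor 4 on the
   last coordinates cancels the [4^-1] of [small]. *)
move=> cv kn small; pose mu : R := Num.sqrt 2^-1.
have mu2 : mu ^+ 2 = 2^-1 by rewrite sqr_sqrtr // invr_ge0.
have mu0 : 0 <= mu by exact: sqrtr_ge0.
pose d : 'rV[R]_n := \row_i (if (i < k)%N then mu else 4 * mu).
exists (act (diag_mx d) v).
  move=> c; rewrite lin_comb_act.
  pose a : 'rV[R]_n := \row_i (if (i < k)%N then c 0 i else 0).
  pose b : 'rV[R]_n := \row_i (if (i < k)%N then 0 else c 0 i).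
  have -> : c *m diag_mx d = mu *: a + (4 * mu) *: b.
    apply/rowP => i; rewrite mul_mx_diag !mxE.
    by case: ifP => _; rewrite ?mulr0 ?addr0 ?add0r mulrC.
  have cab : sqnorm c = sqnorm a + sqnorm b.
    rewrite !sqnormE -big_split; apply: eq_bigr => i _; rewrite /= !mxE.
    by case: ifP => _; rewrite expr0n ?addr0 ?add0r.
  have Nb : N (lin_comb b v) <= 4^-1 * Num.sqrt (sqnorm b).
    by apply: small => i ik; rewrite mxE ik.
  have Na : N (lin_comb a v) <= Num.sqrt (sqnorm a).
    rewrite -(ger0_norm (seminorm_ge0 normN _)) -sqrtr_sqr ler_sqrt ?sqnorm_ge0 //.
  have h : N (lin_comb (mu *: a + (4 * mu) *: b) v) <= mu * (Num.sqrt (sqnorm a) + Num.sqrt (sqnorm b)).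
    rewrite lin_combD !lin_combZ; apply: (le_trans (seminormD normN _ _)).
    rewrite !(seminormZ normN) !ger0_norm ?mulr_ge0 // mulrDr lerD ?ler_wpM2l //.
    rewrite -mulrA mulrCA ler_wpM2l //; lra.
  apply: (@le_trans _ _ ((mu * (Num.sqrt (sqnorm a) + Num.sqrt (sqnorm b))) ^+ 2)).
    by rewrite ler_pXn2r ?nnegrE ?(seminorm_ge0 normN) // mulr_ge0 // addr_ge0 ?sqrtr_ge0.
  rewrite exprMn mu2 cab -{2}(sqr_sqrtr (sqnorm_ge0 a)) -{2}(sqr_sqrtr (sqnorm_ge0 b)).
  move: (Num.sqrt _) (Num.sqrt _) => x y; have := sqr_ge0 (x - y); nra.
rewrite volume_act det_diag normrM mulrC ler_wpM2l //.
have -> : \prod_i d 0 i = mu ^+ n * 4 ^+ (n - k).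
  have kn' : (k <= n)%N by lia.
  rewrite (eq_bigr (fun i : 'I_n => mu * (if (i < k)%N then 1 else 4))); last first.
    by move=> i _; rewrite mxE; case: ifP; rewrite ?mulr1 // mulrC.
  rewrite big_split /= prodr_const card_ord; congr (_ * _).
  rewrite -(big_mkord predT (fun i => if (i < k)%N then 1 else 4 : R)).
  rewrite (big_cat_nat _ kn') //= big1_seq ?mul1r; last first.
    by move=> i /andP[_]; rewrite mem_index_iota => /andP[_ ->].
  rewrite (eq_big_nat _ _ (F2 := fun=> 4)) ?prodr_const_nat // => i /andP[ki _].
  by rewrite ltnNge ki.
have p0 : 0 <= mu ^+ n * 4 ^+ (n - k) by rewrite mulr_ge0 ?exprn_ge0.
(* In the squared determinant, each of the first [k] coordinates paired with a later one contributes
   4 and each remaining coordinate 8; as [2 k < n], at least one remains. *)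
rewrite ger0_norm // -(@ler_pXn2r _ 2) ?nnegrE //.
rewrite exprMn -!exprM mulnC exprM mu2 (mulnC _ 2) exprM.
have -> : (n - k = k + (n - k - k))%N by lia.
have n_eq : (n = k + k + (n - k - k))%N by lia.
rewrite {1}n_eq !exprD; have l1 : (0 < n - k - k)%N by lia.
case: (n - k - k)%N l1 => // l _.
have -> : 2^-1 ^+ k * 2^-1 ^+ k * 2^-1 ^+ l.+1 * ((4 ^+ 2) ^+ k * (4 ^+ 2) ^+ l.+1) =
   (2^-1 * 2^-1 * 4 ^+ 2) ^+ k * (2^-1 * 4 ^+ 2) ^+ l.+1 :> R by rewrite !exprMn; ring.
have -> : 2^-1 * 4 ^+ 2 = 8 :> R by field.
have -> : 2^-1 * 2^-1 * 4 ^+ 2 = 4 :> R by field.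
have h4 : 1 <= 4 ^+ k :> R by rewrite exprn_ege1 // ler1n.
have h8 : 1 <= 8 ^+ l :> R by rewrite exprn_ege1 // ler1n.
rewrite (exprS 8) expr2; move: (4 ^+ k) (8 ^+ l) h4 h8 => x y hx hy; nra.
Qed.

End Volume.

(** A contraction whose volume exceeds half the supremum cannot be enlarged to twice its volume.
    Hence, while [2 k < n], some unit vector vanishing on the first [k] coordinates has an image of
    norm at least 1/4, and an orthogonal change of basis moves it to position [k] without altering
    the volume up to sign. Taking [n = 2 m + 1] permits [m] such steps. *)
Theorem dvoretzky_rogers m : real_infinite_dimensional ->
  exists zs : seq V, [/\ size zs = m, {in zs, forall z, 4^-1 <= N z} &
    forall c : nat -> R, N (\sum_(i < m) c i *: nth 0 zs i) ^+ 2 <= \sum_(i < m) c i ^+ 2].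
Proof.
move=> infdim; pose n := (m + m).+1.
have [e [phi' H]] := triangular_system n infdim.
pose phi (i : 'I_n) := phi' i.
have phi_lin i : linear_functional (phi i) by have [h _ _ _ _] := H i (ltn_ord i); exact: h.
have phi_le i x : `|phi i x| <= N x by have [_ h _ _ _] := H i (ltn_ord i); exact: h.
pose S := [set `|volume phi v| | v in @contraction n].
have n0 : 0 < n%:R :> R by rewrite ltr0n.
have supS : has_sup S.
  split; last first.
    by exists #|{perm 'I_n}|%:R => _ [v cv <-]; exact: volume_contraction.
  exists `|volume phi (fun=> 0)|, (fun=> 0) => // c; rewrite /lin_comb big1.
    by rewrite (seminorm0 normN) expr0n sqnorm_ge0.
  by move=> i _; rewrite scaler0.
pose v0 (i : 'I_n) := n%:R^-1 *: e i.
have cv0 : contraction v0.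
  move=> c; set s := Num.sqrt (sqnorm c).
  rewrite -(sqr_sqrtr (sqnorm_ge0 c)) ler_pXn2r ?nnegrE ?sqrtr_ge0 ?(seminorm_ge0 normN) //.
  have Nsum (F : 'I_n -> V) : N (\sum_i F i) <= \sum_i N (F i).
    apply: (big_ind2 (fun x y => N x <= y)) => //; first by rewrite (seminorm0 normN).
    by move=> x1 x2 y1 y2 h1 h2; apply: le_trans (seminormD normN _ _) (lerD h1 h2).
  apply: (le_trans (Nsum _)); apply: (@le_trans _ _ (\sum_(i < n) s / n%:R)); last first.
    by rewrite sumr_const card_ord -[s / _ *+ _]mulr_natr divfK ?gt_eqF.
  apply: ler_sum => i _; rewrite /v0 scalerA (seminormZ normN).
  have [_ _ -> _ _] := H i (ltn_ord i).
  rewrite mulr1 normrM [`|n%:R^-1|]ger0_norm ?invr_ge0 ?ler0n // ler_pM2r ?invr_gt0 //.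
  rewrite -sqrtr_sqr ler_sqrt ?sqnorm_ge0 // sqnormE (bigD1 i) //= lerDl.
  by apply: sumr_ge0 => j _; exact: sqr_ge0.
have vol0 : 0 < `|volume phi v0|.
  rewrite normr_gt0 /volume det_trig; last first.
    apply/is_trig_mxP => i j ij; rewrite mxE /phi.
    have [[_ pZ] _ _ _ h0] := H i (ltn_ord i).
    by rewrite /v0 pZ h0 ?mulr0 // ij ltn_ord.
  apply/prodf_neq0 => i _; rewrite mxE /v0 /phi.
  have [[_ pZ] _ _ e1 _] := H i (ltn_ord i).
  by rewrite pZ e1 mulr1 invr_neq0 // gt_eqF.
have s0 : 0 < sup S by apply: lt_le_trans vol0 _; apply: ub_le_sup; [case: supS|exists v0].
have Sle v : contraction v -> `|volume phi v| <= sup S.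
  by move=> cv; apply: ub_le_sup; [case: supS|exists v].
have step k : (k <= m)%N -> exists v, [/\ contraction v, sup S / 2 < `|volume phi v| &
    forall i : 'I_n, (i < k)%N -> 4^-1 <= N (v i)].
  elim: k => [_|k IH km].
    have [_ [v cv <-] hv] := sup_adherent (divr_gt0 s0 (ltr0n R 2)) supS.
    by exists v; split=> //; apply: le_lt_trans hv; lra.
  have [v [cv hv Nv]] := IH (ltnW km).
  have kn : (k < n)%N by lia.
  have [[c [c1 c0 cN]]|none] := pselect (exists c : 'rV[R]_n, [/\ sqnorm c = 1,
      forall i : 'I_n, (i < k)%N -> c 0 i = 0 & 4^-1 <= N (lin_comb c v)]).
    have [M [MM rowk rowi]] := @orthogonal_completion n (Ordinal kn) c c1 c0.
    exists (act M v); split.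
    - exact: contraction_orthogonal.
    - rewrite (volume_act phi_lin) normrM.
      have : `|\det M| ^+ 2 = 1.
        by rewrite -normrX expr2 -{2}(det_tr M) -det_mulmx MM det1 normr1.
      move/eqP; rewrite sqrf_eq1 => /orP[/eqP ->|/eqP]; first by rewrite mulr1.
      by have := normr_ge0 (\det M) => /[swap] ->; lra.
    - move=> i; rewrite ltnS leq_eqVlt => /predU1P[ik|ik].
        by rewrite /act (_ : i = Ordinal kn) ?rowk //; apply: val_inj.
      by rewrite /act rowi // lin_comb_delta Nv.
  have kk : (k + k < n)%N by lia.
  have small (c : 'rV[R]_n) : (forall i : 'I_n, (i < k)%N -> c 0 i = 0) ->
      N (lin_comb c v) <= 4^-1 * Num.sqrt (sqnorm c).
    move=> c0; have [c_eq0|cn0] := eqVneq (sqnorm c) 0.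
      have := cv c; rewrite c_eq0 sqrtr0 mulr0.
      by have := seminorm_ge0 normN (lin_comb c v); nra.
    have sc : 0 < Num.sqrt (sqnorm c) by rewrite sqrtr_gt0 lt_def cn0 sqnorm_ge0.
    rewrite leNgt; apply/negP => big_c; apply: none.
    exists ((Num.sqrt (sqnorm c))^-1 *: c); split.
    - have -> : sqnorm ((Num.sqrt (sqnorm c))^-1 *: c) = (Num.sqrt (sqnorm c)) ^- 2 * sqnorm c.
        rewrite !sqnormE mulr_sumr; apply: eq_bigr => i _.
        by rewrite mxE exprMn exprVn.
      by rewrite sqr_sqrtr ?sqnorm_ge0 // mulVf.
    - by move=> i ik; rewrite mxE c0 // mulr0.
    - rewrite lin_combZ (seminormZ normN) ger0_norm ?invr_ge0 ?sqrtr_ge0 //.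
      by rewrite ler_pdivlMl // mulrC ltW.
  have [w cw hw] := contraction_enlarge phi_lin cv kk small.
  by have := Sle w cw; lra.
have [v [cv _ Nv]] := step m (leqnn m).
have mn i : (i < m)%N -> (i < n)%N by lia.
pose z i := if (i < m)%N =P true is ReflectT h then v (Ordinal (mn i h)) else 0.
have zE i (h : (i < m)%N) : z i = v (Ordinal (mn i h)).
  by rewrite /z; case: eqP => // h'; congr v; apply: val_inj.
exists (mkseq z m); split; first by rewrite size_mkseq.
  move=> x /mapP[j]; rewrite mem_iota add0n => /andP[_ im] ->.
  by rewrite (zE j im) Nv.
move=> c; pose d : 'rV[R]_n := \row_i (if (i < m)%N then c i else 0).
have -> : \sum_(i < m) c i *: nth 0 (mkseq z m) i = lin_comb d v.
  rewrite /lin_comb (big_ord_widen_cond n predT (fun i => c i *: nth 0 (mkseq z m) i)) //; last by lia.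
  rewrite big_mkcond; apply: eq_bigr => i _ /=; rewrite mxE; case: ifP => im; last by rewrite scale0r.
  by rewrite nth_mkseq // (zE i im); congr (_ *: v _); apply: val_inj.
apply: (le_trans (cv d)); rewrite sqnormE.
rewrite (big_ord_widen_cond n predT (fun i => c i ^+ 2)) ?[leRHS]big_mkcond; last by lia.
by apply: ler_sum => i _; rewrite mxE /=; case: ifP; rewrite ?expr0n.
Qed.

End DvoretzkyRogers.

(** * Failure of summability *)

Section SummingFails.
Context (R : realType) (V : lmodType R) (N : V -> R).
Hypothesis normN : seminorm_on N.
Hypothesis N0 : forall x, N x = 0 -> x = 0.
Hypothesis infdim : real_infinite_dimensional V.
Implicit Types (zs : seq V).

Definition cotype_bound (q K : R) :=
  forall zs, (\sum_(z <- zs) N z `^ q) `^ q^-1 <= K * avg N zs.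

(** For [2 ^ a] vectors given by [dvoretzky_rogers], signed sums have norm at most [2 ^ (a / 2)]
    whereas the [l_r] norm is at least [2 ^ (a / r) / 4]. *)
Lemma summing_fails_lt2 (r C : R) : 0 < r -> r < 2 -> 0 < C -> exists zs,
  {in signed_sums zs 0, forall u, C * N u < (\sum_(z <- zs) N z `^ r) `^ r^-1}.
Proof.
move=> r0 r2 C0.
have ri : 2^-1 < r^-1 by rewrite ltf_pV2 ?posrE.
have [a ha] : exists a, 4 * C < 2 `^ (a%:R * (r^-1 - 2^-1)) :> R.
  by apply: powR_unbounded; lra.
have [zs [szz Nz Hz]] := dvoretzky_rogers normN N0 (2 ^ a) infdim.
exists zs => u /mem_signed_sums[ss sz_ss uE].
have Nu : N u <= 2 `^ (a%:R * 2^-1).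
  have -> : u = \sum_(i < 2 ^ a) (if nth true ss i then 1 else -1 : R) *: nth 0 zs i.
    rewrite uE add0r (big_nth (true, 0)) big_mkord size_zip sz_ss minnn szz.
    apply: eq_bigr => i _; rewrite nth_zip ?sz_ss //=.
    by case: ifP => _; rewrite ?scale1r ?scaleN1r.
  have p0 : 0 <= 2 `^ (a%:R * 2^-1) :> R by exact: powR_ge0.
  rewrite -(@ler_pXn2r _ 2) ?nnegrE ?(seminorm_ge0 normN) //.
  apply: (le_trans (Hz (fun i => if nth true ss i then 1 else -1 : R))).
  rewrite (eq_bigr (fun=> 1)); last by move=> i _; case: ifP; rewrite ?sqrrN expr1n.
  rewrite sumr_const card_ord -[leRHS]powR_mulrn // -powRrM divfK ?pnatr_eq0 //.
  by rewrite pow2R.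
apply: (@lt_le_trans _ _ (2 `^ (a%:R * r^-1) * 4^-1)).
  apply: (le_lt_trans (ler_wpM2l (ltW C0) Nu)).
  have -> : a%:R * r^-1 = a%:R * (r^-1 - 2^-1) + a%:R * 2^-1 by ring.
  rewrite powR2D mulrAC ltr_pM2r ?powR2_gt0 //; lra.
have -> : 2 `^ (a%:R * r^-1) * 4^-1 = ((2 ^ a)%:R * 4^-1 `^ r) `^ r^-1.
  rewrite powRM ?ler0n ?powR_ge0 // -powRrM divff ?gt_eqF // pow2_powR powRr1 //.
have S0 : 0 <= (2 ^ a)%:R * 4^-1 `^ r :> R by rewrite mulr_ge0 ?powR_ge0.
apply: ge0_ler_powR; rewrite ?nnegrE ?invr_ge0 ?(ltW r0) //.
  by apply: sumr_ge0 => *; exact: powR_ge0.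
have -> : (2 ^ a)%:R * 4^-1 `^ r = \sum_(z <- zs) 4^-1 `^ r.
  by rewrite big_const_seq count_predT szz iter_addr_0 mulr_natl.
rewrite big_seq [leRHS]big_seq; apply: ler_sum => z zin.
apply: ge0_ler_powR; rewrite ?nnegrE ?(seminorm_ge0 normN) ?(ltW r0) ?invr_ge0 //.
exact: Nz.
Qed.

Lemma summing_fails (q K r C : R) : 2 <= q -> 0 < K -> cotype_bound q K ->
  (forall p K', 2 <= p -> p < q -> 0 < K' -> ~ cotype_bound p K') ->
  0 < r -> r < q -> 0 < C -> exists zs,
  {in signed_sums zs 0, forall u, C * N u < (\sum_(z <- zs) N z `^ r) `^ r^-1}.
Proof.
move=> q2 K0 HK opt r0 rq C0.
have [r2|r2] := ltP r 2; first exact: summing_fails_lt2.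
apply: contrapT => none.
have HC zs : exists2 u, u \in signed_sums zs 0 & (\sum_(z <- zs) N z `^ r) `^ r^-1 <= C * N u.
  apply: contrapT => Hzs; apply: none; exists zs => u uin.
  by rewrite ltNge; apply/negP => h; apply: Hzs; exists u.
have [tau [Q [tauq Q0 HQ]]] := flat_cotype normN r2 rq C0 K0 HC HK.
have qi : 0 < q^-1 by rewrite invr_gt0; lra.
have tau0 : 0 < tau by lra.
(* Both 2 and [1 / tau] are below [q], so the midpoint of [m] and [q] is a cotype in [[2, q[],
   against the optimality of [q]. *)
pose m := Num.max 2 tau^-1.
have mq : m < q.
  rewrite gt_max; apply/andP; split; first by lra.
  by rewrite -[ltRHS]invrK ltf_pV2 ?posrE.
have m2 : 2 <= m by rewrite le_max lexx.
have mt : tau^-1 <= m by rewrite le_max lexx orbT.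
have tp : tau^-1 < (m + q) / 2 by lra.
have [K' K'0 HK'] := cotype_of_flat normN tau0 Q0 tp HQ.
by apply: (opt ((m + q) / 2) K') => //; lra.
Qed.

(** A convex function on a cube is bounded by its values at the vertices. *)
Lemma norm_le_signed_sums zs v (B : R) (c : nat -> R) : (forall i, `|c i| <= 1) ->
  {in signed_sums zs v, forall u, N u <= B} ->
  N (v + \sum_(i < size zs) c i *: nth 0 zs i) <= B.
Proof.
elim: zs v c => [|x zs IH] v c c1 H; first by rewrite big_ord0 addr0 H ?mem_head.
rewrite big_ord_recl /=; set S := \sum_(i < size zs) _.
have h1 : N (v + x + S) <= B.
  by apply: (IH _ (fun i => c i.+1)) => // u uin; apply: H; rewrite mem_cat uin.
have h2 : N (v - x + S) <= B.
  by apply: (IH _ (fun i => c i.+1)) => // u uin; apply: H; rewrite mem_cat uin orbT.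
have -> : v + (c 0%N *: x + S) = ((1 + c 0%N) / 2) *: (v + x + S) + ((1 - c 0%N) / 2) *: (v - x + S).
  rewrite !scalerDr addrACA -scalerDl [X in _ = X + _]addrACA -scalerDl scalerN -scalerBl.
  have -> : (1 + c 0%N) / 2 + (1 - c 0%N) / 2 = 1 by lra.
  have -> : (1 + c 0%N) / 2 - (1 - c 0%N) / 2 = c 0%N by lra.
  by rewrite !scale1r addrA.
have := c1 0%N; rewrite ler_norml => /andP[c2 c3].
have p1 : 0 <= (1 + c 0%N) / 2 by lra.
have p2 : 0 <= (1 - c 0%N) / 2 by lra.
apply: (le_trans (seminormD normN _ _)).
rewrite !(seminormZ normN) (ger0_norm p1) (ger0_norm p2).
apply: (le_trans (lerD (ler_wpM2l p1 h1) (ler_wpM2l p2 h2))).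
rewrite -mulrDl; have -> : (1 + c 0%N) / 2 + (1 - c 0%N) / 2 = 1 by lra.
by rewrite mul1r.
Qed.

(** The unit ball of the weakly 1-summable families of length [n]. *)
Definition tame n (y : 'I_n -> V) := forall c : 'I_n -> R, (forall i, `|c i| <= 1) ->
  N (\sum_i c i *: y i) <= 1.

Lemma tame_le1 n (y : 'I_n -> V) i : tame y -> N (y i) <= 1.
Proof.
move=> /(_ (fun j => (j == i)%:R)) H.
have -> : y i = \sum_j (j == i)%:R *: y j.
  rewrite (bigD1 i) //= eqxx scale1r big1 ?addr0 // => j /negPf ->.
  by rewrite scale0r.
by apply: H => j; case: eqP; rewrite ?normr1 ?normr0.
Qed.

Definition mass (r : R) n (y : 'I_n -> V) (A : {set 'I_n}) : R := \sum_(i in A) N (y i) `^ r.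

Lemma tame_large_mass (r T : R) : 0 < r -> 0 < T ->
  (forall C, 0 < C -> exists zs,
    {in signed_sums zs 0, forall u, C * N u < (\sum_(z <- zs) N z `^ r) `^ r^-1}) ->
  exists n, exists2 y : 'I_n -> V, tame y & T <= \sum_i N (y i) `^ r.
Proof.
move=> r0 T0 fails.
have [zs Hzs] := fails _ (powR_gt0 r^-1 T0).
set B := (\sum_(z <- zs) N z `^ r) `^ r^-1 in Hzs.
have [u0 u0in _] := rad_exists_le zs (fun=> 0 : R) 0.
have C0 : 0 < T `^ r^-1 by exact: powR_gt0.
have B0 : 0 < B.
  by apply: le_lt_trans (Hzs _ u0in); rewrite mulr_ge0 ?(ltW C0) ?(seminorm_ge0 normN).
pose t := T `^ r^-1 / B.
have t0 : 0 < t by rewrite divr_gt0.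
exists (size zs), (fun i => t *: nth 0 zs i).
  move=> c c1.
  have [c' c'E c'1] : exists2 c' : nat -> R, forall i : 'I_(size zs), c' i = c i & forall i, `|c' i| <= 1.
    exists (fun i => if insub i is Some j then c j else 0) => [i|i]; first by rewrite valK.
    by case: insub => [j|]; rewrite ?normr0 ?ler01.
  have := @norm_le_signed_sums zs 0 (B / T `^ r^-1) c' c'1.
  rewrite add0r => H.
  have -> : \sum_i c i *: (t *: nth 0 zs i) = t *: \sum_(i < size zs) c' i *: nth 0 zs i.
    by rewrite scaler_sumr; apply: eq_bigr => i _; rewrite c'E !scalerA mulrC.
  rewrite (seminormZ normN) ger0_norm ?(ltW t0) //.
  apply: le_trans (ler_wpM2l (ltW t0) (H _)) _.
    by move=> u uin; rewrite ler_pdivlMr // mulrC ltW // Hzs.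
  by rewrite /t mulrA divfK ?gt_eqF // divff // gt_eqF.
have -> : \sum_(i < size zs) N (t *: nth 0 zs i) `^ r = t `^ r * \sum_(z <- zs) N z `^ r.
  rewrite (big_nth 0) big_mkord mulr_sumr; apply: eq_bigr => i _.
  by rewrite (seminormZ normN) ger0_norm ?(ltW t0) // powRM ?(ltW t0) ?(seminorm_ge0 normN).
have BE : \sum_(z <- zs) N z `^ r = B `^ r.
  by rewrite /B -powRrM mulVf ?gt_eqF // powRr1 //; apply: sumr_ge0 => *; exact: powR_ge0.
rewrite BE -powRM ?(ltW t0) ?(ltW B0) // /t divfK ?gt_eqF //.
by rewrite -powRrM mulVf ?gt_eqF // powRr1 // ltW.
Qed.

(* Among nearly extremal tame families, disjoint blocks of large norm relative
   to their mass cannot cover half of the total mass. *)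
Lemma good_family (r T : R) : 0 < r -> 0 < T ->
  (forall C, 0 < C -> exists zs,
    {in signed_sums zs 0, forall u, C * N u < (\sum_(z <- zs) N z `^ r) `^ r^-1}) ->
  exists n, exists y : 'I_n -> V,
  [/\ 2^-1 <= \sum_i N (y i) `^ r, \sum_i N (y i) `^ r <= 1,
      forall i, N (y i) `^ r <= T^-1 &
      forall (A : {set 'I_n}) (c : 'I_n -> R), (forall i, `|c i| <= 1) ->
        N (\sum_(i in A) c i *: y i) <= (4 * mass r y A) `^ r^-1].
Proof.
move=> r0 T0 fails.
have T20 : 0 < 2 * T by lra.
have [n [y0 ty0 Ty0]] := tame_large_mass r0 T20 fails.
pose S := [set \sum_i N (y i) `^ r | y in @tame n].
have supS : has_sup S.
  split; first by exists (\sum_i N (y0 i) `^ r), y0.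
  exists n%:R => _ [y ty <-].
  apply: (@le_trans _ _ (\sum_(i < n) 1)); last by rewrite sumr_const card_ord.
  apply: ler_sum => i _; rewrite -(congr1 (fun f => f r) (@powR1 R)).
  by apply: ge0_ler_powR; rewrite ?nnegrE ?(ltW r0) ?(seminorm_ge0 normN) // tame_le1.
have Sle (y : 'I_n -> V) : tame y -> \sum_i N (y i) `^ r <= sup S.
  by move=> ty; apply: ub_le_sup; [case: supS|exists y].
have TS : 2 * T <= sup S by apply: le_trans (Sle _ ty0).
have s0 : 0 < sup S by lra.
have [y [ty yS yT]] : exists y, [/\ @tame n y, sup S / 2 < \sum_i N (y i) `^ r & T < \sum_i N (y i) `^ r].
  have [_ [y ty <-] hy] := sup_adherent (divr_gt0 s0 (ltr0n R 2)) supS.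
  by exists y; split=> //; lra.
set W := \sum_i N (y i) `^ r in yS yT.
have W0 : 0 < W by lra.
(* [U] is covered by disjoint blocks whose norm is too large for their mass, each collapsed into one
   vector of [z] placed at an index of the block. *)
pose P (U : {set 'I_n}) := exists z : 'I_n -> V,
  [/\ forall d : 'I_n -> R, (forall i, `|d i| <= 1) ->
        exists2 c : 'I_n -> R, forall i, `|c i| <= 1 & \sum_j d j *: z j = \sum_(i in U) c i *: y i,
      forall j, j \notin U -> z j = 0 &
      4 * mass r y U <= \sum_j N (z j) `^ r].
have Pset0 : P finset.set0.
  exists (fun=> 0); split=> // [d d1|].
    by exists (fun=> 0); rewrite ?normr0 // ?big_set0 ?big1 // => *; rewrite ?normr0 ?ler01 ?scaler0.
  rewrite /mass big_set0 mulr0; apply: sumr_ge0 => *; exact: powR_ge0.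
have [U [PU Umax]] : exists U, P U /\ forall U', P U' -> (#|U'| <= #|U|)%N.
  have asP0 : `[< P finset.set0 >] by apply/asboolP.
  case: (@arg_maxnP _ (finset.set0 : {set 'I_n}) (fun U => `[< P U >]) (fun U => #|U|) asP0) => U /asboolP PU Umax.
  by exists U; split=> // U' PU'; apply: Umax; apply/asboolP.
(* A bad set [A] outside the maximal [U] could be collapsed at its point [a] and added to [U]. *)
have goodA (A : {set 'I_n}) (c : 'I_n -> R) : (forall i, i \in A -> i \notin U) -> (forall i, `|c i| <= 1) ->
    N (\sum_(i in A) c i *: y i) `^ r <= 4 * mass r y A.
  move=> dAU c1; have [->|[a aA]] := finset.set_0Vmem A.
    by rewrite /mass !big_set0 mulr0 (seminorm0 normN) powR0 // gt_eqF.
  rewrite leNgt; apply/negP => bad.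
  have aU : a \notin U by exact: dAU.
  have [z [zc z0 zm]] := PU.
  have : (#|A :|: U| <= #|U|)%N.
    apply: Umax; exists (fun j => if j == a then \sum_(i in A) c i *: y i else z j); split.
    - move=> d d1; have [c' c'1 c'E] := zc d d1.
      exists (fun i => if i \in A then d a * c i else c' i).
        move=> i; case: ifP => _ //; rewrite normrM.
        by apply: le_trans (ler_pM _ _ (d1 a) (c1 i)) _; rewrite ?mulr1.
      rewrite (eq_bigr (fun j => d j *: z j + (if j == a then d a *: (\sum_(i in A) c i *: y i) else 0))); last first.
        by move=> j _; case: eqP => [->|_]; rewrite ?addr0 // z0 // scaler0 add0r.
      rewrite big_split /= c'E -big_mkcond big_pred1_eq.
      rewrite [RHS]big_mkcond [X in X + _]big_mkcond [in X in _ + X]big_mkcond scaler_sumr.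
      rewrite -big_split; apply: eq_bigr => i _ /=; rewrite finset.in_setU.
      have [iA|iA] := boolP (i \in A); rewrite /= ?scaler0 ?addr0 //.
      by rewrite (negPf (dAU _ iA)) add0r scalerA.
    - move=> j; rewrite finset.in_setU negb_or => /andP[jA jU].
      by case: eqP => [ja|_]; [rewrite ja aA in jA|exact: z0].
    - rewrite (bigD1 a) //= eqxx.
      have -> : \sum_(i | i != a) N (if i == a then \sum_(i0 in A) c i0 *: y i0 else z i) `^ r = \sum_j N (z j) `^ r.
        rewrite [RHS](bigD1 a) //= z0 // (seminorm0 normN) powR0 ?gt_eqF // add0r.
        by apply: eq_bigr => i /negPf ->.
      have -> : mass r y (A :|: U) = mass r y A + mass r y U.
        rewrite /mass big_mkcond [in X in _ = X + _]big_mkcond [in X in _ = _ + X]big_mkcond.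
        rewrite -big_split; apply: eq_bigr => i _ /=; rewrite finset.in_setU.
        have [iA|iA] := boolP (i \in A); rewrite /= ?add0r //.
        by rewrite (negPf (dAU _ iA)) addr0.
      by rewrite mulrDr lerD // ltW.
  rewrite leqNgt => /negP; apply; apply: proper_card; apply/properP; split.
    exact: finset.subsetUr.
  by exists a; rewrite // finset.in_setU aA.
(* Collapsing keeps the family tame, so four times the mass of [U] is at most [sup S], which is less
   than [2 * W]. *)
have massU : mass r y U <= W / 2.
  have [z [zc z0 zm]] := PU.
  have tz : tame z.
    move=> d d1; have [c c1 ->] := zc d d1.
    have := ty (fun i => if i \in U then c i else 0).
    have -> : \sum_i (if i \in U then c i else 0) *: y i = \sum_(i in U) c i *: y i.
      rewrite [RHS]big_mkcond; apply: eq_bigr => i _.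
      by case: ifP => _; rewrite ?scale0r.
    by apply => i; case: ifP; rewrite ?normr0 ?ler01.
  by have := Sle z tz; lra.
(* This normalises the total mass [W] to 1. As a tame vector has norm at most 1 and [W > T], each
   new mass is at most [1 / T]. *)
pose t := W `^ (- r^-1).
have t0 : 0 < t by exact: powR_gt0.
have tr : t `^ r = W^-1.
  by rewrite /t -powRrM mulNr mulVf ?gt_eqF // powR_inv1 // ltW.
pose y' i := if i \in U then 0 else t *: y i.
have Ny' i : N (y' i) `^ r = if i \in U then 0 else N (y i) `^ r / W.
  rewrite /y'; case: ifP => _; first by rewrite (seminorm0 normN) powR0 // gt_eqF.
  rewrite (seminormZ normN) ger0_norm ?(ltW t0) // powRM ?(ltW t0) ?(seminorm_ge0 normN) //.
  by rewrite tr mulrC.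
have massD (A : {set 'I_n}) : mass r y' A = mass r y (A :\: U) / W.
  rewrite /mass mulr_suml (eq_bigr (fun i => if i \in U then 0 else N (y i) `^ r / W)) //.
  rewrite big_mkcond [RHS]big_mkcond; apply: eq_bigr => i _.
  by rewrite finset.in_setD; case: (i \in A); case: (i \in U).
have massT : \sum_i N (y' i) `^ r = mass r y (~: U) / W.
  by rewrite -finset.setTD -massD /mass; apply: eq_bigl => i; rewrite finset.in_setT.
have massC : mass r y (~: U) = W - mass r y U.
  have -> : W = mass r y U + mass r y (~: U).
    by rewrite /W (bigID (mem U)) /=; congr (_ + _); apply: eq_bigl => i; rewrite finset.in_setC.
  by rewrite addrAC subrr add0r.
have massU0 : 0 <= mass r y U by apply: sumr_ge0 => *; exact: powR_ge0.
exists n, y'; split.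
- by rewrite massT massC ler_pdivlMr //; lra.
- by rewrite massT massC ler_pdivrMr //; lra.
- move=> i; rewrite Ny'; case: ifP => _; first by rewrite invr_ge0 ltW.
  rewrite ler_pdivrMr // mulrC ler_pdivlMr //; apply: (@le_trans _ _ T); last exact: ltW.
  rewrite -[leRHS]mul1r ler_pM2r //.
  rewrite -(congr1 (fun f => f r) (@powR1 R)).
  by apply: ge0_ler_powR; rewrite ?nnegrE ?(ltW r0) ?(seminorm_ge0 normN) // tame_le1.
move=> A c c1.
have -> : \sum_(i in A) c i *: y' i = t *: \sum_(i in A :\: U) c i *: y i.
  rewrite scaler_sumr big_mkcond [RHS]big_mkcond; apply: eq_bigr => i _.
  rewrite finset.in_setD /y'; case: (i \in A); case: (i \in U) => //=; first by rewrite scaler0.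
  by rewrite !scalerA mulrC.
have dis i : i \in A :\: U -> i \notin U by rewrite finset.in_setD => /andP[].
have := goodA _ c dis c1; move: (\sum_(i in A :\: U) _) => v hv.
rewrite (seminormZ normN) ger0_norm ?(ltW t0) // massD mulrA powRM; last 2 first.
- by rewrite mulr_ge0 //; apply: sumr_ge0 => *; exact: powR_ge0.
- by rewrite invr_ge0 ltW.
have -> : W^-1 `^ r^-1 = t by rewrite /t -(powR_inv1 (ltW W0)) -powRrM mulN1r.
rewrite mulrC ler_pM2r //.
have -> : N v = (N v `^ r) `^ r^-1.
  by rewrite -powRrM divff ?gt_eqF // powRr1 // (seminorm_ge0 normN).
apply: ge0_ler_powR; rewrite ?nnegrE ?powR_ge0 ?invr_ge0 ?(ltW r0) //.
by rewrite mulr_ge0 //; apply: sumr_ge0 => *; exact: powR_ge0.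
Qed.

(* Splits the indices along the level sets [2 ^ l <= g i < 2 ^ l.+1]. *)
Lemma layer_cake (r e M : R) : 0 < r -> 0 <= e -> e < r^-1 -> 0 < M -> exists2 K', 0 < K' &
  forall n (y : 'I_n -> V) (g c : 'I_n -> R),
  (forall (A : {set 'I_n}) (c : 'I_n -> R), (forall i, `|c i| <= 1) ->
        N (\sum_(i in A) c i *: y i) <= (4 * mass r y A) `^ r^-1) ->
  (forall i, 1 <= g i) -> \sum_i g i * N (y i) `^ r <= M ->
  (forall i, `|c i| <= g i `^ e) ->
  N (\sum_i c i *: y i) <= K'.
Proof.
move=> r0 e0 er M0.
pose b : R := 2 `^ (e - r^-1).
have b0 : 0 < b by exact: powR2_gt0.
have b1 : b < 1.
  rewrite -[ltRHS](powRr0 2) /b -[e - r^-1]opprK powRN powRr0 invf_lt1 ?powR2_gt0 //.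
  by apply: powR2_gt1; lra.
pose D : R := 2 `^ e * (4 * M) `^ r^-1.
have D0 : 0 < D by rewrite mulr_gt0 ?powR2_gt0 // powR_gt0 // mulr_gt0.
exists (D / (1 - b)); first by rewrite divr_gt0 // subr_gt0.
move=> n y g c Hy g1 gM cg.
have lvl i : exists l, 2 ^+ l <= g i < 2 ^+ l.+1.
  have [L hL] := expr_unbounded (g i) (ltr1n R 2).
  elim: L hL => [|L IH] hL; first by have := g1 i; rewrite leNgt -(expr0 2) hL.
  by have [h|h] := leP (2 ^+ L) (g i); [exists L; rewrite h|exact: IH].
have [lv lvP] := boolp.choice lvl.
pose L := \max_i lv i.
have lvL i : (lv i < L.+1)%N by rewrite ltnS; exact: leq_bigmax.
pose A (l : 'I_L.+1) : {set 'I_n} := finset.finset (fun i => lv i == l).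
rewrite (partition_big (fun i => Ordinal (lvL i)) predT) //=.
have Nsum (F : 'I_L.+1 -> V) : N (\sum_i F i) <= \sum_i N (F i).
  apply: (big_ind2 (fun x y => N x <= y)) => //; first by rewrite (seminorm0 normN).
  by move=> x1 x2 y1 y2 h1 h2; apply: le_trans (seminormD normN _ _) (lerD h1 h2).
apply: (le_trans (Nsum _)).
(* On level [l] the coefficients are at most [2 ^ ((l+1) e)] and the mass is at most [M / 2 ^ l];
   [e < 1 / r] makes the resulting series geometric with ratio [b < 1]. *)
apply: (@le_trans _ _ (\sum_(l < L.+1) D * b ^+ l)).
  apply: ler_sum => l _.
  have t0 : 0 < 2 `^ (l.+1%:R * e) :> R by exact: powR2_gt0.
  have -> : \sum_(i | Ordinal (lvL i) == l) c i *: y i =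
     2 `^ (l.+1%:R * e) *: \sum_(i in A l) (if i \in A l then c i / 2 `^ (l.+1%:R * e) else 0) *: y i.
    rewrite scaler_sumr; apply: eq_big => [i|i]; first by rewrite inE -val_eqE.
    by rewrite -val_eqE /= => il; rewrite inE il scalerA mulrC divfK // gt_eqF.
  rewrite (seminormZ normN) ger0_norm ?(ltW t0) //.
  apply: le_trans (ler_wpM2l (ltW t0) (Hy (A l) _ _)) _.
    move=> i; case: ifP => [|_]; last by rewrite normr0 ler01.
    rewrite inE => /eqP il; rewrite normrM [`|_^-1|]ger0_norm ?invr_ge0 ?(ltW t0) //.
    rewrite ler_pdivrMr // mul1r; apply: (le_trans (cg i)).
    rewrite powRrM powR_mulrn //; apply: ge0_ler_powR; rewrite ?nnegrE ?exprn_ge0 //.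
      by apply: le_trans (g1 i).
    by have /andP[_ /ltW] := lvP i; rewrite il.
  have mA : mass r y (A l) <= M / 2 ^+ l.
    rewrite ler_pdivlMr ?exprn_gt0 // mulrC; apply: le_trans gM.
    rewrite /mass mulr_sumr big_mkcond; apply: ler_sum => i _.
    case: ifP; last by rewrite mulr_ge0 ?powR_ge0 // (le_trans _ (g1 i)).
    rewrite inE => /eqP il; rewrite ler_wpM2r ?powR_ge0 //.
    by have /andP[h _] := lvP i; rewrite -il.
  apply: (@le_trans _ _ (2 `^ (l.+1%:R * e) * (4 * (M / 2 ^+ l)) `^ r^-1)).
    rewrite ler_pM2l //; apply: ge0_ler_powR.
    - by rewrite invr_ge0 ltW.
    - by rewrite nnegrE mulr_ge0 //; apply: sumr_ge0 => *; exact: powR_ge0.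
    - by rewrite nnegrE mulr_ge0 // divr_ge0 ?exprn_ge0 // ltW.
    - by rewrite ler_pM2l.
  rewrite mulrA powRM ?invr_ge0 ?exprn_ge0 ?mulr_ge0 ?(ltW M0) //.
  have e1 : (2 ^+ l)^-1 `^ r^-1 = 2 `^ (- (l%:R * r^-1)) :> R.
    by rewrite -powR_invn ?ler0n // -powRrM mulNr.
  have e2 : b ^+ l = 2 `^ (l%:R * (e - r^-1)).
    by rewrite /b -powR_mulrn ?powR_ge0 // -powRrM mulrC.
  have e3 : 2 `^ (l.+1%:R * e) * 2 `^ (- (l%:R * r^-1)) = 2 `^ e * 2 `^ (l%:R * (e - r^-1)) :> R.
    by rewrite -!powR2D; congr (_ `^ _); rewrite -natr1; ring.
  by rewrite e1 e2 /D mulrCA e3 le_eqVlt; apply/orP; left; apply/eqP; ring.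
rewrite -mulr_sumr ler_pM2l // -[leRHS]div1r ler_pdivlMr ?subr_gt0 //.
have -> : (\sum_(l < L.+1) b ^+ l) * (1 - b) = 1 - b ^+ L.+1.
  by rewrite -{2}(expr1n _ L.+1) subrXX mulrC; congr (_ * _); apply: eq_bigr => l _; rewrite expr1n mul1r.
by rewrite lerBlDr lerDl exprn_ge0 // ltW.
Qed.

End SummingFails.

(** * Real and complex scalars *)

Section Scalars.
Context (R : realType) (k : scalar_kind).
Local Notation K := (scalars R k).

Definition of_real (a : R) : K :=
  match k return scalars R k with RealScalars => a | ComplexScalars => (a%:C)%C end.

Lemma of_realD a b : of_real (a + b) = of_real a + of_real b.
Proof. by rewrite /of_real; case: k => //; exact: rmorphD. Qed.

Lemma of_realM a b : of_real (a * b) = of_real a * of_real b.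
Proof. by rewrite /of_real; case: k => //; exact: rmorphM. Qed.

Lemma of_real1 : of_real 1 = 1. Proof. by rewrite /of_real; case: k. Qed.

Lemma of_real0 : of_real 0 = 0. Proof. by rewrite /of_real; case: k. Qed.

Lemma real_part_of_real a : real_part (of_real a) = a.
Proof. by rewrite /real_part /of_real; case: k. Qed.

Lemma ge0_of_real (a : K) : 0 <= a -> a = of_real (real_part a).
Proof.
rewrite /real_part /of_real; case: k a => //= -[a1 a2]; rewrite lecE /= => /andP[/eqP ].
by move=> ->.
Qed.

Lemma of_real_ge0 a : (0 <= of_real a) = (0 <= a).
Proof. by rewrite /of_real; case: k => //; rewrite lecE /= eqxx. Qed.

Lemma le_of_real a b : (of_real a <= of_real b) = (a <= b).
Proof. by rewrite /of_real; case: k => //; rewrite lecE /= eqxx. Qed.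

Lemma norm_of_real a : `|of_real a| = of_real `|a| :> K.
Proof. by rewrite /of_real; case: k => //=; rewrite normc_def /= expr0n /= addr0 sqrtr_sqr. Qed.

Section Rnorm.
Context (V : normedZmodType K).
Implicit Types x y : V.

Lemma rnormE x : of_real (rnorm x) = `|x|.
Proof. by rewrite /rnorm -ge0_of_real. Qed.

Lemma rnorm_ge0 x : 0 <= rnorm x.
Proof. by rewrite -of_real_ge0 rnormE. Qed.

Lemma rnormD x y : rnorm (x + y) <= rnorm x + rnorm y.
Proof. by rewrite -le_of_real of_realD !rnormE ler_normD. Qed.

Lemma rnorm0 : rnorm (0 : V) = 0.
Proof. by rewrite /rnorm normr0 -of_real0 real_part_of_real. Qed.

Lemma rnormN x : rnorm (- x) = rnorm x.
Proof. by rewrite /rnorm normrN. Qed.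

Lemma rnorm_eq0 x : rnorm x = 0 -> x = 0.
Proof. by move=> h; apply/normr0_eq0; rewrite -rnormE h of_real0. Qed.

End Rnorm.

Lemma rnormM (a b : K) : rnorm (a * b) = rnorm a * rnorm b.
Proof.
have h : of_real (rnorm (a * b)) = of_real (rnorm a * rnorm b).
  by rewrite of_realM !rnormE normrM.
by rewrite -[LHS]real_part_of_real h real_part_of_real.
Qed.

Lemma rnorm_prod (I : finType) (F : I -> K) :
  rnorm (\prod_i F i) = \prod_i rnorm (F i).
Proof.
apply: (big_morph _ rnormM); rewrite /rnorm normr1 -of_real1.
exact: real_part_of_real.
Qed.

Lemma rnorm_of_real a : rnorm (of_real a) = `|a|.
Proof. by rewrite /rnorm norm_of_real real_part_of_real. Qed.

Lemma rnormZ (X : normedModType K) (a : K) (x : X) : rnorm (a *: x) = rnorm a * rnorm x.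
Proof.
have h : of_real (rnorm (a *: x)) = of_real (rnorm a * rnorm x).
  by rewrite of_realM !rnormE normrZ.
by rewrite -[LHS]real_part_of_real h real_part_of_real.
Qed.

End Scalars.

Lemma rnorm_complex (R : realType) (z : scalars R ComplexScalars) :
  rnorm z = Num.sqrt (complex.Re z ^+ 2 + complex.Im z ^+ 2).
Proof.
have h : `|z| = (Num.sqrt (complex.Re z ^+ 2 + complex.Im z ^+ 2))%:C%C by exact: normc_def.
by rewrite /rnorm h.
Qed.

(** Real and imaginary parts, for both kinds of scalars at once: over the reals [i0 = 0] and the
    second part is 0. *)
Lemma scalar_decomposition (R : realType) (k : scalar_kind) :
  exists2 i0 : scalars R k, rnorm i0 <= 1 & forall c : scalars R k,
  exists a b, [/\ c = of_real k a + i0 * of_real k b, `|a| <= rnorm c & `|b| <= rnorm c].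
Proof.
case: k.
  exists 0; first by rewrite rnorm0.
  by move=> c; exists c, 0; rewrite mul0r addr0 normr0 rnorm_ge0; split.
exists ('i)%C; first by rewrite rnorm_complex /= expr0n /= add0r expr1n sqrtr1.
move=> c; exists (complex.Re c), (complex.Im c); split.
- by case: c => a b; apply/eqP; rewrite eq_complex /=; apply/andP; split; apply/eqP; ring.
- by rewrite rnorm_complex -sqrtr_sqr ler_sqrt ?addr_ge0 ?sqr_ge0 // lerDl sqr_ge0.
- by rewrite rnorm_complex -sqrtr_sqr ler_sqrt ?addr_ge0 ?sqr_ge0 // lerDr sqr_ge0.
Qed.

(** A synonym of [X] that can carry a module structure over the reals without clashing with the
    original one. *)
Definition realified (R : realType) (k : scalar_kind) (X : normedModType (scalars R k)) : Type := X.

Section Realified.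
Context (R : realType) (k : scalar_kind) (X : normedModType (scalars R k)).

HB.instance Definition _ := GRing.Zmodule.copy (realified X) X.

Definition real_scale (a : R) (x : realified X) : realified X := of_real k a *: (x : X).

Fact real_scaleA a b v : real_scale a (real_scale b v) = real_scale (a * b) v.
Proof. by rewrite /real_scale scalerA of_realM. Qed.
Fact real_scale1 : left_id 1 real_scale.
Proof. by move=> v; rewrite /real_scale of_real1 scale1r. Qed.
Fact real_scaleDr : right_distributive real_scale +%R.
Proof. by move=> a x y; rewrite /real_scale scalerDr. Qed.
Fact real_scaleDl v : {morph real_scale^~ v : a b / a + b}.
Proof. by move=> a b; rewrite /real_scale of_realD scalerDl. Qed.

HB.instance Definition _ := GRing.Zmodule_isLmodule.Build R (realified X)
  real_scaleA real_scale1 real_scaleDr real_scaleDl.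

Definition rn (x : realified X) : R := rnorm (x : X).

Lemma real_scaleE a (x : realified X) : a *: x = of_real k a *: (x : X) :> X.
Proof. by []. Qed.

Lemma rn_seminorm : seminorm_on rn.
Proof.
split=> [x y|a x]; first exact: rnormD.
by rewrite /rn real_scaleE rnormZ rnorm_of_real.
Qed.

Lemma realified_infinite_dimensional :
  infinite_dimensional X -> real_infinite_dimensional (realified X).
Proof.
move=> infX [n [v sp]]; apply: infX; exists n, v => x.
have [c ->] := sp x I; exists (fun i => of_real k (c 0 i)).
by [].
Qed.

End Realified.

(** * The Rademacher integral *)

Section StepIntegral.
Context (R : realType).
Local Notation mu := (@lebesgue_measure R).

(** The endpoints of the steps are left free because Rademacher functions take the value 0 there;
    they are negligible. Measurability belongs to the induction since splitting the integral uses
    it. *)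
Lemma step_integral (F : R -> R) (c : nat -> R) (h : R) m : 0 < h -> (forall t, 0 <= F t) ->
  (forall l, (l < m)%N -> forall t, l%:R * h < t < l.+1%:R * h -> F t = c l) ->
  measurable_fun `[0, m%:R * h] (EFin \o F) /\
  (\int[mu]_(t in `[0%R, (m%:R * h)%R]) (F t)%:E = (\sum_(l < m) c l * h)%:E)%E.
Proof.
move=> h0 F0; elim: m => [|m IH] H.
  rewrite mul0r set_itv1; split; first exact: measurable_fun_set1.
  by rewrite integral_set1 big_ord0.
have [mF IF] := IH (fun l lm => H l (ltnW lm)).
have lt_mh : m%:R * h < m.+1%:R * h by rewrite ltr_pM2r // ltr_nat.
have mh0 : 0 <= m%:R * h by rewrite mulr_ge0 ?ler0n // ltW.
have mFo : measurable_fun `]m%:R * h, m.+1%:R * h[ (EFin \o F).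
  apply: (eq_measurable_fun (cst (c m)%:E)) => [t|]; last exact: measurable_cst.
  by rewrite inE /= in_itv /= => tin; rewrite (H m).
have mFc : measurable_fun `]m%:R * h, m.+1%:R * h] (EFin \o F).
  rewrite -(setUitv1 true); last by rewrite bnd_simp.
  by apply/measurable_funU => //; split => //; exact: measurable_fun_set1.
have cover : [set` `[0, m.+1%:R * h]] = [set` `[0, m%:R * h]] `|` [set` `]m%:R * h, m.+1%:R * h]].
  by rewrite -itv_bndbnd_setU // bnd_simp // ltW.
split; first by rewrite cover; apply/measurable_funU.
rewrite cover ge0_integral_setU //; last 3 first.
- by apply/measurable_funU.
- by move=> t _; rewrite lee_fin.
- apply/disj_setPS => t [] /=; rewrite !in_itv /= => /andP[_ h1] /andP[h2 _].
  by move: (le_lt_trans h1 h2); rewrite ltxx.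
rewrite IF big_ord_recr /= EFinD; congr (_ + _)%E.
rewrite integral_itv_bndoo // (eq_integral (cst (c m)%:E)); last first.
  by move=> t; rewrite inE /= in_itv /= => tin; rewrite (H m).
rewrite integral_cst //= lebesgue_measure_itv /= lte_fin lt_mh -EFinD -EFinM.
by rewrite -mulrBl -natrB // subSnn mul1r.
Qed.

Lemma sin_natpi (x : R) q : sin (x + q%:R * pi) = (-1) ^+ q * sin x.
Proof.
elim: q => [|q IH]; first by rewrite mul0r addr0 mul1r.
by rewrite -natr1 mulrDl mul1r addrA sinDpi IH exprS mulN1r mulNr.
Qed.

(** The quotient counts the half-periods of the sine completed before the [l]-th dyadic interval,
    and each of them reverses the sign. *)
Lemma rademacher_dyadic (n l j : nat) (t : R) : (j < n)%N ->
  l%:R / 2 ^+ n < t < l.+1%:R / 2 ^+ n ->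
  rademacher j.+1 t = (-1) ^+ (l %/ 2 ^ (n - j.+1)).
Proof.
move=> jn /andP[t1 t2]; rewrite /rademacher.
set d := (n - j.+1)%N; set q := (l %/ 2 ^ d)%N.
have nE : n = (j.+1 + d)%N by rewrite subnKC.
have p0 m : 0 < 2 ^+ m :> R by exact: exprn_gt0.
have t1' : l%:R < 2 ^+ j.+1 * t * 2 ^+ d.
  by move: t1; rewrite ltr_pdivrMr // nE exprD mulrA [t * _]mulrC.
have t2' : 2 ^+ j.+1 * t * 2 ^+ d < l.+1%:R.
  by move: t2; rewrite ltr_pdivlMr // nE exprD mulrA [t * _]mulrC.
have q1 : q%:R * 2 ^+ d <= l%:R :> R by rewrite -natrX -natrM ler_nat leq_trunc_div.
have q2 : l.+1%:R <= q.+1%:R * 2 ^+ d :> R.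
  by rewrite -natrX -natrM ler_nat -ltn_divLR ?expn_gt0.
set s := 2 ^+ j.+1 * t - q%:R.
have s0 : 0 < s by rewrite subr_gt0 -(ltr_pM2r (p0 d)) (le_lt_trans q1).
have s1 : s < 1 by rewrite ltrBlDr nat1r -(ltr_pM2r (p0 d)) (lt_le_trans t2').
have -> : 2 ^+ j.+1 * pi * t = s * pi + q%:R * pi by rewrite /s; ring.
rewrite sin_natpi sgzM.
have -> : sgz (sin (s * pi)) = 1.
  apply: gtr0_sgz; apply: sin_gt0_pi.
  by rewrite mulr_gt0 ?pi_gt0 //= gtr_pMl // pi_gt0.
by rewrite mulr1 sgzX sgzN sgz1.
Qed.

End StepIntegral.

(** The first sign is the leading binary digit of [l]: plus on the lower half of the indices, minus
    on the upper half. *)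
Lemma rad_dyadic_sum (R : realType) (W : zmodType) (xs : seq W) (f : W -> R) v :
  rad xs f v = (\sum_(l < 2 ^ size xs)
    f (v + \sum_(j < size xs) nth 0 xs j *~ (-1) ^+ (l %/ 2 ^ (size xs - j.+1)))) / 2 ^+ size xs.
Proof.
elim: xs v => [|x xs IH] v.
  by rewrite /= expn0 big_ord_recl !big_ord0 !addr0 divr1.
set n := size xs in IH *; rewrite [LHS]/= !IH [size (x :: xs)]/= -/n.
have e2 : (2 ^ n.+1 = 2 ^ n + 2 ^ n)%N by rewrite expnS mul2n addnn.
pose G l := f (v + \sum_(j < n.+1) nth 0 (x :: xs) j *~ (-1) ^+ (l %/ 2 ^ (n.+1 - j.+1))).
rewrite [RHS](_ : _ = (\sum_(l < 2 ^ n + 2 ^ n) G l) / 2 ^+ n.+1); last by rewrite -e2.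
rewrite big_split_ord /= exprS invfM; set c := (2 ^+ n)^-1.
set S1 := \sum_(l < 2 ^ n) _; set S2 := \sum_(l < 2 ^ n) _.
have -> : \sum_(l < 2 ^ n) G l = S1.
  apply: eq_bigr => l _; rewrite /G big_ord_recl /= addrA.
  rewrite subn1 /= divn_small ?ltn_ord // expr0 mulr1z; congr (f (_ + _)).
have -> : \sum_(l < 2 ^ n) G (2 ^ n + l)%N = S2.
  apply: eq_bigr => l _; rewrite /G big_ord_recl /= addrA.
  rewrite subn1 /= divnDl ?dvdnn // divnn expn_gt0 /= divn_small ?ltn_ord // addn0 expr1 mulrN1z.
  congr (f (_ + _)); apply: eq_bigr => j _; congr (_ *~ _).
  rewrite /bump /= add1n subSS.
  (* Passing to the upper half changes the other quotients by an even number, hence leaves their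
     signs alone. *)
  have -> : ((2 ^ n + l) %/ 2 ^ (n - j.+1) = 2 ^ j.+1 + l %/ 2 ^ (n - j.+1))%N.
    move: (nat_of_ord l) => l'; have -> : (2 ^ n = 2 ^ (n - j.+1) * 2 ^ j.+1)%N.
      by rewrite -expnD subnK.
    by rewrite divnDl ?dvdn_mulr // mulKn ?expn_gt0.
  by rewrite exprD -[(-1) ^+ (2 ^ _)]signr_odd oddX /= expr0 mul1r.
ring.
Qed.

Section RademacherAverage.
Context (R : realType) (k : scalar_kind) (X : normedModType (scalars R k)).

Lemma rademacher_averageE n (x : 'I_n -> X) :
  rademacher_average x = avg (@rn R k X) [seq x i | i <- enum 'I_n].
Proof.
rewrite /rademacher_average /avg; congr (Num.sqrt _).
set xs : seq (realified X) := [seq x i | i <- enum 'I_n].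
have szxs : size xs = n by rewrite size_map size_enum_ord.
have xsE (j : 'I_n) : nth 0 xs j = x j.
  by rewrite (nth_map j) ?size_enum_ord // nth_ord_enum.
pose c (l : nat) : R := rnorm (\sum_(j < n) x j *~ (-1) ^+ (l %/ 2 ^ (n - j.+1))) ^+ 2.
pose F (t : R) : R := rnorm (\sum_(j < n) x j *~ rademacher j.+1 t) ^+ 2.
have h0 : 0 < (2 ^+ n)^-1 :> R by rewrite invr_gt0 exprn_gt0.
have [|_ IF] := @step_integral R F c (2 ^+ n)^-1 (2 ^ n) h0 (fun t => sqr_ge0 _).
  move=> l _ t tin; rewrite /F /c; congr (rnorm _ ^+ 2).
  by apply: eq_bigr => j _; rewrite (@rademacher_dyadic _ n l).
rewrite natrX divff ?expf_neq0 ?pnatr_eq0 // in IF.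
rewrite /Rintegral -/(F _) IF /= /avg2 rad_dyadic_sum szxs mulr_suml.
apply: eq_bigr => l _; congr (_ / _).
rewrite /c /rn add0r; congr (rnorm _ ^+ 2).
by apply: eq_bigr => j _; rewrite xsE.
Qed.

Lemma cotype_bound_of_has_cotype (q : R) : has_cotype X q%:E ->
  exists2 K, 0 < K & cotype_bound (@rn R k X) q K.
Proof.
move=> [K K0 HK]; exists K => // zs.
have := HK (size zs) (fun i => nth 0 zs i); rewrite rademacher_averageE /=.
have -> : [seq nth 0 zs i | i : 'I_(size zs) <- enum 'I_(size zs)] = zs.
  apply: (@eq_from_nth _ 0); first by rewrite size_map size_enum_ord.
  move=> i; rewrite size_map size_enum_ord => ilt.
  by rewrite (nth_map (Ordinal ilt)) ?size_enum_ord // nth_enum_ord.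
by rewrite (big_nth 0) big_mkord.
Qed.

Lemma has_cotype_of_cotype_bound (q K : R) : 0 < K ->
  cotype_bound (@rn R k X) q K -> has_cotype X q%:E.
Proof.
move=> K0 HK; exists K => // n x.
rewrite rademacher_averageE /=; have := HK [seq x i | i <- enum 'I_n].
by rewrite big_map big_enum.
Qed.

End RademacherAverage.

(** * Sequence spaces *)

Section SequenceSpaceFacts.
Context (R : realType) (k : scalar_kind).
Local Notation K := (scalars R k).
Implicit Types (u v : nat -> K) (p : \bar R).

Lemma counting_ge1 (A : set nat) i : A i -> (1 <= counting A :> \bar R)%E.
Proof.
move=> Ai; rewrite /counting; case: asboolP => fA; last by rewrite leey.
rewrite lee_fin ler1n finmap.cardfs_gt0; apply/finmap.fset0Pn; exists i.
by rewrite in_fset_set //; exact: mem_set.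
Qed.

Lemma ae_counting (P : nat -> Prop) : {ae (counting : set nat -> \bar R), forall x, P x} -> forall x, P x.
Proof.
move=> [A [_ A0 sub]] x; apply: contrapT => Px.
have := counting_ge1 (sub _ Px); rewrite A0.
by rewrite leNgt lte_fin ltr01.
Qed.

Lemma seq_norm_ge0 p u : (0 <= seq_norm p u)%E.
Proof. exact: Lnorm_ge0. Qed.

Lemma seq_norm_finE (r : R) u : 0 < r ->
  seq_norm r%:E u = ((\sum_(i <oo) (rnorm (u i) `^ r)%:E) `^ r^-1)%E.
Proof.
move=> r0; rewrite /seq_norm Lnorm_counting //; congr (_ `^ _)%E.
by apply: eq_eseriesr => i _; rewrite /= ger0_norm ?rnorm_ge0.
Qed.

Lemma seq_norm_inftyE u : seq_norm +oo%E u = ess_sup counting (abse \o (EFin \o (fun n => rnorm (u n)))).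
Proof.
rewrite /seq_norm unlock ifT //; apply: lt_le_trans (@counting_ge1 setT 0%N I).
by rewrite lte_fin.
Qed.

Lemma in_Xp_seq_norm_lty p u : in_Xp p u -> (seq_norm p u < +oo)%E.
Proof.
rewrite /in_Xp; case: eqP => // -> u0; rewrite seq_norm_inftyE.
have cvu : cvgn (fun n => rnorm (u n)) by apply/cvg_ex; exists 0.
have [M0 [_ HM]] := cvg_seq_bounded cvu.
have hM i : `|rnorm (u i)| <= M0 + 1 by apply: HM => //; rewrite ltrDl.
apply: (@le_lt_trans _ _ (M0 + 1)%:E); last exact: ltry.
apply/ess_supP; apply: nearW => i /=; rewrite lee_fin.
exact: hM.
Qed.

Lemma seq_norm_fineK p u : in_Xp p u -> (fine (seq_norm p u))%:E = seq_norm p u.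
Proof.
by move=> up; rewrite fineK // ge0_fin_numE ?seq_norm_ge0 // in_Xp_seq_norm_lty.
Qed.

Lemma rnorm_le_seq_norm_infty u i : in_Xp +oo%E u -> rnorm (u i) <= fine (seq_norm +oo%E u).
Proof.
move=> up; rewrite -lee_fin seq_norm_fineK // seq_norm_inftyE.
have := @ae_counting _ (ess_sup_ge counting (abse \o (EFin \o (fun n => rnorm (u n))))) i.
by rewrite /= ger0_norm ?rnorm_ge0.
Qed.

(** [f] will list the coordinates of one block, which are scattered among the integers; injectivity
    allows comparison with an initial partial sum. *)
Lemma sum_le_seq_norm (r : R) u n (f : 'I_n -> nat) : 0 < r -> injective f -> in_Xp r%:E u ->
  \sum_i rnorm (u (f i)) `^ r <= fine (seq_norm r%:E u) `^ r.
Proof.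
move=> r0 injf up; set S := (\sum_(i <oo) (rnorm (u i) `^ r)%:E)%E.
have S0 : (0 <= S)%E by apply: nneseries_ge0 => i _ _; rewrite lee_fin powR_ge0.
have normE : seq_norm r%:E u = (S `^ r^-1)%E by exact: seq_norm_finE.
have Slty : (S < +oo)%E.
  have := in_Xp_seq_norm_lty up; rewrite normE.
  move: S0; case: (S) => [s _ _|_|//] /=; first exact: ltry.
  rewrite ifF ?ltxx //.
  by apply/negbTE; rewrite invr_eq0 gt_eqF.
have SE : (fine S)%:E = S by rewrite fineK // ge0_fin_numE.
have -> : fine (seq_norm r%:E u) `^ r = fine S.
  rewrite normE -SE /= -powRrM mulVf ?gt_eqF // powRr1 //.
  by rewrite fine_ge0.
rewrite -lee_fin SE.
pose M := (\max_i (f i)).+1.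
have fM i : (f i < M)%N by rewrite ltnS; exact: (leq_bigmax i).
apply: le_trans (nneseries_lim_ge M _); last by move=> i _ _; rewrite lee_fin powR_ge0.
rewrite big_mkord sumEFin lee_fin.
pose f' i := Ordinal (fM i).
have injf' : injective f' by move=> i j /(congr1 val) /injf.
have -> : \sum_i rnorm (u (f i)) `^ r = \sum_(j in [set f' i | i in 'I_n]%SET) rnorm (u j) `^ r.
  by rewrite big_imset //=; apply: in2W.
rewrite [leRHS](bigID (mem [set f' i | i in 'I_n]%SET)) /= lerDl.
by apply: sumr_ge0 => *; exact: powR_ge0.
Qed.

(** Such sequences lie in every [X_p] with [p >= 2], [c_0] included, which settles membership for
    all vectors of the cotype argument. *)
Definition finitely_supported u := exists n, forall i, (n <= i)%N -> u i = 0.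

Lemma seq_norm_support (r : R) u n : 0 < r -> (forall i, (n <= i)%N -> u i = 0) ->
  seq_norm r%:E u = ((\sum_(i < n) rnorm (u i) `^ r) `^ r^-1)%:E.
Proof.
move=> r0 u0; rewrite seq_norm_finE // (nneseries_split 0%N n); last first.
  by move=> i _; rewrite lee_fin powR_ge0.
rewrite eseries0 ?adde0 ?add0n; last first.
  by move=> i ni _; rewrite u0 // rnorm0 powR0 // gt_eqF.
by rewrite big_mkord sumEFin.
Qed.

Lemma in_Xp_support p u : (2%:E <= p)%E -> finitely_supported u -> in_Xp p u.
Proof.
move=> p2 [n u0]; rewrite /in_Xp; case: p p2 => [r|_|//] /= r2.
  rewrite (@seq_norm_support r u n) ?ltry //.
  by move: r2; rewrite lee_fin; lra.
apply: cvg_near_cst.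
by exists n => // i /= ni; rewrite u0 // rnorm0.
Qed.

Lemma seq_norm_infty_le u (M : R) : (forall i, rnorm (u i) <= M) -> in_Xp +oo%E u ->
  fine (seq_norm +oo%E u) <= M.
Proof.
move=> uM up; rewrite -lee_fin seq_norm_fineK // seq_norm_inftyE.
by apply/ess_supP; apply: nearW => i /=; rewrite lee_fin ger0_norm ?rnorm_ge0.
Qed.

Lemma finitely_supportedD (a : K) u v : finitely_supported u -> finitely_supported v ->
  finitely_supported (fun n => a * u n + v n).
Proof.
move=> [n un] [m vm]; exists (maxn n m) => i; rewrite geq_max => /andP[ni mi].
by rewrite un // vm // mulr0 addr0.
Qed.

Lemma finitely_supported0 : finitely_supported (fun=> 0). Proof. by exists 0%N. Qed.

Lemma finitely_supported_unit i : finitely_supported (unit_vector R k i).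
Proof. by exists i.+1 => j ij; rewrite /unit_vector gtn_eqF. Qed.

End SequenceSpaceFacts.

(** * Cotype of multilinear operators *)

Section CotypeExists.
Context (R : realType) (V : lmodType R) (N : V -> R).
Hypothesis normN : seminorm_on N.

(** Jensen's inequality: Hölder's inequality against the constant 1 gives the case of two points,
    and induction on the signs the rest. *)
Lemma rad_powR_le (W : zmodType) (xs : seq W) (f : W -> R) v s : 1 <= s ->
  (forall u, 0 <= f u) -> rad xs f v `^ s <= rad xs (fun u => f u `^ s) v.
Proof.
move=> s1 f0; have s0 : 0 < s by lra.
have mean2 (a b : R) : 0 <= a -> 0 <= b -> ((a + b) / 2) `^ s <= (a `^ s + b `^ s) / 2.
  move=> a0 b0.
  have := @hoelder_sum R bool (fun i => if i then a else b) (fun=> 1) s s1.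
  rewrite !big_bool /= powR1 !mul1r => /(_ _ (fun=> ler01)) h.
  have {}h : a + b <= (a `^ s + b `^ s) `^ s^-1 * (1 + 1) `^ (1 - s^-1) by apply: h; case.
  have ab0 : 0 <= a `^ s + b `^ s by rewrite addr_ge0 ?powR_ge0.
  have := ge0_ler_powR (ltW s0) _ _ h.
  rewrite !nnegrE addr_ge0 // mulr_ge0 ?powR_ge0 // => /(_ isT isT) {}h.
  rewrite powRM ?addr_ge0 ?invr_ge0 //.
  apply: le_trans (ler_wpM2r _ h) _; first exact: powR_ge0.
  rewrite powRM ?powR_ge0 // -!powRrM mulVf ?gt_eqF // powRr1 // -[leLHS]mulrA.
  have -> : (1 + 1) `^ ((1 - s^-1) * s) * 2^-1 `^ s = 2^-1 :> R.
    rewrite -[2^-1](powR_inv1 (ler0n R 2)) -powRrM -[1 + 1]/(2 : R) -powR2D.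
    by congr (_ `^ _); rewrite mulrBl mul1r mulVf ?gt_eqF //; ring.
  by [].
elim: xs v => //= x xs IH v.
apply: (le_trans (mean2 _ _ (rad_ge0 _ _ f0) (rad_ge0 _ _ f0))).
by rewrite ler_pM2r ?invr_gt0 // lerD.
Qed.

Lemma rad_comp (W1 W2 : zmodType) (h : W1 -> W2) (xs : seq W1) (f : W2 -> R) v :
  {morph h : x y / x + y} -> {morph h : x / - x} ->
  rad xs (fun w => f (h w)) v = rad [seq h x | x <- xs] f (h v).
Proof.
by move=> hD hN; elim: xs v => //= x xs IH v; rewrite !IH !hD hN.
Qed.

Lemma rad_exists_ge (W : zmodType) (xs : seq W) (f : W -> R) v :
  exists2 u, u \in signed_sums xs v & rad xs f v <= f u.
Proof.
have [u uin] := rad_exists_le xs (fun u => -1 * f u) v.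
by rewrite radZ !mulN1r lerN2; exists u.
Qed.

(* The signs are common to all the families [x i]. *)
Lemma cotype_exists_signs (q K : R) (I : Type) (r : seq I) n (x : I -> 'I_n -> V) :
  2 <= q -> 0 < K -> cotype_bound N q K ->
  exists eps : 'I_n -> bool, \sum_(i <- r) \sum_a N (x i a) `^ q <=
    K `^ q * \sum_(i <- r) N (\sum_a if eps a then x i a else - x i a) `^ q.
Proof.
move=> q2 K0 HK; have q0 : 0 < q by lra.
(* Averaging in the space of functions [I -> V] draws the same signs for all [i]. *)
pose Xs : seq (I -> V) := [seq (fun i => x i a) | a <- enum 'I_n].
have [u uin hu] := rad_exists_ge Xs (fun w => \sum_(i <- r) N (w i) `^ q) 0.
have [ss szss uE] := mem_signed_sums uin.
rewrite size_map size_enum_ord in szss.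
exists (fun a => nth true ss a).
have -> : \sum_(i <- r) N (\sum_(a < n) if nth true ss a then x i a else - x i a) `^ q =
    \sum_(i <- r) N (u i) `^ q.
  apply: eq_bigr => i _; congr (N _ `^ q).
  rewrite uE add0r (big_nth (true, 0)) size_zip size_map size_enum_ord szss minnn big_mkord.
  rewrite fct_sumE; apply: eq_bigr => a _.
  have szXs : size Xs = n by rewrite size_map size_enum_ord.
  have XsE : nth 0 Xs a = (fun i => x i a).
    by rewrite /Xs (nth_map a) ?size_enum_ord // nth_ord_enum.
  rewrite nth_zip ?szss ?szXs //= XsE.
  by case: ifP.
apply: (@le_trans _ _ (K `^ q * rad Xs (fun w => \sum_(i <- r) N (w i) `^ q) 0)); last first.
  by apply: ler_wpM2l; [exact: powR_ge0|exact: hu].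
rewrite rad_sum mulr_sumr; apply: ler_sum => i _.
pose zs := [seq w i | w <- Xs].
have -> : rad Xs (fun w => N (w i) `^ q) 0 = rad zs (fun z => N z `^ q) 0.
  exact: (@rad_comp (I -> V) V (fun w => w i) Xs (fun z => N z `^ q) 0).
have S0 : 0 <= \sum_a N (x i a) `^ q by apply: sumr_ge0 => *; exact: powR_ge0.
have sumE : \sum_(z <- zs) N z `^ q = \sum_a N (x i a) `^ q.
  by rewrite /zs big_map /Xs big_map big_enum.
have := HK zs; rewrite sumE => h.
have := ge0_ler_powR (ltW q0) _ _ h; rewrite !nnegrE powR_ge0 mulr_ge0 ?avg_ge0 ?(ltW K0) //.
move=> /(_ isT isT); rewrite -powRrM mulVf ?gt_eqF // powRr1 // => {}h.
apply: (le_trans h); rewrite powRM ?avg_ge0 ?(ltW K0) // ler_wpM2l ?powR_ge0 //.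
(* Since [q >= 2], Jensen's inequality passes from the second moment to the [q]-th. *)
rewrite -sqr_powR_half ?avg_ge0 // avg_sqr.
have s1 : 1 <= q / 2 by rewrite ler_pdivlMr ?mul1r.
apply: le_trans (rad_powR_le _ _ s1 (fun v => sqr_ge0 (N v))) _.
by apply: rad_le => v; rewrite sqr_powR_half // (seminorm_ge0 normN).
Qed.

End CotypeExists.

Section Multilinear.
Context (R : realType) (k : scalar_kind) (X : normedModType (scalars R k)).
Local Notation K := (scalars R k).
Context (m : nat) (p : 'I_m -> \bar R) (A : ('I_m -> nat -> K) -> X).
Hypothesis p2 : forall i, (2%:E <= p i)%E.
Hypothesis Amul : multilinear_on p A.

Let dom (x : 'I_m -> nat -> K) := forall j, finitely_supported (x j).

Let dom_in x : dom x -> forall j, in_Xp (p j) (x j).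
Proof. by move=> xd j; apply: in_Xp_support. Qed.

Lemma multilinear0 x j : dom x -> A (update x j (fun=> 0)) = 0.
Proof.
move=> xd; have in0 := in_Xp_support (p2 j) (finitely_supported0 R k).
have := Amul 1 (dom_in xd) in0 in0.
have -> : (fun n : nat => 1 * 0 + 0 : K) = (fun=> 0) by apply/funext => n; rewrite mulr0 addr0.
rewrite scale1r => /eqP; rewrite -subr_eq0 opprD addrA subrr add0r oppr_eq0.
by move/eqP.
Qed.

Lemma multilinear_sum x j (I : Type) (r : seq I) (c : I -> K) (u : I -> nat -> K) : dom x ->
  (forall a, finitely_supported (u a)) ->
  finitely_supported (fun n => \sum_(a <- r) c a * u a n) /\
  A (update x j (fun n => \sum_(a <- r) c a * u a n)) = \sum_(a <- r) c a *: A (update x j (u a)).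
Proof.
move=> xd ud; elim: r => [|a r [sup IH]].
  have -> : (fun n => \sum_(a <- [::]) c a * u a n) = (fun=> 0).
    by apply/funext => n; rewrite big_nil.
  by rewrite big_nil multilinear0 //; split=> //; exact: finitely_supported0.
have -> : (fun n => \sum_(b <- a :: r) c b * u b n) =
          (fun n => c a * u a n + \sum_(b <- r) c b * u b n).
  by apply/funext => n; rewrite big_cons.
split; first exact: finitely_supportedD.
by rewrite Amul ?big_cons ?IH //; [exact: dom_in|exact: in_Xp_support|exact: in_Xp_support].
Qed.

Lemma multilinearZ x j (c : K) u : dom x -> finitely_supported u ->
  A (update x j (fun n => c * u n)) = c *: A (update x j u).
Proof.
move=> xd ud; have [_] := @multilinear_sum x j unit [:: tt] (fun=> c) (fun=> u) xd (fun=> ud).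
rewrite big_seq1 => <-; congr (A (update x j _)).
by apply/funext => n; rewrite big_seq1.
Qed.

Variables (N' : nat) (c : 'I_m -> nat -> R).
Local Notation N := N'.+1.
Local Notation index := {ffun 'I_m -> 'I_N}.

Let cu (j : 'I_m) (a : nat) : nat -> K := fun n => of_real k (c j a) * unit_vector R k a n.

(* The first [t] variables have been frozen at the vectors [y j]. *)
Let V (t : nat) (y : 'I_m -> nat -> K) (i : index) : 'I_m -> nat -> K :=
  fun j => if (j < t)%N then y j else cu j (i j).

Let cu_support j a : finitely_supported (cu j a).
Proof. by exists a.+1 => n an; rewrite /cu /unit_vector gtn_eqF // mulr0. Qed.

(** Only moduli are recorded: the cotype steps alter signs, and the norm of [X_p] sees moduli
    alone. *)
Definition modulus_of (j : 'I_m) (u : nat -> K) :=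
  forall n, rnorm (u n) = if (n < N)%N then `|c j n| else 0.

Let modulus_support j u : modulus_of j u -> finitely_supported u.
Proof.
by move=> h; exists N => n Nn; apply: rnorm_eq0; rewrite h ltnNge Nn.
Qed.

Lemma multilinear_homogeneous (i : index) :
  rnorm (A (V 0 (fun=> fun=> 0) i)) = (\prod_j `|c j (i j)|) * rnorm (A (fun j => unit_vector R k (i j))).
Proof.
pose U t : 'I_m -> nat -> K := fun j => if (j < t)%N then cu j (i j) else unit_vector R k (i j).
have Ud t : dom (U t).
  by move=> j; rewrite /U; case: ifP => _; [exact: cu_support|exact: finitely_supported_unit].
have key t : (t <= m)%N -> rnorm (A (U t)) =
   (\prod_(j < m | (j < t)%N) `|c j (i j)|) * rnorm (A (fun j => unit_vector R k (i j))).
  elim: t => [_|t IH tm]; first by rewrite big_pred0 ?mul1r.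
  pose j0 := Ordinal tm.
  have -> : U t.+1 = update (U t) j0 (fun n => of_real k (c j0 (i j0)) * unit_vector R k (i j0) n).
    apply/funext => j; rewrite /U /update; case: eqP => [->|jn]; first by rewrite ltnSn.
    rewrite ltnS leq_eqVlt; case: eqP => // jt; case: jn; exact: val_inj.
  rewrite multilinearZ //; last exact: finitely_supported_unit.
  have -> : update (U t) j0 (unit_vector R k (i j0)) = U t.
    by apply/funext => j; rewrite /U /update; case: eqP => [->|//]; rewrite ltnn.
  rewrite rnormZ rnorm_of_real (IH (ltnW tm)) mulrA; congr (_ * _).
  rewrite [RHS](bigD1 j0) ?ltnSn //=; congr (_ * _); apply: eq_bigl => j.
  by rewrite -val_eqE /= ltnS ltn_neqAle andbC.
have -> : V 0 (fun=> fun=> 0) i = U m by apply/funext => j; rewrite /V /U ltn_ord.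
rewrite key //; congr (_ * _); apply: eq_bigl => j; exact: ltn_ord.
Qed.

(** Pinning the first [t] coordinates at [ord0] makes the sum run over the remaining ones while the
    index type stays the same. *)
Let J (t : nat) (i : index) := [forall j : 'I_m, (j < t)%N ==> (i j == ord0)].

Lemma multilinear_cotype_step (q Kq : R) t y : 2 <= q -> 0 < Kq ->
  cotype_bound (@rn R k X) q Kq -> (t < m)%N ->
  (forall j : 'I_m, (j < t)%N -> modulus_of j (y j)) ->
  exists y', (forall j : 'I_m, (j < t.+1)%N -> modulus_of j (y' j)) /\
  \sum_(i | J t i) rnorm (A (V t y i)) `^ q <=
  Kq `^ q * \sum_(i | J t.+1 i) rnorm (A (V t.+1 y' i)) `^ q.
Proof.
move=> q2 K0 HK tm ymod; pose j0 := Ordinal tm.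
pose upd (i : index) a : index := [ffun j => if j == j0 then a else i j].
have Vd i : dom (V t y i).
  move=> j; rewrite /V; case: ifP => [jt|_]; last exact: cu_support.
  exact: modulus_support (ymod j jt).
pose x (i : index) (a : 'I_N) : realified X := A (update (V t y i) j0 (cu j0 a)).
have [eps heps] := @cotype_exists_signs R (realified X) (@rn R k X) (rn_seminorm X) q Kq index
   [seq i <- index_enum index | J t.+1 i] N x q2 K0 HK.
pose sg a : K := if eps a then 1 else -1.
pose y0 : nat -> K := fun n => \sum_(a < N) sg a * cu j0 a n.
exists (fun j => if j == j0 then y0 else y j); split.
  move=> j; rewrite ltnS leq_eqVlt => /predU1P[jt|jt]; last first.
    rewrite (_ : j == j0 = false); first exact: ymod.
    by apply/negbTE; rewrite -val_eqE /= ltn_eqF.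
  have -> : j = j0 by exact: val_inj.
  rewrite eqxx => n; rewrite /y0; have [nN|nN] := ltnP n N.
    rewrite (bigD1 (Ordinal nN)) //= big1 ?addr0.
      rewrite /cu /unit_vector eqxx mulr1 rnormM rnorm_of_real /sg.
      case: ifP => _; first by rewrite -(of_real1 R k) rnorm_of_real normr1 mul1r.
      by rewrite rnormN -(of_real1 R k) rnorm_of_real normr1 mul1r.
    move=> a; rewrite -val_eqE /= => an; rewrite /cu /unit_vector eq_sym (negbTE an).
    by rewrite !mulr0.
  rewrite big1 ?rnorm0 // => a _; rewrite /cu /unit_vector gtn_eqF ?mulr0 //.
  exact: leq_trans (ltn_ord a) nN.
(* Indices are grouped by all coordinates except the one of [j0]; the representative of a group has
   [ord0] there. *)
rewrite (partition_big (fun i => upd i ord0) (J t.+1)) /=; last first.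
  move=> i /forallP iJ; apply/forallP => j; apply/implyP => jt; rewrite ffunE.
  case: (j =P j0) => // /eqP jn; have := iJ j; rewrite -val_eqE /= in jn.
  by move/implyP; apply; rewrite ltn_neqAle jn -ltnS.
have -> : \sum_(i' | J t.+1 i') \sum_(i | J t i && (upd i ord0 == i')) rnorm (A (V t y i)) `^ q =
   \sum_(i' <- [seq i <- index_enum index | J t.+1 i]) \sum_a rn (x i' a) `^ q.
  rewrite big_filter; apply: eq_bigr => i' /forallP i'J.
  rewrite (reindex_onto (fun a => upd i' a) (fun i => i j0)) /=; last first.
    move=> i /andP[_ /eqP <-]; apply/ffunP => j; rewrite !ffunE.
    by case: eqP => [->|].
  apply: eq_big => [a|a _].
    rewrite ffunE !eqxx andbT; apply/andP; split.
      apply/forallP => j; apply/implyP => jt; rewrite ffunE.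
      rewrite (_ : j == j0 = false); last by apply/negbTE; rewrite -val_eqE /= ltn_eqF.
      by have := i'J j; rewrite (ltnW jt : (j < t.+1)%N).
    apply/eqP/ffunP => j; rewrite !ffunE; case: eqP => // ->.
    by have := i'J j0; rewrite /= ltnSn /= => /eqP.
  congr (rnorm (A _) `^ q); apply/funext => j; rewrite /V /update /upd ffunE.
  by case: eqP => [->|//]; rewrite ltnn.
apply: (le_trans heps); rewrite big_filter le_eqVlt; apply/orP; left; apply/eqP.
congr (_ * _); apply: eq_bigr => i' _; congr (_ `^ q).
have [_ hsum] := @multilinear_sum (V t y i') j0 'I_N (index_enum 'I_N) sg (fun a => cu j0 a)
  (Vd i') (fun a => cu_support j0 a).
rewrite /rn; congr rnorm.
transitivity (A (update (V t y i') j0 y0)).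
  rewrite hsum; apply: eq_bigr => a _; rewrite /x /sg.
  by case: ifP => _; rewrite ?scale1r ?scaleN1r.
congr A; apply/funext => j; rewrite /V /update; case: (j =P j0) => [->|jn]; first by rewrite /= ltnSn ?eqxx.
rewrite (ltnS j) (leq_eqVlt j); case: (nat_of_ord j =P t) => // jt; case: jn; exact: val_inj.
Qed.

Lemma multilinear_cotype (q Kq C : R) (D : 'I_m -> R) : 2 <= q -> 0 < Kq -> 0 <= C ->
  cotype_bound (@rn R k X) q Kq ->
  (forall x, (forall j, in_Xp (p j) (x j)) ->
     rnorm (A x) <= C * \prod_(j < m) fine (seq_norm (p j) (x j))) ->
  (forall j u, modulus_of j u -> fine (seq_norm (p j) u) <= D j) ->
  \sum_(i : index) ((\prod_j `|c j (i j)|) * rnorm (A (fun j => unit_vector R k (i j)))) `^ q <=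
  (Kq `^ q) ^+ m * (C * \prod_j D j) `^ q.
Proof.
move=> q2 K0 C0 HK Abnd HD; have q0 : 0 < q by lra.
have iter t : (t <= m)%N -> exists y, (forall j : 'I_m, (j < t)%N -> modulus_of j (y j)) /\
    \sum_(i : index) rnorm (A (V 0 (fun=> fun=> 0) i)) `^ q <=
    (Kq `^ q) ^+ t * \sum_(i | J t i) rnorm (A (V t y i)) `^ q.
  elim: t => [_|t IH tm].
    exists (fun=> fun=> 0); split=> //; rewrite mul1r le_eqVlt; apply/orP; left; apply/eqP.
    by apply: eq_bigl => i; apply/esym/forallP.
  have [y [ymod hy]] := IH (ltnW tm).
  have [y' [y'mod hy']] := multilinear_cotype_step q2 K0 HK tm ymod.
  exists y'; split=> //; apply: (le_trans hy); rewrite exprSr -mulrA.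
  by rewrite ler_wpM2l // exprn_ge0 // powR_ge0.
have [y [ymod hy]] := iter m (leqnn m).
rewrite (eq_bigr (fun i : index => rnorm (A (V 0 (fun=> fun=> 0) i)) `^ q)); last first.
  by move=> i _; rewrite multilinear_homogeneous.
apply: (le_trans hy); rewrite ler_wpM2l ?exprn_ge0 ?powR_ge0 //.
rewrite (big_pred1 [ffun=> ord0]); last first.
  move=> i; apply/forallP/eqP => [H|-> j]; last by rewrite ffunE eqxx implybT.
  by apply/ffunP => j; rewrite ffunE; have := H j; rewrite ltn_ord => /eqP.
have ymod' j : modulus_of j (y j) by exact: ymod.
have -> : V m y [ffun=> ord0] = y by apply/funext => j; rewrite /V ltn_ord.
have yin j : in_Xp (p j) (y j) by apply: in_Xp_support => //; exact: modulus_support (ymod' j).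
apply: ge0_ler_powR; rewrite ?nnegrE ?rnorm_ge0 ?(ltW q0) //.
  rewrite mulr_ge0 // prodr_ge0 // => j _; apply: le_trans (HD j _ (ymod' j)).
  by apply: fine_ge0; exact: seq_norm_ge0.
apply: (le_trans (Abnd _ yin)); rewrite ler_wpM2l //; apply: ler_prod => j _.
by rewrite HD // andbT; apply: fine_ge0; exact: seq_norm_ge0.
Qed.

End Multilinear.

(** * Summability at and above the critical exponent *)

Section Summability.
Context (R : realType) (k : scalar_kind) (X : normedModType (scalars R k)).
Local Notation K := (scalars R k).
Context (m : nat) (p : 'I_m -> \bar R) (s : 'I_m -> R) (A : ('I_m -> nat -> K) -> X).
Hypothesis p2 : forall i, (2%:E <= p i)%E.
Hypothesis ps : forall i, (p i = +oo%E /\ s i = 0) \/ (0 < s i /\ p i = (s i)^-1%:E).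
Hypothesis Amul : multilinear_on p A.
Hypothesis Abnd : bounded_on p A.

Let e : R := \sum_i s i.

Lemma powR_sum (I : finType) (x : R) (f : I -> R) : 0 < x ->
  x `^ (\sum_i f i) = \prod_i x `^ f i.
Proof.
move=> x0; apply: (big_morph (fun t => x `^ t)); last exact: powRr0.
by move=> a b; rewrite powRD // (gt_eqF x0) /= implybT.
Qed.

(** With weights built from the partial sums [S j a], all quantities are powers of the single sum
    [B]. The outcome is [B <= const * B ^ (e q)], and [e q < 1] bounds [B] independently of [N']. *)
Lemma box_bound (q Kq : R) : 2 <= q -> 0 < Kq -> cotype_bound (@rn R k X) q Kq -> e < q^-1 ->
  exists2 L, 0 <= L & forall N', \sum_(i : {ffun 'I_m -> 'I_N'.+1})
    rnorm (A (fun j => unit_vector R k (i j))) `^ (q^-1 - e)^-1 <= L.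
Proof.
move=> q2 K0 HK eq1; have q0 : 0 < q by lra.
have [C HC] := Abnd.
have Abnd' x : (forall j, in_Xp (p j) (x j)) ->
    rnorm (A x) <= `|C| * \prod_(j < m) fine (seq_norm (p j) (x j)).
  move=> xin; apply: (le_trans (HC _ xin)); rewrite ler_wpM2r ?ler_norm //.
  by apply: prodr_ge0 => j _; apply: fine_ge0; exact: seq_norm_ge0.
set rho := (q^-1 - e)^-1.
have d0 : 0 < q^-1 - e by lra.
have rho0 : 0 < rho by rewrite invr_gt0.
have eq0 : 0 < 1 - e * q by rewrite subr_gt0 -ltr_pdivlMr // div1r.
(* This identity singles out the critical exponent: [b ^ (rho e)] times [b], raised to the power
   [q], is [b ^ rho] again. *)
have rhoE : (rho * e + 1) * q = rho.
  have rd : rho * (q^-1 - e) = 1 by rewrite mulVf ?gt_eqF.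
  by rewrite -rd -mulrDr addrC subrK divfK ?gt_eqF.
pose L := ((Kq `^ q) ^+ m * `|C| `^ q) `^ (1 - e * q)^-1.
exists L; first exact: powR_ge0.
move=> N'; pose b (i : {ffun 'I_m -> 'I_N'.+1}) := rnorm (A (fun j => unit_vector R k (i j))).
have b0 i : 0 <= b i by exact: rnorm_ge0.
pose B := \sum_i b i `^ rho; rewrite -/B.
have B0 : 0 <= B by apply: sumr_ge0 => *; exact: powR_ge0.
have [->|Bn0] := eqVneq B 0; first exact: powR_ge0.
have Bp : 0 < B by rewrite lt_def Bn0.
pose S (j : 'I_m) (a : nat) := \sum_(i : {ffun 'I_m -> 'I_N'.+1} | i j == a :> nat) b i `^ rho.
have S0 j a : 0 <= S j a by apply: sumr_ge0 => *; exact: powR_ge0.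
pose c (j : 'I_m) (a : nat) := S j a `^ s j.
have HD j (u : nat -> K) : modulus_of N' c j u -> fine (seq_norm (p j) u) <= B `^ s j.
  move=> mu; have usupp n : (N'.+1 <= n)%N -> u n = 0.
    by move=> h; apply: rnorm_eq0; rewrite mu ltnNge h.
  have ufs : finitely_supported u by exists N'.+1.
  have [[pE sE]|[s0 pE]] := ps j.
    rewrite pE sE powRr0; apply: seq_norm_infty_le; last first.
      by rewrite -pE; exact: in_Xp_support.
    move=> n; rewrite mu; case: ifP => _ //.
    by rewrite /c sE powRr0 normr1.
  have si0 : 0 < (s j)^-1 by rewrite invr_gt0.
  rewrite pE (seq_norm_support si0 usupp) /= invrK.
  rewrite (_ : \sum_(i < N'.+1) rnorm (u i) `^ (s j)^-1 = B) // /B.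
  rewrite (partition_big (fun i : {ffun 'I_m -> 'I_N'.+1} => i j) predT) //=.
  apply: eq_bigr => a _; rewrite mu ltn_ord ger0_norm ?powR_ge0 //.
  by rewrite /c -powRrM mulfV ?gt_eqF // powRr1.
have main := @multilinear_cotype R k X m p A p2 Amul N' c q Kq `|C| (fun j => B `^ s j) q2 K0
  (normr_ge0 C) HK Abnd' HD.
rewrite -powR_sum // -/e in main.
(* Each [S j (i j)] contains the term [b i ^ rho], so the product of the weights is at least
   [b i ^ (rho e)]. *)
have lower : B <= \sum_(i : {ffun 'I_m -> 'I_N'.+1}) ((\prod_j `|c j (i j)|) * b i) `^ q.
  apply: ler_sum => i _.
  have [->|bn0] := eqVneq (b i) 0; first by rewrite powR0 ?powR_ge0 // gt_eqF.
  have bp : 0 < b i by rewrite lt_def bn0 b0.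
  rewrite -{1}rhoE powRrM; apply: ge0_ler_powR; rewrite ?nnegrE ?powR_ge0 ?(ltW q0) //.
    by rewrite mulr_ge0 // prodr_ge0.
  rewrite powRD ?bn0 ?implybT // powRr1 // ler_wpM2r //.
  rewrite powRrM {1}/e powR_sum ?powR_gt0 ?bp //; apply: ler_prod => j _.
  rewrite powR_ge0 /= ger0_norm ?powR_ge0 // /c.
  have sj0 : 0 <= s j by have [[_ ->]|[/ltW]] := ps j.
  apply: ge0_ler_powR; rewrite ?nnegrE ?powR_ge0 //.
  rewrite /S (bigD1 i) //= lerDl; apply: sumr_ge0 => *; exact: powR_ge0.
have h : B <= (Kq `^ q) ^+ m * `|C| `^ q * B `^ (e * q).
  apply: (le_trans lower); apply: (le_trans main).
  by rewrite powRM ?powR_ge0 // -powRrM mulrA.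
have h2 : B `^ (1 - e * q) <= (Kq `^ q) ^+ m * `|C| `^ q.
  rewrite -(@ler_pM2r _ (B `^ (e * q))) ?powR_gt0 // -powRD ?Bn0 ?implybT //.
  by rewrite subrK powRr1.
have -> : B = (B `^ (1 - e * q)) `^ (1 - e * q)^-1.
  by rewrite -powRrM mulfV ?gt_eqF // powRr1.
apply: ge0_ler_powR => //; rewrite ?nnegrE ?powR_ge0 //.
  by rewrite invr_ge0 ltW.
by rewrite mulr_ge0 ?exprn_ge0 ?powR_ge0.
Qed.

Lemma seq_box_sum (f : {ffun 'I_m -> nat} -> R) (M : R) (l : seq {ffun 'I_m -> nat}) :
  (forall i, 0 <= f i) -> uniq l ->
  (forall N', \sum_(i : {ffun 'I_m -> 'I_N'.+1}) f [ffun j => val (i j)] <= M) ->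
  \sum_(i <- l) f i <= M.
Proof.
move=> f0 ul HM.
pose N' := (\max_(i <- l) \max_j i j)%N.
have lN i j : i \in l -> (i j < N'.+1)%N.
  move=> il; rewrite ltnS; apply: (@leq_trans (\max_j i j)); first exact: (leq_bigmax j).
  by rewrite /N' (big_rem i) //= leq_maxl.
pose low (i : {ffun 'I_m -> nat}) : {ffun 'I_m -> 'I_N'.+1} := [ffun j => inord (i j)].
have lowK i : i \in l -> [ffun j => val (low i j)] = i.
  by move=> il; apply/ffunP => j; rewrite !ffunE /= inordK // lN.
apply: le_trans (HM N').
have -> : \sum_(i <- l) f i = \sum_(i <- map low l) f [ffun j => val (i j)].
  rewrite big_map big_seq [RHS]big_seq; apply: eq_bigr => i il.
  by rewrite (lowK i il).
have ulow : uniq (map low l).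
  rewrite map_inj_in_uniq // => i i' il i'l ii'.
  by rewrite -(lowK _ il) -(lowK _ i'l) ii'.
rewrite big_uniq // [leRHS](bigID (mem (map low l))) /= lerDl.
by apply: sumr_ge0 => *; exact: f0.
Qed.

(** Each term to the critical power is at most [L], so a larger exponent only costs the factor
    [L ^ (t - 1)]. *)
Lemma summable_of_exponent (q Kq rho : R) : 2 <= q -> 0 < Kq ->
  cotype_bound (@rn R k X) q Kq -> e < q^-1 -> 0 < rho -> rho^-1 <= q^-1 - e ->
  (\esum_(i in [set: {ffun 'I_m -> nat}])
     (rnorm (A (fun j => unit_vector R k (i j))) `^ rho)%:E < +oo)%E.
Proof.
move=> q2 K0 HK eq1 r0 hr.
have [L L0 HL] := box_bound q2 K0 HK eq1.
set rho0 := (q^-1 - e)^-1 in HL.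
have d0 : 0 < q^-1 - e by lra.
have rho00 : 0 < rho0 by rewrite invr_gt0.
have t1 : 1 <= rho / rho0.
  rewrite ler_pdivlMr // mul1r /rho0 -[leRHS]invrK lef_pV2 ?posrE ?invr_gt0 //.
set t := rho / rho0 in t1.
pose b (i : 'I_m -> nat) := rnorm (A (fun j => unit_vector R k (i j))).
have b0 i : 0 <= b i by exact: rnorm_ge0.
have bt i : b i `^ rho = (b i `^ rho0) `^ t by rewrite -powRrM /t mulrC divfK // gt_eqF.
apply: (@le_lt_trans _ _ (L * L `^ (t - 1))%:E); last exact: ltry.
apply: ge_ereal_sup => _ [F [finF _] <-].
rewrite fsbig_finite // sumEFin lee_fin.
apply: (@seq_box_sum (fun i => b i `^ rho)); first by move=> i; exact: powR_ge0.
  exact: finmap.fset_uniq.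
move=> N'.
have bE (i : {ffun 'I_m -> 'I_N'.+1}) : b [ffun j => val (i j)] = rnorm (A (fun j => unit_vector R k (i j))).
  by rewrite /b; congr (rnorm (A _)); apply/funext => j; rewrite ffunE.
have bL (i : {ffun 'I_m -> 'I_N'.+1}) : b [ffun j => val (i j)] `^ rho0 <= L.
  apply: le_trans (HL N'); rewrite bE (bigD1 i) //= lerDl.
  by apply: sumr_ge0 => *; exact: powR_ge0.
apply: (@le_trans _ _ (\sum_(i : {ffun 'I_m -> 'I_N'.+1}) b [ffun j => val (i j)] `^ rho0 * L `^ (t - 1))).
  apply: ler_sum => i _; rewrite bt.
  rewrite -mulr_powRB1 ?powR_ge0 //; last by lra.
  rewrite ler_wpM2l ?powR_ge0 //; apply: ge0_ler_powR; rewrite ?nnegrE ?powR_ge0 //.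
  by lra.
rewrite -mulr_suml ler_wpM2r ?powR_ge0 //.
by apply: le_trans (HL N'); apply: ler_sum => i _; rewrite bE.
Qed.

End Summability.

(** * Diagonal operators *)

Section DiagonalBlocks.
Context (R : realType) (k : scalar_kind) (X : normedModType (scalars R k)).
Local Notation K := (scalars R k).
Context (m : nat) (s : 'I_m -> R).
Hypothesis s0 : forall j, 0 <= s j.
Let e : R := \sum_j s j.

(** For [s j = 0], that is [p j] infinite, the exponent [(s j)^-1] evaluates to 0, so the sup norm
    needs its own clause. *)
Definition in_unit_ball n (j : 'I_m) (u : nat -> K) :=
  if s j == 0 then forall i, rnorm (u i) <= 1
  else \sum_(i < n) rnorm (u i) `^ (s j)^-1 <= 1.

(* [|\prod_j x j i|] is at most [(g i mu i) `^ e] with [mu i = rn (y i) `^ r] and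
   [g i = 1 + \sum_j rnorm (x j i) `^ (s j)^-1 / mu i], so [layer_cake] applies. *)
Lemma scaled_good_family_bound (r : R) : 0 < r -> e < r^-1 -> exists2 M, 0 < M &
  forall n (y : 'I_n -> realified X),
  (forall (A : {set 'I_n}) (c : 'I_n -> R), (forall i, `|c i| <= 1) ->
        rn (\sum_(i in A) c i *: y i) <= (4 * mass (@rn R k X) r y A) `^ r^-1) ->
  \sum_i rn (y i) `^ r <= 1 ->
  forall x : 'I_m -> nat -> K, (forall j, in_unit_ball n j (x j)) ->
  rnorm (\sum_(i < n) (\prod_j x j i) *: (of_real k ((rn (y i) `^ r) `^ (- e)) *: (y i : X))) <= M.
Proof.
move=> r0 er.
have e0 : 0 <= e by apply: sumr_ge0.
have m10 : 0 < 1 + m%:R :> R by rewrite ltr_pwDl // ler0n.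
have [M M0 HM] := layer_cake (rn_seminorm X) r0 e0 er m10.
exists (M + M); first by rewrite addr_gt0.
move=> n y Hy y1 x xball; pose mu i := rn (y i) `^ r.
have mu0 i : 0 <= mu i by exact: powR_ge0.
(* Where [mu i = 0] the vector [y i] vanishes, so its coefficient may be set to 0; this keeps the
   bound [cg] true there. *)
pose c (i : 'I_n) : K := if mu i == 0 then 0 else (\prod_j x j i) * of_real k (mu i `^ (- e)).
have cE : \sum_(i < n) (\prod_j x j i) *: (of_real k (mu i `^ (- e)) *: (y i : X)) =
          \sum_(i < n) c i *: (y i : X).
  apply: eq_bigr => i _; rewrite scalerA /c; case: eqP => // mui.
  have : rnorm (y i : X) = 0 by apply: (@powR_eq0_eq0 _ _ r).
  by move/rnorm_eq0 => ->; rewrite !scaler0.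
rewrite cE.
pose g i := 1 + \sum_j (if (s j == 0) || (mu i == 0) then 0 else rnorm (x j i) `^ (s j)^-1 / mu i).
have term0 i j : 0 <= (if (s j == 0) || (mu i == 0) then 0 else rnorm (x j i) `^ (s j)^-1 / mu i).
  by case: ifP => // _; rewrite divr_ge0 ?powR_ge0.
have g1 i : 1 <= g i by rewrite lerDl; apply: sumr_ge0.
(* The masses contribute at most 1, and so does each of the [m] variables through its unit ball. *)
have gM : \sum_i g i * rn (y i) `^ r <= 1 + m%:R.
  rewrite (eq_bigr (fun i => mu i + \sum_j (if (s j == 0) || (mu i == 0) then 0 else rnorm (x j i) `^ (s j)^-1))); last first.
    move=> i _; rewrite /g -/(mu i) mulrDl mul1r mulr_suml; congr (_ + _); apply: eq_bigr => j _.
    case: ifP; first by rewrite mul0r.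
    by move/negbT; rewrite negb_or => /andP[_ mun]; rewrite divfK.
  rewrite big_split; apply: lerD => //; rewrite exchange_big /=.
  apply: (@le_trans _ _ (\sum_(j < m) 1)); last by rewrite sumr_const card_ord.
  apply: ler_sum => j _; have := xball j; rewrite /in_unit_ball.
  case: eqP => sj h; first by rewrite big1 // => i _.
  apply: le_trans h; apply: ler_sum => i _; case: ifP => // _; exact: powR_ge0.
have cg i : rnorm (c i) <= g i `^ e.
  rewrite /c; case: eqP => [_|/eqP mun]; first by rewrite rnorm0 powR_ge0.
  have mup : 0 < mu i by rewrite lt_def mun mu0.
  have gp : 0 < g i by apply: lt_le_trans (g1 i).
  rewrite rnormM rnorm_prod rnorm_of_real ger0_norm ?powR_ge0 // powRN ler_pdivrMr; last exact: powR_gt0.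
  rewrite -powRM ?(ltW gp) // /e powR_sum ?mulr_gt0 //; apply: ler_prod => j _.
  rewrite rnorm_ge0 /=; have := xball j; rewrite /in_unit_ball.
  case: eqP => sj h; first by rewrite sj powRr0.
  have sjp : 0 < s j by rewrite lt_def s0 andbT; exact/eqP.
  have -> : rnorm (x j i) = (rnorm (x j i) `^ (s j)^-1) `^ s j.
    by rewrite -powRrM mulVf ?gt_eqF // powRr1 // rnorm_ge0.
  apply: ge0_ler_powR; rewrite ?nnegrE ?powR_ge0 ?(ltW sjp) //.
    by rewrite mulr_ge0 // ltW.
  rewrite -ler_pdivrMr // /g (bigD1 j) //= (gt_eqF sjp) (negbTE mun) /=.
  by rewrite addrCA lerDl; apply: addr_ge0 => //; apply: sumr_ge0 => j0 _; case: ifP => // _; rewrite divr_ge0 ?powR_ge0.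
have [i0 i01 dec] := scalar_decomposition R k.
have [al hal] := boolp.choice (fun i => dec (c i)).
have [be hbe] := boolp.choice hal.
pose u1 : realified X := \sum_(i < n) al i *: y i.
pose u2 : realified X := \sum_(i < n) be i *: y i.
have dE : \sum_(i < n) c i *: (y i : X) = (u1 : X) + i0 *: (u2 : X).
  rewrite /u1 /u2 [X in _ + X]scaler_sumr -[RHS]big_split; apply: eq_bigr => i _ /=.
  by have [cE2 _ _] := hbe i; rewrite cE2 scalerDl -scalerA.
rewrite dE.
apply: (le_trans (rnormD _ _)); apply: lerD.
  apply: (HM n y g al Hy g1 gM) => i; have [_ h _] := hbe i; exact: le_trans h (cg i).
rewrite rnormZ; apply: le_trans (ler_piMl (rnorm_ge0 _) i01) _.
apply: (HM n y g be Hy g1 gM) => i; have [_ _ h] := hbe i; exact: le_trans h (cg i).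
Qed.

(** The weight [mu ^ (- e)] turns the norm [mu ^ (1 / r)] into one whose power [rho] is [mu ^ th]
    with [th < 1]. All masses are at most [1 / T] and add up to at least 1/2, so the sum of the
    [mu ^ th] is at least [T ^ (1 - th) / 2]; [T] is chosen so that this outweighs the scaling by
    [eps / M]. *)
Lemma diagonal_blocks (q rho : R) : 0 < q -> e < q^-1 -> q^-1 < e + rho^-1 -> 0 < rho ->
  (forall r C, 0 < r -> r < q -> 0 < C -> exists zs : seq (realified X),
    {in signed_sums zs 0, forall u, C * rn u < (\sum_(z <- zs) rn z `^ r) `^ r^-1}) ->
  forall eps, 0 < eps -> exists (n : nat) (w : nat -> X),
    1 <= \sum_(i < n) rnorm (w i) `^ rho /\
    forall x : 'I_m -> nat -> K, (forall j, in_unit_ball n j (x j)) ->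
      rnorm (\sum_(i < n) (\prod_j x j i) *: w i) <= eps.
Proof.
move=> q0 eq1 eq2 rho0 fails.
(* [1 / r] lies strictly between [1 / q] and [e + 1 / rho]; it exceeds [e] because [1 / q] does. *)
pose rV := (q^-1 + (e + rho^-1)) / 2; pose r := rV^-1.
have qi0 : 0 < q^-1 by rewrite invr_gt0.
have rV1 : q^-1 < rV by rewrite /rV; lra.
have rV2 : rV < e + rho^-1 by rewrite /rV; lra.
have rV0 : 0 < rV by lra.
have r0 : 0 < r by rewrite invr_gt0.
have rq : r < q by rewrite -[ltRHS]invrK ltf_pV2 ?posrE.
have rE : r^-1 = rV by rewrite invrK.
have er : e < r^-1 by rewrite rE; lra.
have [M M0 HM] := scaled_good_family_bound r0 er.
move=> eps eps0.
pose th := rho * (r^-1 - e).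
have th0 : 0 < th by rewrite mulr_gt0 // subr_gt0.
have th1 : th < 1.
  by rewrite /th rE -(mulfV (lt0r_neq0 rho0)) ltr_pM2l //; lra.
pose B := 2 * (M / eps) `^ rho.
have B0 : 0 < B by rewrite mulr_gt0 // powR_gt0 // divr_gt0.
pose T := B `^ (1 - th)^-1.
have T0 : 0 < T by exact: powR_gt0.
have TB : T `^ (1 - th) = B.
  rewrite /T -powRrM mulVf ?powRr1 ?(ltW B0) //; apply: lt0r_neq0; lra.
have [n [y [y2 y1 yT Hy]]] := good_family (rn_seminorm X) r0 T0 (fun C C0 => fails r C r0 rq C0).
pose mu i := rn (y i) `^ r.
pose a (i : 'I_n) := eps / M * mu i `^ (- e).
pose w (l : nat) : X := if insub l is Some i then of_real k (a i) *: (y i : X) else 0.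
have wE (i : 'I_n) : w i = of_real k (a i) *: (y i : X) by rewrite /w valK.
have c0 : 0 < eps / M by rewrite divr_gt0.
exists n, w; split.
  have term (i : 'I_n) : (eps / M) `^ rho * (mu i * T `^ (1 - th)) <= rnorm (w i) `^ rho.
    have [mui|mun] := eqVneq (mu i) 0.
      by rewrite mui mul0r mulr0 powR_ge0.
    have mup : 0 < mu i by rewrite lt_def mun powR_ge0.
    rewrite wE rnormZ rnorm_of_real ger0_norm; last by rewrite mulr_ge0 ?powR_ge0 ?ltW.
    have -> : rnorm (y i : X) = mu i `^ r^-1.
      by rewrite /mu -powRrM mulfV ?gt_eqF // powRr1 // rnorm_ge0.
    have -> : a i * mu i `^ r^-1 = eps / M * mu i `^ (- e + r^-1).
      by rewrite powRD ?mun ?implybT // /a mulrA.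
    rewrite [X in _ <= X]powRM ?powR_ge0 ?(ltW c0) //.
    rewrite ler_pM2l ?powR_gt0 // -powRrM.
    have -> : (- e + r^-1) * rho = 1 + - (1 - th) by rewrite /th; ring.
    rewrite (@powRD _ (mu i) 1) ?mun ?implybT // (powRr1 (ltW mup)) (ler_pM2l mup).
    have -> : mu i `^ (- (1 - th)) = (mu i)^-1 `^ (1 - th).
      by rewrite -(powR_inv1 (ltW mup)) -powRrM mulN1r.
    apply: ge0_ler_powR; rewrite ?nnegrE ?invr_ge0 ?(ltW mup) ?(ltW T0) //; first by lra.
    by rewrite -[leLHS]invrK lef_pV2 ?posrE ?invr_gt0 //; exact: yT.
  apply: le_trans (ler_sum _ (fun i _ => term i)).
  rewrite -mulr_sumr -mulr_suml TB /B.
  have E1 : (eps / M) `^ rho * (M / eps) `^ rho = 1.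
    rewrite -powRM ?divr_ge0 ?(ltW eps0) ?(ltW M0) // mulrA divfK ?gt_eqF // divff ?gt_eqF //.
    by rewrite powR1.
  have -> : (eps / M) `^ rho * ((\sum_i mu i) * (2 * (M / eps) `^ rho)) =
     ((eps / M) `^ rho * (M / eps) `^ rho) * (2 * \sum_i mu i) by ring.
  by rewrite E1 mul1r; lra.
move=> x xball.
have -> : \sum_(i < n) (\prod_j x j i) *: w i = of_real k (eps / M) *:
   \sum_(i < n) (\prod_j x j i) *: (of_real k (mu i `^ (- e)) *: (y i : X)).
  rewrite scaler_sumr; apply: eq_bigr => i _.
  by rewrite wE /a of_realM !scalerA; congr (_ *: _); rewrite mulrCA mulrA.
rewrite rnormZ rnorm_of_real ger0_norm ?(ltW c0) //.
apply: le_trans (ler_wpM2l (ltW c0) (HM n y Hy y1 x xball)) _.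
by rewrite divfK // gt_eqF.
Qed.

End DiagonalBlocks.

Section GeometricSeries.
Context (R : realType) (k : scalar_kind) (X : completeNormedModType (scalars R k)).
Local Notation K := (scalars R k).

Lemma lt_of_real (a b : R) : (of_real k a < of_real k b) = (a < b).
Proof. by rewrite /of_real; case: k => //; rewrite ltcE /= eqxx. Qed.

Lemma geometric_series (u : nat -> X) (C : R) : 0 <= C ->
  (forall l, rnorm (u l) <= C * (2 ^+ l)^-1) ->
  cvgn (series u) /\ rnorm (limn (series u)) <= 2 * C.
Proof.
move=> C0 uC.
have h0 n : 0 < (2 ^+ n)^-1 :> R by rewrite invr_gt0 exprn_gt0.
have tail (N d : nat) : rnorm (series u (N + d)%N - series u N) <=
    2 * C * ((2 ^+ N)^-1 - (2 ^+ (N + d)%N)^-1).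
  elim: d => [|d IH]; first by rewrite addn0 !subrr mulr0 rnorm0.
  rewrite addnS seriesSr addrAC; apply: le_trans (rnormD _ _) _.
  apply: le_trans (lerD IH (uC _)) _.
  by rewrite exprS invfM; set a := (2 ^+ (N + d)%N)^-1; rewrite le_eqVlt; apply/orP; left; apply/eqP; field.
have tail2 N n : (N <= n)%N -> rnorm (series u n - series u N) <= 2 * C * (2 ^+ N)^-1.
  move=> /subnKC <-; apply: le_trans (tail _ _) _.
  by apply: ler_wpM2l; [rewrite mulr_ge0|rewrite gerBl ltW].
have cv : cvgn (series u).
  apply/cauchy_cvgP; apply: cauchy_exP => eps eps0.
  have epsE := ge0_of_real (ltW eps0).
  have e0 : 0 < real_part eps by rewrite -lt_of_real of_real0 -epsE.
  have [N HN] := expr_unbounded (2 * C / real_part eps) (ltr1n R 2).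
  exists (series u N); exists N => // n /= Nn.
  rewrite -ball_normE /= -rnormE epsE lt_of_real -opprB rnormN.
  apply: le_lt_trans (tail2 _ _ Nn) _.
  by rewrite ltr_pdivrMr ?exprn_gt0 // [ltRHS]mulrC -ltr_pdivrMr.
split=> //.
apply/ler_addgt0Pr => e e0.
have /cvgrPdist_lt/(_ (of_real k e)) := cv.
rewrite -(of_real0 R k) lt_of_real => /(_ e0) [N _ /(_ N (leqnn N))] /=.
rewrite -rnormE lt_of_real => h.
rewrite -[X in rnorm X](subrK (series u N)); apply: le_trans (rnormD _ _) _.
rewrite addrC; apply: lerD (ltW h).
have S0 : series u 0%N = 0 by rewrite /series /= big_geq.
have := tail 0%N N; rewrite add0n S0 subr0 => /le_trans; apply.
by apply: ler_piMr; rewrite ?mulr_ge0 // expr0 invr1 gerBl ltW.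
Qed.

End GeometricSeries.

(** * Assembling the blocks into one operator *)

Section Gluing.
Context (R : realType) (k : scalar_kind) (X : completeNormedModType (scalars R k)).
Local Notation K := (scalars R k).
Context (m : nat) (p : 'I_m -> \bar R) (s : 'I_m -> R) (rho : R).
Hypothesis m1 : (0 < m)%N.
Hypothesis ps : forall i, (p i = +oo%E /\ s i = 0) \/ (0 < s i /\ p i = (s i)^-1%:E).
Context (n : nat -> nat) (w : nat -> nat -> X).
Hypothesis w1 : forall l, 1 <= \sum_(i < n l) rnorm (w l i) `^ rho.
Hypothesis wS : forall l (x : 'I_m -> nat -> K), (forall j, in_unit_ball s (n l) j (x j)) ->
  rnorm (\sum_(i < n l) (\prod_j x j i) *: w l i) <= (2 ^+ l)^-1.

(** An injective pairing gives the blocks disjoint sets of coordinates, the same in every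
    variable. *)
Let position (l i : nat) : nat := pickle (l, i).
Let block l (x : 'I_m -> nat -> K) : X :=
  \sum_(i < n l) (\prod_j x j (position l i)) *: w l i.
Let glued x : X := limn (series (block^~ x)).
Let norms (x : 'I_m -> nat -> K) : R := \prod_j fine (seq_norm (p j) (x j)).

Let position_inj l i l' i' : position l i = position l' i' -> (l, i) = (l', i').
Proof. exact: (pcan_inj pickleK). Qed.

Lemma in_unit_ball_normalized l j (u : nat -> K) : in_Xp (p j) u ->
  let t := fine (seq_norm (p j) u) in
  in_unit_ball s (n l) j (fun i => of_real k t^-1 * u (position l i)) /\
  forall i, (i < n l)%N -> u (position l i) = of_real k t * (of_real k t^-1 * u (position l i)).
Proof.
move=> up t.
have t0 : 0 <= t by apply: fine_ge0; exact: seq_norm_ge0.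
(* When [t = 0] also [t^-1 = 0], and the identity survives because [u] vanishes on the block. *)
have tE (a : K) : (t = 0 -> a = 0) -> a = of_real k t * (of_real k t^-1 * a).
  have [-> -> //|tn _] := eqVneq t 0; first by rewrite !mulr0.
  by rewrite mulrA -of_realM divff // of_real1 mul1r.
case: (ps j) => -[pj sj].
  have ut i : rnorm (u i) <= t by rewrite /t pj; apply: rnorm_le_seq_norm_infty; rewrite -pj.
  split.
    rewrite /in_unit_ball sj eqxx => i; rewrite rnormM rnorm_of_real ger0_norm ?invr_ge0 //.
    have [t00|tn] := eqVneq t 0; first by rewrite t00 invr0 mul0r.
    by rewrite mulrC ler_pdivrMr ?mul1r // lt_def tn.
  move=> i _; apply: tE => t00; apply: rnorm_eq0; apply/eqP.
  by rewrite eq_le rnorm_ge0 andbT -t00.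
have s1 : 0 < (s j)^-1 by rewrite invr_gt0.
have sumt : \sum_(i < n l) rnorm (u (position l i)) `^ (s j)^-1 <= t `^ (s j)^-1.
  rewrite /t sj; apply: (sum_le_seq_norm (f := fun i : 'I_(n l) => position l i)) => //.
    by move=> i i' /position_inj[/val_inj].
  by rewrite -sj.
split.
  rewrite /in_unit_ball gt_eqF //.
  rewrite (eq_bigr (fun i : 'I_(n l) => (t^-1) `^ (s j)^-1 * rnorm (u (position l i)) `^ (s j)^-1)); last first.
    move=> i _; rewrite rnormM rnorm_of_real ger0_norm ?invr_ge0 //.
    by rewrite powRM ?invr_ge0 // rnorm_ge0.
  rewrite -mulr_sumr; apply: le_trans (ler_wpM2l (powR_ge0 _ _) sumt) _.
  rewrite -powRM ?invr_ge0 //.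
  have [->|tn] := eqVneq t 0; first by rewrite mulr0 powR0 ?gt_eqF.
  by rewrite mulVf // powR1.
move=> i il; apply: tE => t00; apply: rnorm_eq0; apply: (@powR_eq0_eq0 _ _ (s j)^-1); apply/eqP.
rewrite eq_le powR_ge0 andbT; apply: le_trans (_ : t `^ (s j)^-1 <= _); last first.
  by rewrite t00 powR0 // gt_eqF.
apply: le_trans sumt; rewrite (bigD1 (Ordinal il)) //= lerDl.
by apply: sumr_ge0 => i' _; exact: powR_ge0.
Qed.

Lemma block_bound l x : (forall j, in_Xp (p j) (x j)) -> rnorm (block l x) <= norms x * (2 ^+ l)^-1.
Proof.
move=> xp; pose t j := fine (seq_norm (p j) (x j)).
have t0 j : 0 <= t j by apply: fine_ge0; exact: seq_norm_ge0.
pose y j i := of_real k (t j)^-1 * x j (position l i).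
have -> : block l x = of_real k (norms x) *: \sum_(i < n l) (\prod_j y j i) *: w l i.
  rewrite /block scaler_sumr; apply: eq_bigr => i _; rewrite scalerA; congr (_ *: _).
  rewrite (eq_bigr (fun j => of_real k (t j) * y j i)); last first.
    by move=> j _; have [_] := in_unit_ball_normalized l (xp j); apply.
  rewrite big_split /=; congr (_ * _).
  by rewrite (big_morph _ (of_realM k) (of_real1 R k)).
rewrite rnormZ rnorm_of_real ger0_norm; last by apply: prodr_ge0 => j _; exact: t0.
apply: ler_wpM2l; first by apply: prodr_ge0 => j _; exact: t0.
by apply: wS => j; have [] := in_unit_ball_normalized l (xp j).
Qed.

Let glued_series x : (forall j, in_Xp (p j) (x j)) ->
  cvgn (series (block^~ x)) /\ rnorm (glued x) <= 2 * norms x.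
Proof.
move=> xp; apply: geometric_series => [|l]; last exact: block_bound.
by apply: prodr_ge0 => j _; apply: fine_ge0; exact: seq_norm_ge0.
Qed.

Lemma block_update l x j (a : K) u v : block l (update x j (fun i => a * u i + v i)) =
  a *: block l (update x j u) + block l (update x j v).
Proof.
rewrite /block scaler_sumr -big_split; apply: eq_bigr => i _ /=.
rewrite scalerA -scalerDl; congr (_ *: _).
rewrite [LHS](bigD1 j) // [X in a * X](bigD1 j) // [X in _ + X](bigD1 j) //=.
rewrite /update eqxx mulrDl mulrA; congr (_ * _ + _ * _); apply: eq_bigr => i' /negbTE ->;
by [].
Qed.

Lemma in_Xp_update (x : 'I_m -> nat -> K) j u : (forall i, in_Xp (p i) (x i)) -> in_Xp (p j) u ->
  forall i, in_Xp (p i) (update x j u i).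
Proof. by move=> xp up i; rewrite /update; case: eqP => [->|_]. Qed.

Lemma glued_multilinear : multilinear_on p glued.
Proof.
move=> x j a u v xp up vp.
have [cu _] := glued_series (in_Xp_update xp up).
have [cv _] := glued_series (in_Xp_update xp vp).
rewrite /glued; apply: cvg_lim; first exact: norm_hausdorff.
have -> : series (block^~ (update x j (fun i => a * u i + v i))) =
   (fun N => a *: series (block^~ (update x j u)) N + series (block^~ (update x j v)) N).
  apply/funext => N; rewrite /series /= scaler_sumr -big_split /=.
  by apply: eq_bigr => l _; rewrite block_update.
by apply: cvgD => //; exact: cvgZl_tmp.
Qed.

(** All variables carry the same unit vector, so each coefficient is the power [m > 0] of an
    indicator, and only that of [w l i] is nonzero. *)
Lemma glued_unit_vectors l (i : 'I_(n l)) :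
  glued (fun=> unit_vector R k (position l i)) = w l i.
Proof.
have coef l' i' : \prod_(j < m) unit_vector R k (position l i) (position l' i') =
    ((l' == l) && (i' == i :> nat))%:R :> K.
  rewrite prodr_const card_ord /unit_vector.
  have -> : (position l' i' == position l i) = (l' == l) && (i' == i :> nat).
    apply/eqP/andP => [/position_inj[-> ->]|[/eqP-> /eqP->]] //.
  by case: (_ && _); rewrite ?expr1n // expr0n gtn_eqF.
have blockE l' : block l' (fun=> unit_vector R k (position l i)) = if l' == l then w l i else 0.
  rewrite /block; case: eqP => [->|/eqP/negbTE ll].
    rewrite (bigD1 i) //= coef !eqxx scale1r big1 ?addr0 // => i' ii.
    by rewrite coef eqxx /= -val_eqE in ii *; rewrite (negbTE ii) scale0r.
  by rewrite big1 // => i' _; rewrite coef ll scale0r.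
rewrite /glued; apply: cvg_lim; first exact: norm_hausdorff.
apply: cvg_near_cst; exists l.+1 => // N /= lN.
rewrite /series /= big_mkord (bigD1 (Ordinal lN)) //= blockE eqxx big1 ?addr0 // => l' ll.
by rewrite blockE -[l' == l :> nat]/(l' == Ordinal lN) (negbTE ll).
Qed.

(** The diagonal indices of the first [N] blocks alone contribute at least [N]. *)
Lemma glued_not_summable :
  (\esum_(i in [set: {ffun 'I_m -> nat}])
     (rnorm (glued (fun j => unit_vector R k (i j))) `^ rho)%:E = +oo)%E.
Proof.
apply: eq_infty => B.
have [N HN] : exists N : nat, B <= N%:R.
  by exists (Num.truncn `|B|).+1; apply: le_trans (ler_norm _) (ltW _); exact: truncnS_gt.
apply: (@le_trans _ _ N%:R%:E); first by rewrite lee_fin.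
pose diag l i : {ffun 'I_m -> nat} := [ffun=> position l i].
pose S := [seq diag l i | l <- index_iota 0 N, i <- index_iota 0 (n l)].
have US : uniq S.
  apply: allpairs_uniq_dep; [exact: iota_uniq|by move=> l _; exact: iota_uniq|].
  move=> [l i] [l' i'] _ _ /= /ffunP/(_ (Ordinal m1)); rewrite !ffunE.
  by move=> /position_inj[-> ->].
apply: esum_ge; exists [set` S]; first by split => //; exact: finite_seq.
rewrite -fsbig_seq // big_allpairs_dep big_mkord.
rewrite (eq_bigr (fun l : 'I_N => (\sum_(i < n l) rnorm (w l i) `^ rho)%:E)); last first.
  move=> l _; rewrite big_mkord sumEFin; congr (_%:E); apply: eq_bigr => i _.
  by rewrite -(glued_unit_vectors i); congr (rnorm (glued _) `^ _); apply/funext => j; rewrite ffunE.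
rewrite sumEFin lee_fin; apply: (@le_trans _ _ (\sum_(l < N) 1)); first by rewrite sumr_const card_ord.
by apply: ler_sum => l _; exact: w1.
Qed.

Lemma nonsummable_operator : exists A : ('I_m -> nat -> K) -> X,
  [/\ multilinear_on p A, bounded_on p A &
  (\esum_(i in [set: {ffun 'I_m -> nat}])
     (rnorm (A (fun j => unit_vector R k (i j))) `^ rho)%:E = +oo)%E].
Proof.
exists glued; split; [exact: glued_multilinear| |exact: glued_not_summable].
by exists 2 => x xp; have [] := glued_series xp.
Qed.

End Gluing.

Theorem theorem1p5 (R : realType) (k : scalar_kind)
    (X : completeNormedModType (scalars R k))
    (m : nat) (p : 'I_m -> \bar R) (rho : R) :
  (1 <= m)%N ->
  (forall i : 'I_m, 2%:E <= p i)%E ->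
  infinite_dimensional X ->
  has_cotype X (optimal_cotype X) ->
  (\sum_(i < m) (p i)^-1 < (optimal_cotype X)^-1)%E ->
  0 < rho ->
  (forall A : ('I_m -> nat -> scalars R k) -> X,
      multilinear_on p A -> bounded_on p A ->
      (\esum_(i in [set: {ffun 'I_m -> nat}])
         (rnorm (A (fun j => unit_vector R k (i j))) `^ rho)%:E < +oo)%E)
  <->
  ((rho^-1)%:E <= (optimal_cotype X)^-1 - \sum_(i < m) (p i)^-1)%E.
Proof.
move=> m1 p2 infX cotX sumq rho0.
pose s i := fine (p i)^-1%E.
have ps i : (p i = +oo%E /\ s i = 0) \/ (0 < s i /\ p i = (s i)^-1%:E).
  have := p2 i; rewrite /s; case: (p i) => [r| |] //= r2; last by left.
  have r0 : 0 < r by move: r2; rewrite lee_fin; lra.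
  by right; rewrite inver gt_eqF //= invr_gt0 invrK.
have s0 i : 0 <= s i by have [[_ ->]|[/ltW]] := ps i.
have sumE : (\sum_(i < m) (p i)^-1 = (\sum_i s i)%:E)%E.
  rewrite -sumEFin; apply: eq_bigr => i _; rewrite /s.
  have := p2 i; case: (p i) => [r| |] //= r2.
  have r0 : 0 < r by move: r2; rewrite lee_fin; lra.
  by rewrite inver gt_eqF.
have e0 : 0 <= \sum_i s i by exact: sumr_ge0.
have q2 : (2%:E <= optimal_cotype X)%E by apply: le_ereal_inf_tmp => q /= [].
have qmin q' : 2 <= q' -> has_cotype X q'%:E -> (optimal_cotype X <= q'%:E)%E.
  by move=> q'2 cq; apply: ereal_inf_lbound; split => //; rewrite lee_fin.
rewrite sumE in sumq *; move: cotX sumq q2 qmin.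
case: (optimal_cotype X) => [q| |] cotX sumq q2 qmin; last first.
- by [].
(* An infinite optimal cotype has inverse 0, which cannot exceed the sum of the [1 / p_i]. *)
- by move: sumq; rewrite invey lte_fin ltNge e0.
rewrite lee_fin in q2; have q0 : 0 < q by lra.
move: sumq; rewrite inver gt_eqF // -EFinB lee_fin lte_fin => sumq.
have [Kq Kq0 cotq] := cotype_bound_of_has_cotype cotX.
split=> [all_summable|rhoq A Amul Abnd]; last exact: (summable_of_exponent p2 ps Amul Abnd q2 Kq0 cotq).
rewrite leNgt; apply/negP => rhoq.
have opt q' K' : 2 <= q' -> q' < q -> 0 < K' -> ~ cotype_bound (@rn R k X) q' K'.
  move=> q'2 q'q K'0 /(has_cotype_of_cotype_bound K'0) /(qmin _ q'2).
  by rewrite lee_fin leNgt q'q.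
have fails r C : 0 < r -> r < q -> 0 < C -> exists zs : seq (realified X),
    {in signed_sums zs 0, forall u, C * rn u < (\sum_(z <- zs) rn z `^ r) `^ r^-1}.
  apply: (summing_fails (rn_seminorm X) _ (realified_infinite_dimensional infX) q2 Kq0 cotq opt).
  by move=> x /rnorm_eq0.
have rhoq' : q^-1 < \sum_i s i + rho^-1 by rewrite addrC -ltrBlDr.
(* The bounds [2 ^ (- l)] make the block operators summable in norm, while each block keeps
   [rho]-sum at least 1. *)
have blocks l : exists nw : nat * (nat -> X),
    1 <= \sum_(i < nw.1) rnorm (nw.2 i) `^ rho /\
    forall x : 'I_m -> nat -> scalars R k, (forall j, in_unit_ball s nw.1 j (x j)) ->
      rnorm (\sum_(i < nw.1) (\prod_j x j i) *: nw.2 i) <= (2 ^+ l)^-1.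
  have e2 : 0 < (2 ^+ l)^-1 :> R by rewrite invr_gt0 exprn_gt0.
  have [n [w nw]] := diagonal_blocks s0 q0 sumq rhoq' rho0 fails e2.
  by exists (n, w).
have [nw Hnw] := boolp.choice blocks.
have [A [Amul Abnd Aoo]] := @nonsummable_operator _ _ _ _ _ _ rho m1 ps
  (fun l => (nw l).1) (fun l => (nw l).2) (fun l => proj1 (Hnw l)) (fun l => proj2 (Hnw l)).
by have := all_summable A Amul Abnd; rewrite Aoo ltxx.
Qed.
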